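(* Let $\Bbbk$ be an algebraically closed field of arbitrary characteristic and let $M$ be a free abelian group of rank $n$. Let $A=\{u_0,\ldots,u_N\}\subset M$ be a finite subset with $\operatorname{Aff}(A)=M$. Set $$B:=\{u_{i_0}+u_{i_1}+\cdots+u_{i_n}\in M \mid u_{i_0},u_{i_1},\ldots,u_{i_n}\in A \text{ span the } \Bbbk\text{-affine space } M_{\Bbbk}\},$$ and let $\pi: M\to M':=M/(\langle B-B\rangle_{\mathbb{R}}\cap M)$ be the natural projection. Let $\gamma: X_A\dashrightarrow \mathbb{G}(n,\mathbb{P}^N)$ be the Gauss map of $X_A\subset\mathbb{P}^N$. Then the following hold. (1) The closure $\overline{\gamma(X_A)}$ of the image of $\gamma$, embedded in a projective space by the Plücker embedding of $\mathbb{G}(n,\mathbb{P}^N)$, is projectively equivalent to the toric variety $X_B$. (2) The restriction of $\gamma: X_A\dashrightarrow\overline{\gamma(X_A)}\cong X_B$ to $T_M\subset X_A$ is the morphism $$T_M=\operatorname{Spec}\Bbbk[M]\twoheadrightarrow T_{\langle B-B\rangle}=\operatorname{Spec}\Bbbk[\langle B-B\rangle]\subset X_B$$ induced by the inclusion $\langle B-B\rangle\subset M$. (3) Let $F\subset T_M$ be an irreducible component of any fiber of $\gamma|_{T_M}$, with the reduced structure. Let $T_{M'}\hookrightarrow T_M$ be the subtorus induced by $\pi$. Then $F$ is a translation of $T_{M'}$ by an element of $T_M$, and the closure $\overline{F}\subset X_A$ is projectively equivalent to the toric variety $X_{\pi(A)}$. In particular, $\delta_\gamma(X_A)=\operatorname{rk}M'=n-\operatorname{rk}\langle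 B-B\rangle$.
   Context: For a free abelian group $M$ of finite rank, $T_M=\operatorname{Spec}\Bbbk[M]$, where $\Bbbk[M]=\bigoplus_{u\in M}\Bbbk z^u$ is the group ring, and $M_{\Bbbk}=M\otimes_{\mathbb{Z}}\Bbbk$. For a finite subset $A=\{u_0,\ldots,u_N\}\subset M$ (distinct elements), $X_A\subset\mathbb{P}^N$ is the closure of the image of $\varphi_A: T_M\to\mathbb{P}^N$, $t\mapsto[z^{u_0}(t):\cdots:z^{u_N}(t)]$. $\langle A-A\rangle\subset M$ is the subgroup generated by $A-A=\{u-u'\mid u,u'\in A\}$, and $\langle A-A\rangle_{\mathbb{R}}\subset M\otimes\mathbb{R}$ is the real subspace it spans. The torus $T_{\langle A-A\rangle}$ acts on $X_A$ and is contained in $X_A$ as an open dense orbit (for fixed $u_0\in A$, via $t\mapsto[z^{u_i-u_0}(t)]_i$). $\operatorname{Aff}(A)$ is the affine sublattice of $M$ spanned by $A$, i.e. the set of $\sum_i a_iu_i$ with $a_i\in\mathbb{Z}$, $\sum_i a_i=1$. If $\operatorname{Aff}(A)=M$, then $\varphi_A$ identifies $T_M$ with an open subset of $X_A$. Elements of $M$ span the $\Bbbk$-affine space $M_{\Bbbk}$ if the set of $\Bbbk$-linear combinations of their images in $M_{\Bbbk}$ with coefficient sum $1$ is all of $M_{\Bbbk}$. The Gauss map of an $n$-dimensional projective variety $X\subset\mathbb{P}^N$ is the rational map $\gamma: X\dashrightarrow\mathbb{G}(n,\mathbb{P}^N)$ (Grassmannian of $n$-planes in $\mathbb{P}^N$)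 sending each smooth point $x$ to the embedded tangent space $\mathbb{T}_xX\subset\mathbb{P}^N$. The Gauss defect $\delta_\gamma(X)$ is the dimension of a general fiber of $\gamma$. Projective varieties $X_1\subset\mathbb{P}^{N_1}$ and $X_2\subset\mathbb{P}^{N_2}$ are projectively equivalent if there are linear embeddings $\jmath_i:\mathbb{P}^{N_i}\hookrightarrow\mathbb{P}^{N}$ (i.e. $\jmath_i^*\mathcal{O}(1)=\mathcal{O}(1)$) for some $N$ with $\jmath_1(X_1)=\jmath_2(X_2)$. *)

(* Defs.v *)
From HB Require Import structures.
From mathcomp Require Import all_boot all_order all_algebra finmap.
From mathcomp Require Import boolp classical_sets.
From mathcomp Require Import reals topology_structure.
From mathcomp Require Import -(notations) monalg.
From mathcomp Require Import mpoly.

Set Implicit Arguments.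
Unset Strict Implicit.
Unset Printing Implicit Defensive.

Import GRing.Theory.

Local Open Scope classical_set_scope.
Local Open Scope ring_scope.

(* Varieties are taken classically: over an algebraically closed field, a
   reduced scheme of finite type is given by its closed points with the Zariski
   topology. *)

Section Topology.
Variable T : topologicalType.
Implicit Types S F Z : set T.

Definition irreducible_set S :=
  S !=set0 /\
  forall Z1 Z2, closed Z1 -> closed Z2 -> S `<=` Z1 `|` Z2 ->
    S `<=` Z1 \/ S `<=` Z2.

Definition irreducible_component S F :=
  [/\ irreducible_set F, F `<=` S &
      forall Z, irreducible_set Z -> F `<=` Z -> Z `<=` S -> Z = F].

(* C 0, ..., C d is a strictly increasing chain of irreducible subsets of S
   which are closed for the topology induced on S. *)
Definition irreducible_chain S (d : nat) (C : nat -> set T) :=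
  (forall i, (i <= d)%N -> irreducible_set (C i) /\ C i = S `&` closure (C i)) /\
  (forall i, (i < d)%N -> C i `<` C i.+1).

Definition krull_dim S (d : nat) :=
  (exists C, irreducible_chain S d C) /\
  (forall e C, irreducible_chain S e C -> (e <= d)%N).

End Topology.

(* [PP k m] is the projective space of dimension m - 1: its points are the
   lines of k^m, so the point [v_0 : ... : v_(m-1)] is <[v]>%VS. *)
Record PP (k : fieldType) (m : nat) := Point {
  line :> {vspace 'rV[k]_m};
  _ : \dim line == 1%N }.

HB.instance Definition _ k m := [isSub for @line k m].
HB.instance Definition _ k m := [Choice of PP k m by <:].

Section Zariski.
Variables (k : fieldType) (m : nat).
Implicit Types (F G : {mpoly k[m]}) (x : PP k m) (v w : 'rV[k]_m).

Definition heval F v : k := F.@[fun i => v 0 i].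

Definition vanish F x := forall v, v \in line x -> heval F v = 0.

Definition zariski_open (O : set (PP k m)) :=
  exists S : set {mpoly k[m]},
    (forall F, S F -> exists d, F \is d.-homog) /\
    O = [set x | exists2 F, S F & ~ vanish F x].

Lemma heval_scale F d a v : F \is d.-homog ->
  heval F (a *: v) = a ^+ d * heval F v.
Proof.
move=> hF; rewrite /heval !mevalE mulr_sumr big_seq [RHS]big_seq.
apply: eq_bigr => mu /(dhomog_mf hF) <-; rewrite mulrCA; congr (_ * _).
rewrite [mf in a ^+ mf]mdegE -prodrXr -big_split /=.
by apply: eq_bigr => i _; rewrite mxE exprMn.
Qed.

Lemma nvanishP F d x : F \is d.-homog ->
  ~ vanish F x <-> heval F (vpick (line x)) <> 0.
Proof.
move=> hF; split; last by move=> nz Fx; apply: nz; apply: Fx; exact: memv_pick.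
move=> nFx Fp; apply: nFx => v vx.
have xE : line x = <[vpick (line x)]>%VS.
  apply/eqP; rewrite eq_sym eqEdim -memvE memv_pick /=.
  case: x {Fp vx v} => L /= /eqP dL; rewrite dL dim_vline.
  by case: eqP => // /eqP; rewrite vpick0 -dimv_eq0 dL.
move: vx; rewrite xE => /vlineP[a ->].
by rewrite (heval_scale _ _ hF) Fp mulr0.
Qed.

Lemma zariski_openT : zariski_open setT.
Proof.
exists [set 1]; split=> [F ->|]; first by exists 0%N; exact: dhomog1.
rewrite predeqE => x; split=> // _; exists 1 => // /(_ 0 (mem0v _)).
by rewrite /heval meval1 => /eqP; rewrite oner_eq0.
Qed.

Lemma zariski_openI : setI_closed zariski_open.
Proof.
move=> O1 O2 [S1 [h1 ->]] [S2 [h2 ->]].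
exists [set F | exists F1 F2, [/\ S1 F1, S2 F2 & F = F1 * F2]]; split.
  move=> _ [F1 [F2 [/h1[d1 H1] /h2[d2 H2] ->]]].
  by exists (d1 + d2)%N; exact: dhomogM.
rewrite predeqE => x; split.
  case=> -[F1 S1F1 /[dup] n1] + [F2 S2F2 /[dup] n2].
  have [[d1 H1] [d2 H2]] := (h1 _ S1F1, h2 _ S2F2).
  move=> /(nvanishP _ H1) /eqP e1 /(nvanishP _ H2) /eqP e2.
  exists (F1 * F2); first by exists F1, F2.
  apply/(nvanishP _ (dhomogM H1 H2)); apply/eqP.
  by rewrite /heval mevalM mulf_neq0.
case=> _ [F1 [F2 [S1F1 S2F2 ->]]] n12; split; [exists F1|exists F2] => //.
  by move=> F1x; apply: n12 => v vx; rewrite /heval mevalM -/(heval F1 v) F1x ?mul0r.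
by move=> F2x; apply: n12 => v vx; rewrite /heval mevalM -/(heval F2 v) F2x ?mulr0.
Qed.

Lemma zariski_open_bigU (I : Type) (f : I -> set (PP k m)) :
  (forall i, zariski_open (f i)) -> zariski_open (\bigcup_i f i).
Proof.
move=> /choice[S fS]; exists (\bigcup_i S i); split.
  by move=> F [i _ SF]; exact: (fS i).1.
rewrite predeqE => x; split.
  by case=> i _; rewrite (fS i).2 => -[F SF nF]; exists F => //; exists i.
by case=> F [i _ SF] nF; exists i => //; rewrite (fS i).2; exists F.
Qed.

HB.instance Definition _ := isOpenTopological.Build (PP k m)
  zariski_openT zariski_openI zariski_open_bigU.

End Zariski.

(* Linear embeddings of projective spaces are induced by injective linear
   maps. *)
Definition proj_image (k : fieldType) (m1 m : nat)
    (j : 'Hom('rV[k]_m1, 'rV[k]_m)) (X : set (PP k m1)) : set (PP k m) :=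
  [set y | exists2 x, X x & line y = (j @: line x)%VS].

Definition proj_equiv_via (k : fieldType) (m1 m2 m : nat)
    (j1 : 'Hom('rV[k]_m1, 'rV[k]_m)) (j2 : 'Hom('rV[k]_m2, 'rV[k]_m))
    (X1 : set (PP k m1)) (X2 : set (PP k m2)) :=
  [/\ lker j1 = 0%VS, lker j2 = 0%VS & proj_image j1 X1 = proj_image j2 X2].

Definition proj_equiv (k : fieldType) (m1 m2 : nat)
    (X1 : set (PP k m1)) (X2 : set (PP k m2)) :=
  exists (m : nat) (j1 : 'Hom('rV[k]_m1, 'rV[k]_m))
         (j2 : 'Hom('rV[k]_m2, 'rV[k]_m)), proj_equiv_via j1 j2 X1 X2.

Section Gauss.
Variables (k : fieldType) (m : nat).
Implicit Types (X : set (PP k m)) (x : PP k m) (W : {vspace 'rV[k]_m}).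

(* W is the linear subspace of k^m whose projectivization is the embedded
   tangent space of X at x. *)
Definition is_tangent X x W :=
  forall v : 'rV[k]_m, v \in W <->
    forall (F : {mpoly k[m]}) (d : nat), F \is d.-homog ->
      (forall y, X y -> vanish F y) ->
      forall w, w \in line x -> \sum_(i < m) heval F^`M(i) w * v 0 i = 0.

(* The graph of the Gauss map of X, where n = dim X: a point x of X is smooth
   when the embedded tangent space at x has projective dimension n. *)
Definition gauss X (n : nat) x W :=
  [/\ krull_dim X n, X x, is_tangent X x W & \dim W = n.+1].

(* Plücker coordinates are indexed by the strictly increasing maps
   {0, ..., n} -> {0, ..., m - 1}. *)
Definition pluecker_index (n : nat) : finType :=
  {s : {ffun 'I_n.+1 -> 'I_m} |
    [forall i : 'I_n.+1, forall j : 'I_n.+1, (i < j)%N ==> (s i < s j)%N]}.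

(* A nonzero vector only for \dim W = n.+1. *)
Definition pluecker (n : nat) W : 'rV[k]_#|{: pluecker_index n}| :=
  \row_(J < #|{: pluecker_index n}|)
    \det (\matrix_(i < n.+1, j < n.+1) (vbasis W)`_i 0 (val (enum_val J) j)).

Definition gauss_image X (n : nat) : set (PP k #|{: pluecker_index n}|) :=
  [set y | exists x W, gauss X n x W /\ line y = <[pluecker n W]>%VS].

Arguments gauss_image : clear implicits.

(* dim X = n, and the fibers of the Gauss map over a nonempty open subset of
   the closure of its image have dimension delta. *)
Definition gauss_defect X (n delta : nat) :=
  exists U : set (PP k #|{: pluecker_index n}|),
  [/\ open U, U `&` closure (gauss_image X n) !=set0 &
      forall y, U y -> closure (gauss_image X n) y ->
        krull_dim
          [set x | exists2 W, gauss X n x W & line y = <[pluecker n W]>%VS]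
          delta].

End Gauss.

Arguments gauss_image {k m} X n _.

(* The k-points of Spec k[M] are the k-algebra morphisms k[M] -> k, i.e. the
   group morphisms M -> k^*; z^u is evaluation at u. *)
Record torus (k : fieldType) (M : zmodType) := Torus {
  chi :> M -> k;
  chi0 : chi 0 = 1;
  chiD : forall u v, chi (u + v) = chi u * chi v }.

HB.instance Definition _ k M := gen_eqMixin (torus k M).
HB.instance Definition _ k M := gen_choiceMixin (torus k M).

(* The finite formal sums of c z^u for u in M and c in k. *)
Definition group_ring (k : fieldType) (M : zmodType) : zmodType := monalg.malg M k.

Section TorusTopology.
Variables (k : fieldType) (M : zmodType).
Implicit Types (f g : group_ring k M) (t : torus k M).

Definition teval f t : k := \sum_(u <- monalg.msupp f) monalg.mcoeff u f * t u.

Definition torus_open (O : set (torus k M)) :=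
  exists S : set (group_ring k M), O = [set t | exists2 f, S f & teval f t <> 0].

Lemma tevalE f t : teval f t = monalg.mmap (@idfun k) t f.
Proof. by []. Qed.

Lemma teval_mul f g : exists h, forall t, teval h t = teval f t * teval g t.
Proof.
exists (\sum_(u <- monalg.msupp f) \sum_(v <- monalg.msupp g)
  monalg.mkmalgU (u + v) (monalg.mcoeff u f * monalg.mcoeff v g)).
move=> t; rewrite tevalE raddf_sum /= /teval big_distrl /=.
apply: eq_bigr => u _; rewrite raddf_sum /= big_distrr /=.
by apply: eq_bigr => v _; rewrite monalg.mmapU /= chiD mulrACA.
Qed.

Lemma torus_openT : torus_open setT.
Proof.
exists [set monalg.mkmalgU 0 1]; rewrite predeqE => t; split=> // _.
exists (monalg.mkmalgU 0 1) => //; rewrite tevalE monalg.mmapU /= chi0 mulr1.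
by apply/eqP; rewrite oner_eq0.
Qed.

Lemma torus_openI : setI_closed torus_open.
Proof.
move=> _ _ [S1 ->] [S2 ->].
exists [set h | exists f g, [/\ S1 f, S2 g &
                    forall t, teval h t = teval f t * teval g t]].
rewrite predeqE => t; split.
  case=> -[f Sf /eqP f0] [g Sg /eqP g0]; have [h hE] := teval_mul f g.
  by exists h; [exists f, g | apply/eqP; rewrite hE mulf_neq0].
case=> h [f [g [Sf Sg ->]]] /eqP; rewrite mulf_eq0 negb_or => /andP[/eqP ? /eqP ?].
by split; [exists f | exists g].
Qed.

Lemma torus_open_bigU (I : Type) (f : I -> set (torus k M)) :
  (forall i, torus_open (f i)) -> torus_open (\bigcup_i f i).
Proof.
move=> /choice[S fS]; exists (\bigcup_i S i); rewrite predeqE => t; split.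
  by case=> i _; rewrite (fS i) => -[h Sh nh]; exists h => //; exists i.
by case=> h [i _ Sh] nh; exists i => //; rewrite (fS i); exists h.
Qed.

HB.instance Definition _ := isOpenTopological.Build (torus k M)
  torus_openT torus_openI torus_open_bigU.

Lemma torus_mul0 t1 t2 : t1 0 * t2 0 = 1.
Proof. by rewrite !chi0 mulr1. Qed.

Lemma torus_mulD t1 t2 u v : t1 (u + v) * t2 (u + v) = t1 u * t2 u * (t1 v * t2 v).
Proof. by rewrite !chiD mulrACA. Qed.

Definition torus_mul t1 t2 : torus k M :=
  @Torus k M (fun u => t1 u * t2 u) (torus_mul0 t1 t2) (torus_mulD t1 t2).

End TorusTopology.

Section TorusMap.
Variables (k : fieldType) (M1 M2 : zmodType) (h : {additive M1 -> M2}).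

Lemma torus_map0 (t : torus k M2) : t (h 0) = 1.
Proof. by rewrite raddf0 chi0. Qed.

Lemma torus_mapD (t : torus k M2) u v : t (h (u + v)) = t (h u) * t (h v).
Proof. by rewrite raddfD chiD. Qed.

(* The morphism Spec k[M2] -> Spec k[M1] induced by h. *)
Definition torus_map (t : torus k M2) : torus k M1 :=
  @Torus k M1 (fun u => t (h u)) (torus_map0 t) (torus_mapD t).

End TorusMap.

Definition free_of_rank (M : zmodType) (r : nat) :=
  exists c : {additive M -> 'rV[int]_r}, bijective c.

Definition Aff (M : zmodType) (m : nat) (u : 'I_m -> M) : set M :=
  [set v | exists2 a : 'I_m -> int,
      \sum_i a i = 1 & v = \sum_i u i *~ a i].

Definition span_affine (K : fieldType) (n m : nat) (w : 'I_m -> 'rV[K]_n) :=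
  forall v : 'rV[K]_n, exists2 a : 'I_m -> K,
    \sum_i a i = 1 & v = \sum_i a i *: w i.

Section GeneratedSubgroup.
Variables (M : zmodType) (S : set M).

Definition gen : {pred M} := fun u =>
  `[< forall G : {pred M}, zmod_closed G -> (forall v, S v -> v \in G) ->
        u \in G >].

Lemma gen_zmod_closed : zmod_closed gen.
Proof.
split=> [|u v /asboolP uP /asboolP vP]; apply/asboolP => G hG SG.
  by case: hG.
by have [_ ->] := hG => //; [exact: uP | exact: vP].
Qed.

HB.instance Definition _ := GRing.isZmodClosed.Build M gen gen_zmod_closed.

Lemma mem_gen v : S v -> v \in gen.
Proof. by move=> Sv; apply/asboolP => G _; apply. Qed.

End GeneratedSubgroup.

Definition subgroup (M : zmodType) (G : zmodClosed M) := {v : M | v \in G}.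

HB.instance Definition _ M (G : zmodClosed M) := SubChoice.on (subgroup G).
HB.instance Definition _ M (G : zmodClosed M) :=
  [SubChoice_isSubZmodule of subgroup G by <:].

Section DifferenceLattice.
Variables (M : zmodType) (B : {fset M}).

Definition diffs : set M := [set v | exists b b' : B, v = val b - val b'].

(* <B - B> *)
Definition difflat : zmodType := subgroup (gen diffs).

Lemma diff_subproof (b b' : B) : val b - val b' \in gen diffs.
Proof. by apply: mem_gen; exists b, b'. Qed.

Definition diff (b b' : B) : difflat :=
  (Sub (val b - val b') (diff_subproof b b') : subgroup (gen diffs)).

Definition difflat_incl : {additive difflat -> M} := \val.

End DifferenceLattice.

(* A free abelian group M of rank n is given with an isomorphism c onto Z^n;
   the tensor product of M with a field K is then K^n. *)
Definition scalar_ext (K : fieldType) (M : zmodType) (n : nat)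
    (c : {additive M -> 'rV[int]_n}) (u : M) : 'rV[K]_n :=
  map_mx intr (c u).

Section Saturation.
Variables (R : realType) (M : zmodType) (n : nat).
Variables (c : {additive M -> 'rV[int]_n}) (B : {fset M}).

(* <B - B>_R :&: M *)
Definition satur : {pred M} := fun v =>
  scalar_ext R c v \in
    <<[seq scalar_ext R c (b - b') | b <- B, b' <- B]>>%VS.

Lemma satur_zmod_closed : zmod_closed satur.
Proof.
rewrite /satur /scalar_ext; split=> [|u v].
  by rewrite -topredE /= raddf0 map_mx0 mem0v.
by rewrite -!topredE /= raddfB map_mxB; exact: memvB.
Qed.

HB.instance Definition _ := GRing.isZmodClosed.Build M satur satur_zmod_closed.

Definition satquot : zmodType := Quotient.quot satur.

Definition satproj : {additive M -> satquot} := \pi_(satquot)%qT.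

End Saturation.

Section Toric.
Variables (k : fieldType) (M : zmodType).

(* The graph of phi_A, for A the family u. *)
Definition toric_map (m : nat) (u : 'I_m -> M) (t : torus k M) (x : PP k m) :=
  line x = <[\row_i t (u i)]>%VS.

Definition toric_map_image (m : nat) (u : 'I_m -> M) (F : set (torus k M)) :
    set (PP k m) :=
  [set x | exists2 t, F t & toric_map u t x].

Definition toric (m : nat) (u : 'I_m -> M) : set (PP k m) :=
  closure (toric_map_image u setT).

Definition elems (B : {fset M}) (i : 'I_#|{: B}|) : M := val (enum_val i).

(* The graph of the embedding of the torus of <B - B> in X_B given by
   b0 \in B. *)
Definition orbit_map (B : {fset M}) (b0 : B) (s : torus k (difflat B))
    (y : PP k #|{: B}|) :=
  line y = <[\row_i s (diff (enum_val i) b0)]>%VS.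

End Toric.

Arguments toric k {M m} u _.
Arguments elems {M} B i.

Definition Bset (k : fieldType) (M : zmodType) (n m : nat)
    (c : {additive M -> 'rV[int]_n}) (u : 'I_m -> M) : {fset M} :=
  [fset \sum_j u (s j) | s : {ffun 'I_n.+1 -> 'I_m} in
     [pred s : {ffun 'I_n.+1 -> 'I_m} |
       `[< span_affine (fun j => scalar_ext k c (u (s j))) >]]]%fset.

(* The fiber over W of the restriction to T_M of the Gauss map of X_A. *)
Definition torus_fiber (k : fieldType) (M : zmodType) (n m : nat)
    (u : 'I_m -> M) (W : {vspace 'rV[k]_m}) : set (torus k M) :=
  [set t | exists2 x, toric_map u t x & gauss (toric k u) n x W].

(* Main.v *)
Require Import Defs.
From HB Require Import structures.
From mathcomp Require Import all_boot all_order all_algebra finmap.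
From mathcomp Require Import boolp classical_sets.
From mathcomp Require Import reals topology_structure.
From mathcomp Require Import -(notations) monalg.
From mathcomp Require Import mpoly.

Set Implicit Arguments.
Unset Strict Implicit.
Unset Printing Implicit Defensive.

Import GRing.Theory.

Local Open Scope classical_set_scope.
Local Open Scope ring_scope.

(** The torus acts on [X_A] by linear automorphisms, so everything is decided by
    one computation: the tangent space of [X_A] at the torus point [t] is the row
    space of the matrix with columns [t(u_j) * (1, u_j)].  It contains the
    derivatives along one-parameter subgroups, and it is no larger because the
    binomials vanishing on [X_A] record every integral relation between the
    points (1, u_j).  As [A] affinely generates the lattice, the integral matrix
    of these points has a left inverse and keeps rank [n + 1] over a field of any
    characteristic ([affine_left_inverse], [tangent_toric_pt]).

    The maximal minor of that matrix at the columns [J] is the determinant of the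
    points (1, u_j), j in [J], times the character [sum_J u_j] at [t]; the
    determinant is nonzero exactly when these points span the affine space over
    the field.  The Gauss map on the torus is therefore the monomial map of [B]
    followed by a linear embedding ([minors_tangent_mx], [exists_Bset_embedding]).
    For the closures to agree, smooth points outside the torus must bring nothing
    new: near a smooth point the tangent spaces have polynomial Pluecker
    coordinates, so the equations of the Gauss image persist ([gauss_closure]).

    Two torus points have the same tangent space if and only if the characters in
    <B - B> agree on them ([rowsp_tangent_mxP]).  In a basis adapted to <B - B>,
    given by the Smith normal form, this reads [t_i ^ d_i = t0_i ^ d_i] for
    [i < r].  Extracting roots extends characters from <B - B> to the lattice; on
    an irreducible set the coordinates [t_i], which take finitely many values,
    are constant, so the components of the fibres are cosets of the subtorus
    dual to the quotient by the saturation ([component_coset]).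

    Dimensions are measured by chains.  A chain of irreducible closed sets in
    [X_A] yields independent monomials in forms separating its members, and
    there are too many of them if the chain is longer than the rank
    ([projective_chain_length_le]).  Conversely, sweeping a point by one-parameter
    subgroups produces chains.  For a fibre of the Gauss map, which may also
    contain points outside the torus, the upper bound follows by prolonging a
    chain in the fibre: sweeping its last member by the first [r] one-parameter
    subgroups moves the image under the Gauss map, hence gives [r] further steps
    ([fibre_sweep_strict], [krull_dim_gauss_fibre]). *)

(** * Polynomials on projective space *)

Lemma poly_eq0_units (k : closedFieldType) (p : {poly k}) :
  (forall a, a != 0 -> p.[a] = 0) -> p = 0.
Proof.
move=> p0; suff /eqP : p * 'X = 0 by rewrite mulf_eq0 polyX_eq0 orbF => /eqP.
apply/eqP/negPn/negP => /closed_nonrootP[a]; rewrite rootE hornerM hornerX.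
by have [->|/p0->] := eqVneq a 0; rewrite ?mulr0 ?mul0r eqxx.
Qed.

Lemma closed_field_root (k : closedFieldType) (d : nat) (c : k) :
  (0 < d)%N -> exists a, a ^+ d = c.
Proof.
move=> d0; have [|a] := @closed_rootP k ('X^d - c%:P) _.
  by rewrite size_XnsubC // eqSS -lt0n.
by rewrite rootE !hornerE subr_eq0 => /eqP <-; exists a.
Qed.

Lemma rmorph_mmap (m : nat) (k R S : comNzRingType) (f : {rmorphism R -> S})
    (h : k -> R) (q : 'I_m -> R) (F : {mpoly k[m]}) :
  f (mmap h q F) = mmap (f \o h) (f \o q) F.
Proof.
rewrite /mmap rmorph_sum; apply: eq_bigr => mu _; rewrite rmorphM; congr (_ * _).
by rewrite /mmap1 rmorph_prod; apply: eq_bigr => i _; rewrite rmorphXn.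
Qed.

Section PolynomialCurves.
Variables (k : closedFieldType) (m : nat).
Implicit Types (F : {mpoly k[m]}) (v : 'rV[k]_m).

Definition along (q : 'I_m -> {poly k}) F : {poly k} := mmap (@polyC k) q F.

Lemma horner_along q F a :
  (along q F).[a] = heval F (\row_i (q i).[a]).
Proof.
rewrite /along -horner_evalE rmorph_mmap /heval /meval /mmap.
apply: eq_bigr => mu _; rewrite /= horner_evalE hornerC; congr (_ * _).
by apply: eq_bigr => i _; rewrite mxE /= horner_evalE.
Qed.

Definition along_line v F : {poly k} := along (fun i => v 0 i *: 'X) F.

Lemma horner_along_line v F a : (along_line v F).[a] = heval F (a *: v).
Proof.
rewrite horner_along; congr (heval _ _); apply/rowP => i.
by rewrite !mxE hornerZ hornerX mulrC.
Qed.

Lemma along_lineM v F G : along_line v (F * G) = along_line v F * along_line v G.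
Proof. exact: rmorphM. Qed.

Lemma heval_homog_sum F v a :
  heval F (a *: v) = \sum_(d < msize F) a ^+ d * heval (pihomog mdeg d F) v.
Proof.
rewrite {1}(pihomog_partitionE (leqnn (msize F))) /heval rmorph_sum.
by apply: eq_bigr => d _; apply: heval_scale; exact: pihomogP.
Qed.

Lemma heval_pihomog_eq0 F v :
  (forall a, a != 0 -> heval F (a *: v) = 0) ->
  forall d, heval (pihomog mdeg d F) v = 0.
Proof.
move=> F0 d; have [dF|Fd] := ltnP d (msize F); last first.
  suff -> : pihomog mdeg d F = 0 by rewrite /heval meval0.
  rewrite /pihomog big1_seq // => mu /andP[/eqP mud /msize_mdeg_lt].
  by rewrite mud ltnNge Fd.
pose p : {poly k} := \poly_(i < msize F) heval (pihomog mdeg i F) v.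
have p0 : p = 0.
  apply: poly_eq0_units => a a0; rewrite horner_poly -[RHS](F0 _ a0).
  by rewrite heval_homog_sum; apply: eq_bigr => i _; rewrite mulrC.
by have /(congr1 (fun q : {poly k} => q`_d)) := p0; rewrite coef_poly dF coef0.
Qed.

End PolynomialCurves.

(** * Points, lines and the Zariski closure *)

Lemma closure_sub_closed (T : topologicalType) (Z C : set T) :
  closed C -> Z `<=` C -> closure Z `<=` C.
Proof. by move=> /closure_id {2}->; exact: closure_subset. Qed.

Section Points.
Variables (k : closedFieldType) (m : nat).
Implicit Types (F G : {mpoly k[m]}) (x y : PP k m) (v w : 'rV[k]_m).

Lemma PP_eq x y : line x = line y -> x = y.
Proof. exact: val_inj. Qed.

Lemma pt_subproof v : v != 0 -> \dim <[v]>%VS == 1%N.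
Proof. by rewrite dim_vline => ->. Qed.

Definition pt v (v0 : v != 0) : PP k m := Point (pt_subproof v0).

Lemma line_mem x v : v != 0 -> v \in line x -> line x = <[v]>%VS.
Proof.
move=> v0 vx; apply/eqP; rewrite eq_sym eqEdim -memvE vx /=.
by case: x {vx} => L /= /eqP->; rewrite dim_vline v0.
Qed.

Lemma line_neq0 x v : line x = <[v]>%VS -> v != 0.
Proof.
case: x => L /= dL LE; move: dL; rewrite LE dim_vline.
by case: (v == 0).
Qed.

Lemma lineP x : exists2 v, v != 0 & line x = <[v]>%VS.
Proof.
have nz : vpick (line x) != 0.
  by case: x => L /= /eqP dL; rewrite vpick0 -dimv_eq0 dL.
by exists (vpick (line x)) => //; apply: line_mem => //; exact: memv_pick.
Qed.

Lemma eq_vline v w : v != 0 -> <[v]>%VS = <[w]>%VS :> {vspace _} ->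
  exists2 a, a != 0 & v = a *: w.
Proof.
move=> v0 vw; have : v \in <[w]>%VS by rewrite -vw memv_line.
case/vlineP=> a va; exists a => //.
by apply: contra v0 => /eqP a0; rewrite va a0 scale0r.
Qed.

Lemma vline_scale a v : a != 0 -> <[a *: v]>%VS = <[v]>%VS :> {vspace _}.
Proof.
move=> a0; apply/eqP; rewrite eqEsubv -!memvE; apply/andP; split.
  by rewrite memvZ ?memv_line.
by apply/vlineP; exists a^-1; rewrite scalerA mulVf ?scale1r.
Qed.

Lemma vanish_lineP F x v : line x = <[v]>%VS ->
  vanish F x <-> (forall a, heval F (a *: v) = 0).
Proof.
move=> xv; split=> [Fx a|F0 w]; first by apply: Fx; rewrite xv memvZ ?memv_line.
by rewrite xv => /vlineP[a ->].
Qed.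

Lemma vanish_unitsP F x v : line x = <[v]>%VS ->
  vanish F x <-> (forall a, a != 0 -> heval F (a *: v) = 0).
Proof.
move=> xv; rewrite (vanish_lineP _ xv); split=> [F0 a _|F0 a]; first exact: F0.
rewrite -horner_along_line [along_line v F]poly_eq0_units ?horner0 // => b b0.
by rewrite horner_along_line F0.
Qed.

Lemma vanish_homogP F d x v : F \is d.-homog -> line x = <[v]>%VS ->
  vanish F x <-> heval F v = 0.
Proof.
move=> hF xv; rewrite (vanish_lineP _ xv); split=> [/(_ 1)|F0 a].
  by rewrite scale1r.
by rewrite (heval_scale _ _ hF) F0 mulr0.
Qed.

(** A line is parametrized by an infinite field, so the polynomial functions on it
    form a domain. *)
Lemma vanishM F G x : vanish (F * G) x <-> vanish F x \/ vanish G x.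
Proof.
have [v v0 xv] := lineP x; rewrite !(vanish_lineP _ xv); split; last first.
  by case=> H a; rewrite /heval mevalM -!/(heval _ _) H ?mul0r ?mulr0.
move=> FG0; have /eqP : along_line v F * along_line v G = 0.
  apply: poly_eq0_units => a _.
  by rewrite -along_lineM horner_along_line FG0.
by rewrite mulf_eq0 => /orP[]/eqP p0; [left|right] => a;
  rewrite -horner_along_line p0 horner0.
Qed.

Lemma vanish_pihomog F x d : vanish F x -> vanish (pihomog mdeg d F) x.
Proof.
have [v v0 xv] := lineP x; move=> /(vanish_unitsP _ xv) F0.
apply/(vanish_homogP (pihomogP _ _ _) xv); exact: heval_pihomog_eq0.
Qed.

Lemma PP_openE (O : set (PP k m)) : open O = zariski_open O.
Proof. by []. Qed.

Lemma closed_homog F d : F \is d.-homog -> closed [set x | vanish F x].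
Proof.
move=> hF; rewrite -openC; exists [set F]; split=> [_ ->|]; first by exists d.
by rewrite predeqE => x; split=> [nF|[_ ->]]; [exists F|].
Qed.

Lemma closed_separate (C : set (PP k m)) x : closed C -> ~ C x ->
  exists F d, [/\ F \is d.-homog, forall y, C y -> vanish F y & ~ vanish F x].
Proof.
rewrite -openC => -[S [hS CE]] nCx.
have : (~` C) x by [].
rewrite CE => -[F SF nF]; have [d hF] := hS _ SF; exists F, d; split=> // y Cy.
apply: contrapT => nFy; have : (~` C) y by rewrite CE; exists F.
by apply.
Qed.

(** Polynomials of mixed degree cut out the same closed sets as forms: over an
    infinite field a polynomial vanishes on a line through the origin if and
    only if all its homogeneous parts do.  This is what lets determinants and
    adjugates be used below without keeping track of degrees. *)
Lemma closureP (S : set (PP k m)) x :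
  closure S x <->
  forall F, (forall y, S y -> vanish F y) -> vanish F x.
Proof.
split=> [Sx F FS|H].
  have [v v0 xv] := lineP x; apply/(vanish_lineP _ xv) => a.
  rewrite heval_homog_sum big1 // => d _.
  suff /(vanish_homogP (pihomogP _ _ _) xv)-> : vanish (pihomog mdeg d F) x.
    by rewrite mulr0.
  have Cd := @closed_homog _ _ (pihomogP mdeg d F).
  by apply: (closure_sub_closed Cd) Sx => y /FS /(vanish_pihomog d).
rewrite closureEbigcap => C [closedC SC]; apply: contrapT => nCx.
have [F [d [_ FC nFx]]] := closed_separate closedC nCx.
by apply: nFx; apply: H => y /SC; exact: FC.
Qed.

Lemma closure_homog (S : set (PP k m)) x :
  (forall F d, F \is d.-homog -> (forall y, S y -> vanish F y) -> vanish F x) ->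
  closure S x.
Proof.
move=> H; rewrite closureEbigcap => C [closedC SC]; apply: contrapT => nCx.
have [F [d [hF FC nFx]]] := closed_separate closedC nCx.
by apply: nFx; apply: (H F d) => // y /SC; exact: FC.
Qed.

Lemma closed_vanish F : closed [set x | vanish F x].
Proof.
apply/closure_id/seteqP; split; first exact: subset_closure.
by move=> x /closureP; apply.
Qed.

Lemma irreducible_vanishM (D : set (PP k m)) F G : irreducible_set D ->
  (forall x, D x -> vanish (F * G) x) ->
  (forall x, D x -> vanish F x) \/ (forall x, D x -> vanish G x).
Proof.
move=> [_ irr] FG; have := irr _ _ (@closed_vanish F) (@closed_vanish G).
by apply=> x /FG /vanishM.
Qed.

End Points.

(** * Krull dimension of sets parametrized by monomials *)

Section DimensionBound.
Variables (k : closedFieldType) (m : nat).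
Implicit Types (F G P : {mpoly k[m]}) (V : set 'rV[k]_m).

Definition null F V := forall v, V v -> heval F v = 0.

(** The polynomials null on [V] form a prime ideal. *)
Definition prime_cone V := V !=set0 /\
  forall F G, null (F * G) V -> null F V \/ null G V.

Lemma prime_coneX V F j : prime_cone V -> null (F ^+ j) V -> null F V.
Proof.
move=> [[v0 Vv0] pV]; elim: j => [|j IHj].
  by move=> /(_ _ Vv0) /eqP; rewrite expr0 /heval meval1 oner_eq0.
by rewrite exprS => /pV[].
Qed.

Lemma msizeM_leq P F : (msize (P * F) <= msize P + msize F)%N.
Proof.
have [->|P0] := eqVneq P 0; first by rewrite mul0r msize0.
have [->|F0] := eqVneq F 0; first by rewrite mulr0 msize0.
by rewrite msizeM // leq_pred.
Qed.

Lemma msizeX_leq F j : (msize (F ^+ j) <= j * msize F + 1)%N.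
Proof.
elim: j => [|j IHj]; first by rewrite expr0 msize1.
rewrite exprS (leq_trans (msizeM_leq _ _)) // mulSn -addnA leq_add2l.
exact: IHj.
Qed.

(** The lower bound on dimension contained in a chain of primes: if [F i]
    vanishes on [V i] but not on [V i.+1], a relation between monomials in the
    [F i] can be divided by the highest possible power of the last one, and then
    restricted to the previous member of the chain, where only the terms free of
    it survive. *)
Lemma chain_independent (V : nat -> set 'rV[k]_m) (F : nat -> {mpoly k[m]})
    (d h : nat) :
  (forall i, (i <= h)%N -> prime_cone (V i)) ->
  (forall i, (i < h)%N ->
     [/\ V i `<=` V i.+1, null (F i) (V i) & ~ null (F i) (V i.+1)]) ->
  exists (I : finType) (P : I -> {mpoly k[m]}),
    [/\ #|I| = (d.+1 ^ h)%N,
        forall i, (msize (P i) <= d * (\sum_(j < h) msize (F j)) + h.+1)%N &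
        forall c : I -> k, null (\sum_i c i *: P i) (V h) -> forall i, c i = 0].
Proof.
elim: h => [|h IHh] pV chF.
  exists unit, (fun=> 1); split=> [|i|c]; first by rewrite card_unit.
    by rewrite big_ord0 muln0 msize1.
  have [[v Vv] _] := pV 0%N isT; move=> /(_ _ Vv) + [].
  by rewrite (big_pred1 tt) => [|[]] //; rewrite /heval mevalZ meval1 mulr1.
have [I [P [cI sP indP]]] :
    exists (I : finType) (P : I -> {mpoly k[m]}),
    [/\ #|I| = (d.+1 ^ h)%N,
        forall i, (msize (P i) <= d * (\sum_(j < h) msize (F j)) + h.+1)%N &
        forall c : I -> k, null (\sum_i c i *: P i) (V h) -> forall i, c i = 0].
  by apply: IHh => i ih; [apply: pV; exact: leqW | apply: chF; exact: leqW].
have [VV FV nFV] := chF h (ltnSn h).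
exists (I * 'I_d.+1)%type, (fun ij : I * 'I_d.+1 => P ij.1 * F h ^+ ij.2).
split.
- by rewrite card_prod cI card_ord expnSr.
- move=> [i j] /=; rewrite big_ord_recr /= mulnDr.
  apply: leq_trans (msizeM_leq _ _) _.
  apply: leq_trans (leq_add (sP i) (msizeX_leq _ _)) _.
  rewrite addnACA addn1 leq_add2r leq_add2l leq_mul2r.
  by rewrite -ltnS ltn_ord orbT.
move=> c c0.
pose S (j : 'I_d.+1) := \sum_i c (i, j) *: P i.
have sumE : \sum_ij c ij *: (P ij.1 * F h ^+ ij.2) = \sum_j S j * F h ^+ j.
  transitivity (\sum_i \sum_j c (i, j) *: (P i * F h ^+ (j : 'I_d.+1))).
    by rewrite pair_bigA; apply: eq_bigr => -[].
  rewrite exchange_big; apply: eq_bigr => j _; rewrite mulr_suml.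
  by apply: eq_bigr => i _; rewrite scalerAl.
suff cj j : (j < d.+1)%N -> forall jj : 'I_d.+1, jj = j :> nat ->
    forall i, c (i, jj) = 0.
  by move=> [i j]; exact: (cj j).
(* Coefficients vanish by strong induction on the exponent of the last form. *)
elim/ltn_ind: j => j IHj jd jj jjE.
have Sl (l : 'I_d.+1) : (l < j)%N -> S l = 0.
  move=> lj; rewrite /S big1 // => i _.
  by rewrite (IHj l lj (ltn_ord l)) // scale0r.
pose T := \sum_(l < d.+1 | (j <= l)%N) S l * F h ^+ (l - j).
have FT : \sum_l S l * F h ^+ l = F h ^+ j * T.
  rewrite (bigID (fun l : 'I__ => (j <= l)%N)) /= [X in _ + X]big1 ?addr0.
    rewrite mulr_sumr; apply: eq_bigr => l jl.
    by rewrite mulrCA -exprD subnKC.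
  by move=> l; rewrite -ltnNge => /Sl->; rewrite mul0r.
move: c0; rewrite sumE FT => /(pV h.+1 (leqnn _)).2[].
  by move/(prime_coneX (pV h.+1 (leqnn _))).
move=> T0; apply: (indP (fun i => c (i, jj))) => v Vv.
rewrite -[RHS](T0 v (VV v Vv)) /T (bigD1 jj) ?jjE //= subnn expr0 mulr1.
rewrite /heval [RHS]mevalD [X in _ = _ + X]raddf_sum [X in _ = _ + X]big1.
  by rewrite addr0.
move=> i /andP[ji ijj].
have jlti : (j < i)%N by rewrite ltn_neqAle ji andbT -jjE eq_sym.
by rewrite /= mevalM rmorphXn /= -/(heval (F h) v) FV // expr0n subn_eq0
  leqNgt jlti mulr0.
Qed.

Variables (q : nat) (l : 'I_m -> 'I_q -> nat).

Definition monomial_map (y : 'rV[k]_q) : 'rV[k]_m :=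
  \row_j \prod_i y 0 i ^+ l j i.

(** The upper bound on dimension: polynomials of degree at most [E] pull back to
    combinations of monomials whose exponents lie in a box of size linear in
    [E]. *)
Lemma monomial_map_dependent (I : finType) (P : I -> {mpoly k[m]}) (E K : nat) :
  (forall i, (msize (P i) <= E)%N) -> (forall j i, (l j i <= K)%N) ->
  ((E * K).+1 ^ q < #|I|)%N ->
  exists c : I -> k, (exists i, c i != 0) /\
    forall y, heval (\sum_i c i *: P i) (monomial_map y) = 0.
Proof.
move=> sP lK big.
pose box := {ffun 'I_q -> 'I_(E * K).+1}.
pose ex (mu : 'X_{1..m}) i := (\sum_j mu j * l j i)%N.
pose beta (mu : 'X_{1..m}) : box := [ffun i => inord (ex mu i)].
pose A := \matrix_(i < #|I|, b < #|box|)
  \sum_(mu <- msupp (P (enum_val i)) | beta mu == enum_val b)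
     (P (enum_val i))@_mu.
have : kermx A != 0.
  rewrite -mxrank_eq0 mxrank_ker -lt0n subn_gt0.
  by apply: leq_ltn_trans (rank_leq_col A) _; rewrite card_ffun !card_ord.
case/rowV0Pn=> w /sub_kermxP wA w0.
exists (fun i => w 0 (enum_rank i)); split.
  case/rV0Pn: w0 => i wi; exists (enum_val i); by rewrite enum_valK.
move=> y; pose Y (b : box) := \prod_i y 0 i ^+ b i.
have PE i : heval (P i) (monomial_map y) = \sum_b A (enum_rank i) b * Y (enum_val b).
  transitivity (\sum_(b : box)
      (\sum_(mu <- msupp (P i) | beta mu == b) (P i)@_mu) * Y b); last first.
    rewrite (reindex_onto enum_val enum_rank) => [|b _] /=; last exact: enum_rankK.
    rewrite (eq_bigl xpredT) => [|b]; last by rewrite enum_valK eqxx.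
    by apply: eq_bigr => b _; rewrite mxE enum_rankK.
  rewrite /heval mevalE.
  transitivity (\sum_(mu <- msupp (P i)) (P i)@_mu * Y (beta mu)).
    apply: eq_big_seq => mu muP /=; congr (_ * _).
    rewrite /Y; under eq_bigr => j _ do rewrite mxE -prodrXl.
    rewrite exchange_big /=; apply: eq_bigr => j _; rewrite ffunE inordK.
      by rewrite /ex -prodrXr; apply: eq_bigr => i' _; rewrite -exprM mulnC.
    rewrite ltnS /ex (leq_trans (n := (\sum_j mu j * K)%N)) //.
      by apply: leq_sum => i' _; rewrite leq_mul2l lK orbT.
    rewrite -big_distrl /= -mdegE leq_mul2r; apply/orP; right.
    by apply: ltnW; apply: leq_trans (sP i); exact: msize_mdeg_lt.
  rewrite (partition_big beta xpredT) //=.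
  apply: eq_bigr => b _; rewrite mulr_suml; apply: eq_bigr => mu /eqP <- //.
rewrite /heval rmorph_sum /=.
under eq_bigr => i _.
  rewrite mevalZ -/(heval _ _) PE mulr_sumr.
  under eq_bigr => b _ do rewrite mulrA.
  over.
rewrite exchange_big big1 //= => b _; rewrite -mulr_suml.
have -> : \sum_i w 0 (enum_rank i) * A (enum_rank i) b = (w *m A) 0 b.
  rewrite mxE (reindex_onto enum_val enum_rank) => [|i _] /=; last exact: enum_rankK.
  rewrite (eq_bigl xpredT) => [|i]; last by rewrite enum_valK eqxx.
  by apply: eq_bigr => i _; rewrite enum_valK.
by rewrite wA mxE mul0r.
Qed.

(** Along a chain of length [h] there are [d.+1 ^ h] independent monomials of
    degree linear in [d], while on the image of [k ^ q] their span has dimension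
    bounded by a polynomial of degree [q] in [d]. *)
Lemma chain_length_le (V : nat -> set 'rV[k]_m) (F : nat -> {mpoly k[m]})
    (h : nat) :
  (forall i, (i <= h)%N -> prime_cone (V i)) ->
  (forall i, (i < h)%N ->
     [/\ V i `<=` V i.+1, null (F i) (V i) & ~ null (F i) (V i.+1)]) ->
  (forall G, (forall y, heval G (monomial_map y) = 0) -> null G (V h)) ->
  (h <= q)%N.
Proof.
move=> pV chF Vh; rewrite leqNgt; apply/negP => qh.
pose K := (\sum_j \sum_i l j i)%N.
have lK j i : (l j i <= K)%N.
  by rewrite /K (bigD1 j) //= (bigD1 i) //= -addnA leq_addr.
pose S := (\sum_(j < h) msize (F j))%N; pose c := ((S + h.+1) * K).+1.
(* With d = c ^ q the box has (c * d) ^ q = d ^ q.+1 elements at most. *)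
pose d := (c ^ q)%N.
have d0 : (0 < d)%N by rewrite expn_gt0.
have [I [P [cI sP indP]]] := chain_independent d pV chF.
have [||ci [[i ci0] c0]] := @monomial_map_dependent I P (d * (S + h.+1)) K _ lK.
- move=> i; apply: leq_trans (sP i) _; rewrite mulnDr leq_add2l.
  by rewrite leq_pmull.
- rewrite cI; apply: (@leq_ltn_trans ((c * d) ^ q)).
    have [->|q0] := posnP q; first by rewrite !expn0.
    by rewrite leq_exp2r // /c mulSn -mulnA mulnC -addn1 addnC leq_add // mulnC.
  rewrite expnMn -/d -expnS; apply: leq_trans (leq_pexp2l _ qh) => //.
  by rewrite ltn_exp2r.
case/eqP: ci0; apply: indP; exact: Vh.
Qed.
End DimensionBound.

Section Cones.
Variables (k : closedFieldType) (m : nat).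
Implicit Types (F G : {mpoly k[m]}) (D X : set (PP k m)).

Definition cone D : set 'rV[k]_m := [set v | exists2 x, D x & v \in line x].

Lemma null_cone F D : null F (cone D) <-> (forall x, D x -> vanish F x).
Proof.
split=> [F0 x Dx v vx|F0 v [x Dx vx]]; last exact: F0 vx.
by apply: F0; exists x.
Qed.

Lemma prime_cone_irreducible D : irreducible_set D -> prime_cone (cone D).
Proof.
move=> irrD; split; first by have [[x Dx] _] := irrD; exists 0, x; rewrite ?mem0v.
by move=> F G; rewrite !null_cone; exact: irreducible_vanishM.
Qed.

(** The bound is applied to the cones over the members of the chain, preceded by
    the vertex; the additional step accounts for the homogenizing parameter. *)
Lemma projective_chain_length_le X q (l : 'I_m -> 'I_q -> nat)
    (D_ : nat -> set (PP k m)) e :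
  (forall G, (forall y, heval G (monomial_map l y) = 0) ->
     forall x, X x -> vanish G x) ->
  (forall i, (i <= e)%N -> irreducible_set (D_ i) /\ closed (D_ i)) ->
  (forall i, (i < e)%N -> D_ i `<` D_ i.+1) -> D_ e `<=` X ->
  (e < q)%N.
Proof.
move=> XP irrD ltD DX.
have [[x0 D0x0] _] := (irrD 0%N isT).1.
have [v0 v00 x0v0] := lineP x0.
have [j v0j] : exists j, v0 0 j != 0 by apply/rV0Pn.
have /choice[F FP] i : exists F, (i < e)%N ->
    (forall x, D_ i x -> vanish F x) /\ ~ (forall x, D_ i.+1 x -> vanish F x).
  have [ie|_] := boolP (i < e)%N; last by exists 0.
  have [DD nDD] := ltD i ie.
  have [x Dx nDx] : exists2 x, D_ i.+1 x & ~ D_ i x.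
    apply: contrapT => H; apply: nDD => x Dx; apply: contrapT => nx.
    by apply: H; exists x.
  have [F [d [_ FD nFx]]] := closed_separate (irrD i (ltnW ie)).2 nDx.
  by exists F => _; split=> // H; apply: nFx; exact: H.
pose V i := if i is i'.+1 then cone (D_ i') else [set 0].
pose G i := if i is i'.+1 then F i' else 'X_j : {mpoly k[m]}.
apply: (@chain_length_le k m q l V G e.+1).
- case=> [_|i ie]; last exact: prime_cone_irreducible (irrD i ie).1.
  split; first by exists 0.
  move=> P Q /(_ 0 erefl) /eqP; rewrite /heval mevalM mulf_eq0.
  by case/orP=> /eqP PQ0; [left|right] => _ ->.
- case=> [_|i ie] /=.
    split; first by move=> _ ->; exists x0; rewrite ?mem0v.
      by move=> _ ->; rewrite /heval mevalXU mxE.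
    move/null_cone/(_ _ D0x0)/(_ v0); rewrite x0v0 memv_line => /(_ isT) /eqP.
    by rewrite /heval mevalXU (negPf v0j).
  have [F1 F2] := FP i ie; split; rewrite ?null_cone //.
  by have [DD _] := ltD i ie; move=> v [x Dx vx]; exists x => //; exact: DD.
by move=> P P0; apply/null_cone => x /DX; exact: XP.
Qed.

End Cones.

(** * Tori and one-parameter subgroups *)

Section TorusPoints.
Variables (k : closedFieldType) (M : zmodType).
Implicit Types (t s g : torus k M) (u v : M).

Lemma torus_ext t s : t =1 s -> t = s.
Proof.
case: t s => [f f0 fD] [h h0 hD] /= /funext fh; case: _ / fh in h0 hD *.
by congr Torus; exact: Prop_irrelevance.
Qed.

Lemma torus_neq0 t u : t u != 0.
Proof.
by apply/eqP => tu; have /eqP := chiD t u (- u); rewrite subrr chi0 tu mul0r oner_eq0.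
Qed.

Lemma torusN t u : t (- u) = (t u)^-1.
Proof.
apply: (mulfI (torus_neq0 t u)).
by rewrite -chiD subrr chi0 mulfV ?torus_neq0.
Qed.

Lemma torusB t u v : t (u - v) = t u / t v.
Proof. by rewrite chiD torusN. Qed.

Lemma torusMn t u (n : nat) : t (u *+ n) = t u ^+ n.
Proof. by elim: n => [|n IHn]; rewrite ?mulr0n ?chi0 // mulrSr chiD IHn exprSr. Qed.

Lemma torusMz t u (a : int) : t (u *~ a) = t u ^ a.
Proof.
case: a => n; first by rewrite -pmulrn torusMn.
by rewrite NegzE mulrNz torusN -pmulrn torusMn -invr_expz.
Qed.

Lemma torus_sum t (I : Type) (r : seq I) (P : pred I) (w : I -> M) :
  t (\sum_(i <- r | P i) w i) = \prod_(i <- r | P i) t (w i).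
Proof. exact: (big_morph (chi t) (chiD t) (chi0 t)). Qed.

Lemma torus_lincomb t (I : finType) (w : I -> M) (a : I -> int) :
  t (\sum_i w i *~ a i) = \prod_i t (w i) ^ a i.
Proof. by rewrite torus_sum; apply: eq_bigr => i _; rewrite torusMz. Qed.

Lemma torus1_subproof : (fun _ : M => 1 : k) 0 = 1. Proof. by []. Qed.
Lemma torus1D_subproof (u v : M) : 1 = 1 * 1 :> k. Proof. by rewrite mulr1. Qed.
Definition torus1 : torus k M := Torus torus1_subproof torus1D_subproof.

Lemma torusV0 t : (t 0)^-1 = 1. Proof. by rewrite chi0 invr1. Qed.
Lemma torusVD t u v : (t (u + v))^-1 = (t u)^-1 * (t v)^-1.
Proof. by rewrite chiD invfM. Qed.
Definition torus_inv t : torus k M :=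
  @Torus k M (fun u => (t u)^-1) (torusV0 t) (torusVD t).

(** Extended by [1] at [0], so that one-parameter subgroups are total functions
    of their parameter. *)
Definition unit_part (a : k) : k := if a == 0 then 1 else a.

Lemma unit_part_neq0 a : unit_part a != 0.
Proof. by rewrite /unit_part; case: (eqVneq a 0) => // _; exact: oner_neq0. Qed.

Lemma unit_partE a : a != 0 -> unit_part a = a.
Proof. by rewrite /unit_part => /negPf->. Qed.

Variable lam : {additive M -> int}.

Lemma cochar0_subproof a : unit_part a ^ lam 0 = 1.
Proof. by rewrite raddf0 expr0z. Qed.
Lemma cocharD_subproof a u v :
  unit_part a ^ lam (u + v) = unit_part a ^ lam u * unit_part a ^ lam v.
Proof. by rewrite raddfD expfzDr ?unit_part_neq0. Qed.
Definition cochar a : torus k M :=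
  @Torus k M (fun u => unit_part a ^ lam u)
    (cochar0_subproof a) (cocharD_subproof a).

Lemma cocharE a u : a != 0 -> cochar a u = a ^ lam u.
Proof. by move=> a0; rewrite /= unit_partE. Qed.

End TorusPoints.

Arguments torus1 {k M}.

(** Conditions on a point moving along a one-parameter subgroup become polynomial
    in the parameter after clearing denominators. *)
Lemma laurent_poly (k : closedFieldType) (I : Type) (r : seq I) (c : I -> k)
    (e : I -> int) :
  exists (p : {poly k}) (K : nat), forall a, a != 0 ->
    p.[a] = a ^+ K * \sum_(i <- r) c i * a ^ e i.
Proof.
elim: r => [|i r [p [K pE]]].
  by exists 0, 0%N => a a0; rewrite big_nil horner0 mulr0.
exists (c i *: 'X^(K + absz (e i + absz (e i))) + p * 'X^(absz (e i))),
  (K + absz (e i))%N.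
move=> a a0; rewrite hornerD hornerZ hornerM !hornerXn pE // big_cons mulrDr.
congr (_ + _); last by rewrite exprD -!mulrA; congr (_ * _); rewrite mulrC.
rewrite mulrCA; congr (_ * _).
rewrite !exprnP -expfzDr //; congr (_ ^ _).
rewrite !PoszD -addrA; congr (_ + _); rewrite gez0_abs; first exact: addrC.
by case: (e i) => j //=; rewrite NegzE addNr.
Qed.

Section Sweeps.
Variables (k : closedFieldType) (T : topologicalType).

Definition sweep1 (mu : k -> T -> T) (Z : set T) : set T :=
  [set x | exists a z, [/\ a != 0, Z z & x = mu a z]].

(** Two proper closed subsets of the union are avoided simultaneously by some
    parameter, because orbit maps pull back proper closed sets to finite sets;
    the translate by this parameter is irreducible and lies in neither. *)
Lemma irreducible_sweep1 (mu : k -> T -> T) (Z : set T) :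
  irreducible_set Z ->
  (forall a C, a != 0 -> closed C -> closed (mu a @^-1` C)) ->
  (forall z C, closed C -> (exists2 a, a != 0 & ~ C (mu a z)) ->
     exists2 p : {poly k}, p != 0 & forall a, a != 0 -> C (mu a z) -> p.[a] = 0) ->
  irreducible_set (sweep1 mu Z).
Proof.
move=> [[z0 Zz0] irr] cont orb; split.
  by exists (mu 1 z0), 1, z0; rewrite oner_neq0.
move=> Z1 Z2 c1 c2 cov; apply: contrapT => /not_orP[n1 n2].
have wit (C : set T) : ~ sweep1 mu Z `<=` C ->
    exists a z, [/\ a != 0, Z z & ~ C (mu a z)].
  move=> nC; apply: contrapT => H; apply: nC => _ [a [z [a0 Zz ->]]].
  by apply: contrapT => nC; apply: H; exists a, z.
have [a1 [z1 [a10 Zz1 nz1]]] := wit _ n1.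
have [a2 [z2 [a20 Zz2 nz2]]] := wit _ n2.
have [p1 p10 p1P] := orb z1 Z1 c1 (ex_intro2 _ _ a1 a10 nz1).
have [p2 p20 p2P] := orb z2 Z2 c2 (ex_intro2 _ _ a2 a20 nz2).
have [a a0 pa] : exists2 a, a != 0 & (p1 * p2).[a] != 0.
  apply: contrapT => H; have /eqP := mulf_neq0 p10 p20; apply.
  apply: poly_eq0_units => a a0; apply/eqP; apply: contrapT => /negP pa.
  by apply: H; exists a.
move: pa; rewrite hornerM mulf_eq0 negb_or => /andP[/eqP pa1 /eqP pa2].
have [|Za|Za] := irr _ _ (cont a Z1 a0 c1) (cont a Z2 a0 c2).
- by move=> z Zz; apply: cov; exists a, z.
- by apply: pa1; apply: p1P => //; exact: Za.
- by apply: pa2; apply: p2P => //; exact: Za.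
Qed.

Variable mu : nat -> k -> T -> T.

Fixpoint sweep (Z : set T) (j : nat) : set T :=
  if j is j'.+1 then sweep1 (mu j') (sweep Z j') else Z.

Lemma irreducible_sweep Z j :
  irreducible_set Z ->
  (forall i a C, a != 0 -> closed C -> closed (mu i a @^-1` C)) ->
  (forall i z C, closed C -> (exists2 a, a != 0 & ~ C (mu i a z)) ->
     exists2 p : {poly k}, p != 0 &
       forall a, a != 0 -> C (mu i a z) -> p.[a] = 0) ->
  irreducible_set (sweep Z j).
Proof.
move=> irrZ cont orb; elim: j => //= j IHj.
by apply: irreducible_sweep1 => // [a C|z C]; [exact: cont | exact: orb].
Qed.

Lemma sub_sweep Z : (forall i z, mu i 1 z = z) ->
  forall j, sweep Z j `<=` sweep Z j.+1.
Proof. by move=> mu1 j z Zz; exists 1, z; rewrite oner_neq0 mu1. Qed.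

End Sweeps.

Section TorusSweep.
Variables (k : closedFieldType) (M : zmodType).
Implicit Types (t g : torus k M).

Lemma torus_closedP (C : set (torus k M)) : closed C <->
  exists S : set (group_ring k M),
    forall t, C t <-> (forall f, S f -> teval f t = 0).
Proof.
rewrite -openC; split=> [[S CE]|[S CS]].
  exists S => t; split=> [Ct f Sf|H].
    apply: contrapT => ft; have : (~` C) t by rewrite CE; exists f.
    by apply.
  apply: contrapT => nCt; have : (~` C) t by [].
  by rewrite CE => -[f /H].
exists S; rewrite predeqE => t; split=> [nCt|[f Sf ft] /CS H]; last first.
  by apply: ft; exact: H.
apply: contrapT => H; apply: nCt; apply/CS => f Sf; apply: contrapT => ft.
by apply: H; exists f.
Qed.

Lemma teval_translate (f : group_ring k M) g :
  exists f' : group_ring k M, forall t, teval f' t = teval f (torus_mul g t).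
Proof.
exists (\sum_(u <- monalg.msupp f) monalg.mkmalgU u (monalg.mcoeff u f * g u)).
move=> t; rewrite tevalE raddf_sum /= /teval; apply: eq_bigr => u _.
by rewrite monalg.mmapU /= mulrA.
Qed.

Lemma torus_translate_closed g (C : set (torus k M)) :
  closed C -> closed (torus_mul g @^-1` C).
Proof.
move=> /torus_closedP[S CS]; apply/torus_closedP.
exists [set f' | exists2 f, S f & forall t, teval f' t = teval f (torus_mul g t)].
move=> t; split=> [/CS H f' [f Sf ->]|H]; first exact: H.
by apply/CS => f Sf; have [f' fE] := teval_translate f g; rewrite -fE; apply: H; exists f.
Qed.

Lemma torus_orbit_finite (lam : {additive M -> int}) t (C : set (torus k M)) :
  closed C -> (exists2 a, a != 0 & ~ C (torus_mul (cochar lam a) t)) ->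
  exists2 p : {poly k}, p != 0 &
    forall a, a != 0 -> C (torus_mul (cochar lam a) t) -> p.[a] = 0.
Proof.
move=> /torus_closedP[S CS] [a a0 nC].
have [f Sf fa] : exists2 f, S f & teval f (torus_mul (cochar lam a) t) <> 0.
  apply: contrapT => H; apply: nC; apply/CS => f Sf; apply: contrapT => fa.
  by apply: H; exists f.
have [p [K pE]] := laurent_poly (monalg.msupp f)
  (fun v => monalg.mcoeff v f * t v) lam.
have fE b : b != 0 -> teval f (torus_mul (cochar lam b) t) =
    \sum_(v <- monalg.msupp f) monalg.mcoeff v f * t v * b ^ lam v.
  move=> b0; apply: eq_bigr => v _ /=.
  by rewrite unit_partE // -mulrA; congr (_ * _); rewrite mulrC.
exists p => [|b b0 /CS Cb]; last by rewrite pE // -fE // Cb ?mulr0.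
apply/eqP => p0; apply: fa; move: (pE a a0); rewrite p0 horner0 -fE //.
by move/esym/eqP; rewrite mulf_eq0 expf_eq0 (negPf a0) andbF => /eqP.
Qed.

End TorusSweep.

(** * Derivatives, dilations and binomials *)

Section ChainRule.
Variables (k : closedFieldType) (m : nat).
Implicit Types (F G : {mpoly k[m]}).

(** Stated for a derivation of an arbitrary commutative ring: it serves to
    differentiate both along curves, in [{poly k}], and after a linear change of
    variables, in [{mpoly k[m]}]. *)
Lemma chain_rule (R : comNzRingType) (h : {rmorphism k -> R}) (q : 'I_m -> R)
    (D : {additive R -> R}) :
  (forall x y, D (x * y) = D x * y + x * D y) -> (forall a, D (h a) = 0) ->
  forall F, D (mmap h q F) = \sum_i mmap h q F^`M(i) * D (q i).
Proof.
move=> DM Dh.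
pose ok F := D (mmap h q F) = \sum_i mmap h q F^`M(i) * D (q i).
have okC c : ok c%:MP.
  by rewrite /ok mmapC Dh big1 // => i _; rewrite mderivC mmap0 mul0r.
have ok1 : ok 1 by rewrite -mpolyC1.
have okX i : ok 'X_i.
  rewrite /ok mmapX mmap1U (bigD1 i) //= mderivX mnm1E eqxx scale1r.
  rewrite [X in 'X_[X]](_ : _ = 0%MM); last first.
    by apply/mnmP => j; rewrite mnmBE mnm0E subnn.
  rewrite mmapX mmap11 mul1r big1 ?addr0 // => j /negPf ji.
  by rewrite mderivX mnm1E eq_sym ji scale0r mmap0 mul0r.
have okD F G : ok F -> ok G -> ok (F + G).
  rewrite /ok mmapD raddfD => -> ->; rewrite -big_split; apply: eq_bigr => i _.
  by rewrite mderivD mmapD mulrDl.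
have okM F G : ok F -> ok G -> ok (F * G).
  rewrite /ok rmorphM DM => -> ->; rewrite mulr_suml mulr_sumr -big_split.
  apply: eq_bigr => i _; rewrite mderivM mmapD !rmorphM /= mulrDl mulrA.
  by congr (_ + _); rewrite mulrAC.
have okXn i j : ok ('X_i ^+ j).
  elim: j => [|j IHj]; first exact: ok1.
  by rewrite exprS; exact: okM (okX i) IHj.
move=> F; elim/mpolyind: F => [|c mu F _ _ okF]; first by have := okC 0; rewrite mpolyC0.
apply: okD => //; rewrite -mul_mpolyC; apply: (okM) => //.
rewrite mpolyXE_id; apply: (big_ind ok) => [//|x y|i _]; last exact: okXn.
exact: okM.
Qed.

Lemma deriv_along (q : 'I_m -> {poly k}) F a :
  (along q F)^`().[a] =
  \sum_i heval F^`M(i) (\row_j (q j).[a]) * (q i)^`().[a].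
Proof.
rewrite /along (@chain_rule _ (@polyC k) q (@deriv k)); first last.
- by move=> b; exact: derivC.
- exact: derivM.
rewrite horner_sum; apply: eq_bigr => i _; rewrite hornerM.
by rewrite -/(along q F^`M(i)) horner_along.
Qed.

(** Tangency conditions at one nonzero vector of a line hold on the whole line,
    because partial derivatives of forms are forms. *)
Lemma homog_scale_grad F d a (w v : 'rV[k]_m) : F \is d.-homog ->
  \sum_i heval F^`M(i) w * v 0 i = 0 ->
  \sum_i heval F^`M(i) (a *: w) * v 0 i = 0.
Proof.
move=> hF Fv.
have [d' hF'] : exists d', forall i, F^`M(i) \is d'.-homog.
  exists d.-1 => i; apply/dhomogP => mu.
  rewrite mcoeff_msupp mcoeff_mderiv => nz.
  have : (mu + U_(i))%MM \in msupp F.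
    by rewrite mcoeff_msupp; apply: contra nz => /eqP->; rewrite mul0rn.
  by move/(dhomog_mf hF) => /= <-; rewrite mdegD mdeg1 addn1.
under eq_bigr => i _ do rewrite (heval_scale _ _ (hF' i)) -mulrA.
by rewrite -mulr_sumr Fv mulr0.
Qed.

End ChainRule.

Section Dilations.
Variables (k : closedFieldType) (m : nat) (D : 'I_m -> k).
Implicit Types (F G : {mpoly k[m]}) (v w : 'rV[k]_m).

Definition dilate v : 'rV[k]_m := \row_j (D j * v 0 j).

Definition dilate_mpoly F : {mpoly k[m]} := mmap (@mpolyC m k) (fun j => D j *: 'X_j) F.

Lemma dilateZ a v : dilate (a *: v) = a *: dilate v.
Proof. by apply/rowP => j; rewrite !mxE mulrCA. Qed.

Lemma dilate_neq0 v : (forall j, D j != 0) -> v != 0 -> dilate v != 0.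
Proof.
move=> D0 /rV0Pn[j vj]; apply/rV0Pn; exists j.
by rewrite mxE mulf_neq0.
Qed.

Lemma heval_dilate F v : heval (dilate_mpoly F) v = heval F (dilate v).
Proof.
rewrite /heval /dilate_mpoly rmorph_mmap /meval /mmap; apply: eq_bigr => mu _.
rewrite /= -/(meval _ _) mevalC; congr (_ * _).
by apply: eq_bigr => j _; rewrite /= mevalZ mevalXU mxE.
Qed.

Lemma dilate_mpolyX mu :
  mmap1 (fun j => D j *: 'X_j : {mpoly k[m]}) mu = (\prod_j D j ^+ mu j) *: 'X_[mu].
Proof.
rewrite /mmap1 [in RHS]mpolyXE_id.
rewrite -mul_mpolyC rmorph_prod -big_split /=; apply: eq_bigr => j _.
by rewrite exprZn -mul_mpolyC.
Qed.

Lemma dilate_homog F d : F \is d.-homog -> dilate_mpoly F \is d.-homog.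
Proof.
move=> hF; rewrite /dilate_mpoly /mmap big_seq; apply: rpred_sum => mu muF.
rewrite dilate_mpolyX mul_mpolyC; do 2 apply: dhomogZ.
by rewrite dhomogX (dhomog_mf hF muF).
Qed.

Lemma mderiv_dilate F i : (dilate_mpoly F)^`M(i) = D i *: dilate_mpoly F^`M(i).
Proof.
rewrite /dilate_mpoly (@chain_rule _ _ _ (@mpolyC m k) _ (@mderiv m k i)); first last.
- by move=> a; exact: mderivC.
- by move=> x y; exact: mderivM.
rewrite (bigD1 i) //= big1 ?addr0 => [|j ji].
  rewrite mderivZ mderivX mnm1E eqxx scale1r.
  rewrite [X in 'X_[X]](_ : _ = 0%MM); last first.
    by apply/mnmP => j; rewrite mnmBE mnm0E subnn.
  by rewrite mpolyX0 -scalerAr mulr1.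
by rewrite mderivZ mderivX mnm1E (negPf ji) scale0r scaler0 mulr0.
Qed.

End Dilations.

Section Binomials.
Variables (k : closedFieldType) (m : nat).
Implicit Types (a : 'I_m -> int) (v z : 'rV[k]_m).

Definition posmnm a : 'X_{1..m} := [multinom if a j is Posz n then n else 0%N | j < m].
Definition negmnm a : 'X_{1..m} := [multinom if a j is Negz n then n.+1 else 0%N | j < m].

(** Positive and negative exponents are separated, so that this polynomial tests
    whether the Laurent monomial with exponents [a] takes the value [b]. *)
Definition binomial a (b : k) : {mpoly k[m]} := 'X_[posmnm a] - b *: 'X_[negmnm a].

Lemma posBneg a j : a j = (posmnm a j)%:Z - (negmnm a j)%:Z.
Proof. by rewrite !mnmE; case: (a j) => n; rewrite ?subr0 // sub0r NegzE. Qed.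

Lemma binomial_homog a b : \sum_j a j = 0 -> binomial a b \is (mdeg (posmnm a)).-homog.
Proof.
move=> a0; rewrite /binomial rpredB ?dhomogX //; apply: dhomogZ.
rewrite dhomogX /= eq_sym -eqz_nat -subr_eq0 -!natz !mdegE !natr_sum -sumrB.
by rewrite -[X in _ == X]a0; apply/eqP/eq_bigr => j _; rewrite !natz -posBneg.
Qed.

Lemma heval_binomial a b v : (forall j, a j != 0 -> v 0 j != 0) ->
  heval (binomial a b) v = 0 <-> \prod_j v 0 j ^ a j = b.
Proof.
move=> v0; rewrite /heval mevalB mevalZ !mevalX.
set p := \prod_j v 0 j ^+ posmnm a j; set q := \prod_j v 0 j ^+ negmnm a j.
have q0 : q != 0.
  apply/prodf_neq0 => j _; rewrite mnmE; case aj: (a j) => [n|n].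
    by rewrite expr0 oner_neq0.
  by rewrite expf_neq0 // v0 // aj.
have -> : \prod_j v 0 j ^ a j = p / q.
  rewrite /p /q -prodf_div; apply: eq_bigr => j _.
  rewrite !mnmE; case: (a j) => n; first by rewrite expr0 divr1.
  by rewrite expr0 mul1r.
split=> [/eqP|<-]; first by rewrite subr_eq0 => /eqP->; rewrite mulfK.
by rewrite divfK ?subrr.
Qed.

(** The logarithmic derivative of a Laurent monomial is the linear form given by
    its exponents. *)
Lemma grad_binomial a b v z : (forall j, v 0 j != 0) ->
  \prod_j v 0 j ^ a j = b ->
  \sum_i heval (binomial a b)^`M(i) v * z 0 i = 0 ->
  \sum_i (a i)%:~R * (z 0 i / v 0 i) = 0.
Proof.
move=> v0 Eb; have bv := (@heval_binomial a b v (fun j _ => v0 j)).2 Eb.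
have dX (mu : 'X_{1..m}) i :
    heval 'X_[mu]^`M(i) v = heval 'X_[mu] v * ((mu i)%:R / v 0 i).
  rewrite mderivX /heval mevalZ !mevalX.
  have [->|mui] := posnP (mu i); first by rewrite !mul0r mulr0.
  rewrite (bigD1 i) //= [X in _ = X * _](bigD1 i) //= !mnmBE mnm1E eqxx subn1.
  rewrite (_ : v 0 i ^+ mu i = v 0 i ^+ (mu i).-1 * v 0 i); last first.
    by rewrite -exprSr prednK.
  rewrite [RHS]mulrC -!mulrA [in RHS]mulrCA mulKf //; congr (_ * (_ * _)).
  by apply: eq_bigr => j /negPf ji; rewrite mnmBE mnm1E eq_sym ji subn0.
have p0 : heval 'X_[posmnm a] v != 0.
  by rewrite /heval mevalX; apply/prodf_neq0 => j _; rewrite expf_neq0.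
have bq : b * heval 'X_[negmnm a] v = heval 'X_[posmnm a] v.
  apply/esym/eqP; rewrite -subr_eq0; apply/eqP; rewrite -[RHS]bv.
  by rewrite /heval mevalB mevalZ.
have T i : heval (binomial a b)^`M(i) v * z 0 i =
    heval 'X_[posmnm a] v * ((a i)%:~R * (z 0 i / v 0 i)).
  rewrite mderivB mderivZ [heval (_ - _) _]mevalB mevalZ -!/(heval _ _) !dX.
  rewrite (mulrA b) bq -mulrBr -mulrA; congr (_ * _).
  by rewrite -mulrBl posBneg rmorphB /= -!pmulrn mulrAC mulrA.
move=> /eqP; under eq_bigr do rewrite T.
by rewrite -mulr_sumr mulf_eq0 (negPf p0) /= => /eqP.
Qed.

End Binomials.

(** * The torus action on projective space *)

Section Action.
Variables (k : closedFieldType) (M : zmodType) (N : nat) (u : 'I_N.+1 -> M).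
Implicit Types (g t : torus k M) (x y : PP k N.+1) (v : 'rV[k]_N.+1).
Implicit Types (F : {mpoly k[N.+1]}) (Z C : set (PP k N.+1)).

Definition torus_scale g v := dilate (fun j => g (u j)) v.

Lemma torus_scaleZ g a v : torus_scale g (a *: v) = a *: torus_scale g v.
Proof. exact: dilateZ. Qed.

Lemma torus_scale_neq0 g v : v != 0 -> torus_scale g v != 0.
Proof. by apply: dilate_neq0 => j; exact: torus_neq0. Qed.

Lemma vpick_neq0 x : vpick (line x) != 0.
Proof. by case: x => L /= /eqP dL; rewrite vpick0 -dimv_eq0 dL. Qed.

Lemma line_vpick x : line x = <[vpick (line x)]>%VS.
Proof. by apply: line_mem; [exact: vpick_neq0 | exact: memv_pick]. Qed.

Definition act g x : PP k N.+1 := pt (torus_scale_neq0 g (vpick_neq0 x)).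

Lemma line_act g x v : line x = <[v]>%VS -> line (act g x) = <[torus_scale g v]>%VS.
Proof.
move=> xv; have [a a0 ->] := eq_vline (line_neq0 xv) (etrans (esym xv) (line_vpick x)).
by rewrite torus_scaleZ vline_scale.
Qed.

Lemma row_torus_neq0 t : \row_j t (u j) != 0.
Proof. by apply/rV0Pn; exists ord0; rewrite mxE torus_neq0. Qed.

Definition toric_pt t : PP k N.+1 := pt (row_torus_neq0 t).

Lemma toric_mapP t x : toric_map u t x <-> x = toric_pt t.
Proof. by split=> [xt|->//]; exact: PP_eq. Qed.

Lemma act_toric_pt g t : act g (toric_pt t) = toric_pt (torus_mul g t).
Proof.
apply: PP_eq; rewrite (line_act g (erefl (line (toric_pt t)))); congr <[_]>%VS.
by apply/rowP => j; rewrite !mxE.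
Qed.

Lemma act_mul g t x : act (torus_mul g t) x = act g (act t x).
Proof.
apply: PP_eq; have [v v0 xv] := lineP x.
rewrite (line_act _ xv) (line_act g (line_act t xv)); congr <[_]>%VS.
by apply/rowP => j; rewrite !mxE mulrA.
Qed.

Lemma act1 g x : (forall j, g (u j) = 1) -> act g x = x.
Proof.
move=> g1; apply: PP_eq; have [v v0 xv] := lineP x.
rewrite (line_act _ xv) xv; congr <[_]>%VS.
by apply/rowP => j; rewrite !mxE g1 mul1r.
Qed.

Lemma vanish_act F g x :
  vanish F (act g x) <-> vanish (dilate_mpoly (fun j => g (u j)) F) x.
Proof.
have [v v0 xv] := lineP x; rewrite (vanish_lineP _ (line_act g xv)) (vanish_lineP _ xv).
by split=> H a; move: (H a); rewrite heval_dilate dilateZ.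
Qed.

Lemma act_closed g C : closed C -> closed (act g @^-1` C).
Proof.
move=> Cc; apply/closure_id/seteqP; split; first exact: subset_closure.
move=> x /closureP Cx; apply: contrapT => nC.
have [F [d [_ FC nF]]] := closed_separate Cc nC.
apply/nF/vanish_act/Cx => y /FC; by rewrite vanish_act.
Qed.

Lemma act_closure g C x : (forall y, C y -> C (act g y)) ->
  closure C x -> closure C (act g x).
Proof.
move=> CC /closureP Cx; apply/closureP => F FC; apply/vanish_act/Cx => y Cy.
by apply/vanish_act/FC/CC.
Qed.

Lemma act_orbit_finite (lam : {additive M -> int}) x C : closed C ->
  (exists2 a, a != 0 & ~ C (act (cochar lam a) x)) ->
  exists2 p : {poly k}, p != 0 &
    forall a, a != 0 -> C (act (cochar lam a) x) -> p.[a] = 0.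
Proof.
move=> Cc [a0 a00 nC]; have [F [d [hF FC nF]]] := closed_separate Cc nC.
have [v v0 xv] := lineP x.
have [p [K pE]] := laurent_poly (msupp F)
  (fun mu => F@_mu * \prod_j v 0 j ^+ mu j)
  (fun mu => \sum_j lam (u j) * mu j).
have FE a : a != 0 -> heval F (torus_scale (cochar lam a) v) =
    \sum_(mu <- msupp F) F@_mu * (\prod_j v 0 j ^+ mu j) *
      a ^ (\sum_j lam (u j) * mu j).
  move=> a_neq0; rewrite /heval mevalE; apply: eq_bigr => mu _.
  rewrite -mulrA; congr (_ * _).
  have -> : a ^ (\sum_j lam (u j) * mu j) = \prod_j (a ^ (lam (u j))) ^+ mu j.
    rewrite (big_morph (fun z : int => a ^ z) (id1 := 1) (op1 := *%R)) //.
      by apply: eq_bigr => j _; rewrite -exprz_exp.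
    by move=> y z; rewrite expfzDr.
  rewrite -big_split; apply: eq_bigr => j _.
  by rewrite !mxE cocharE //= exprMn mulrC.
exists p => [|a a_neq0 /FC]; last first.
  move/(vanish_homogP hF (line_act _ xv)); rewrite FE // pE // => ->.
  by rewrite mulr0.
apply/eqP => p0; apply/nF/(vanish_homogP hF (line_act _ xv)).
move: (pE a0 a00); rewrite p0 horner0 -FE //.
by move/esym/eqP; rewrite mulf_eq0 expf_eq0 (negPf a00) andbF => /eqP.
Qed.

Variable lam : nat -> {additive M -> int}.

Definition act_cochar i (a : k) x := act (cochar (lam i) a) x.

Lemma irreducible_act_sweep Z j : irreducible_set Z ->
  irreducible_set (sweep act_cochar Z j).
Proof.
move=> irrZ; apply: irreducible_sweep => // [i a C _|i z C].
  exact: act_closed.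
exact: act_orbit_finite.
Qed.

Lemma sub_act_sweep Z j : sweep act_cochar Z j `<=` sweep act_cochar Z j.+1.
Proof.
apply: sub_sweep => i z; apply: act1 => l.
by rewrite cocharE ?oner_neq0 // exp1rz.
Qed.

Lemma act_sweep_elt Z j x : sweep act_cochar Z j x ->
  exists g z, [/\ Z z, x = act g z &
    forall f, (forall i, (i < j)%N -> lam i f = 0) -> g f = 1].
Proof.
elim: j x => [|j IHj] x.
  by move=> Zx; exists torus1, x; rewrite act1.
move=> [a [y [a0 /IHj [g [z [Zz -> gf]]] ->]]].
exists (torus_mul (cochar (lam j) a) g), z; split=> //; first by rewrite act_mul.
move=> f fj; rewrite /= gf => [|i ij]; last by apply: fj; exact: leqW.
by rewrite fj // expr0z mulr1.
Qed.

End Action.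

(** * Chains of irreducible closed sets in a toric variety *)

Section Coordinates.
Variables (M : zmodType) (n : nat) (c : {additive M -> 'rV[int]_n}).

(** Coordinates indexed by all natural numbers, zero beyond the rank, so that
    one-parameter subgroups can be indexed by the step of a sweep. *)
Definition ncoord (i : nat) (v : M) : int := \sum_(j < n | j == i :> nat) c v 0 j.

Lemma ncoord_subproof i : zmod_morphism (ncoord i).
Proof.
by move=> v w; rewrite /ncoord -sumrB; apply: eq_bigr => j _; rewrite raddfB !mxE.
Qed.
HB.instance Definition _ i :=
  GRing.isZmodMorphism.Build M int (ncoord i) (ncoord_subproof i).

Lemma ncoord_ord (i : 'I_n) v : ncoord i v = c v 0 i.
Proof. by rewrite /ncoord (big_pred1 i). Qed.

Hypothesis c_bij : bijective c.

Lemma exists_basis : exists e : 'I_n -> M,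
  (forall i, c (e i) = delta_mx 0 i) /\ (forall v, v = \sum_i e i *~ c v 0 i).
Proof.
have [ci cK ciK] := c_bij; exists (fun i => ci (delta_mx 0 i)).
split=> [i|v]; first by rewrite ciK.
apply: (bij_inj c_bij); rewrite raddf_sum [LHS]row_sum_delta; apply: eq_bigr => i _.
by rewrite raddfMz ciK -scaler_int intz.
Qed.

Lemma torus_eq_basis (k : closedFieldType) (e : 'I_n -> M) (t : torus k M) v :
  v = \sum_i e i *~ c v 0 i -> t v = \prod_i t (e i) ^ c v 0 i.
Proof. by move=> vE; rewrite {1}vE torus_lincomb. Qed.

End Coordinates.

Section ToricRelations.
Variables (k : closedFieldType) (M : zmodType) (m : nat) (w : 'I_m -> M).

Lemma toric_ind (F : {mpoly k[m]}) :
  (forall (t : torus k M) x, toric_map w t x -> vanish F x) ->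
  forall x, toric k w x -> vanish F x.
Proof. by move=> H x /closureP; apply=> y [t _ ty]; exact: (H t). Qed.

(** Exponents of sum zero make the binomial homogeneous, and on the torus it then
    tests the value of a character. *)
Lemma toric_map_binomial (t : torus k M) x (a : 'I_m -> int) b :
  toric_map w t x -> \sum_j a j = 0 ->
  vanish (binomial a b) x <-> t (\sum_j w j *~ a j) = b.
Proof.
move=> xt a0; rewrite (vanish_homogP (binomial_homog b a0) xt).
rewrite heval_binomial => [|j _]; last by rewrite mxE torus_neq0.
by rewrite torus_lincomb; under eq_bigr do rewrite mxE.
Qed.

Lemma toric_binomial (a : 'I_m -> int) :
  \sum_j a j = 0 -> \sum_j w j *~ a j = 0 ->
  forall x, toric k w x -> vanish (binomial a 1) x.
Proof.
move=> a0 wa; apply: toric_ind => t x xt.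
by apply/(toric_map_binomial _ xt a0); rewrite wa chi0.
Qed.

End ToricRelations.

Section Chains.
Variable T : topologicalType.
Implicit Types (S : set T).

Lemma irreducible_closure (D S : set T) :
  irreducible_set D -> D `<=` S -> S `<=` closure D -> irreducible_set S.
Proof.
move=> [[x Dx] irr] DS SD; split; first by exists x; exact: DS.
move=> Z1 Z2 c1 c2 S12; case: (irr Z1 Z2 c1 c2 (subset_trans DS S12)) => DZ.
  by left; apply: subset_trans SD _; exact: closure_sub_closed.
by right; apply: subset_trans SD _; exact: closure_sub_closed.
Qed.

(** Chains for the induced topology can be specified by dense subsets of their
    members. *)
Lemma chain_of_closures S (Z : nat -> set T) d :
  (forall i, (i <= d)%N -> irreducible_set (Z i) /\ Z i `<=` S) ->
  (forall i, (i < d)%N -> Z i `<=` Z i.+1) ->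
  (forall i, (i < d)%N -> exists2 x, Z i.+1 x & ~ closure (Z i) x) ->
  irreducible_chain S d (fun i => S `&` closure (Z i)).
Proof.
move=> irrZ ZZ nZ.
have clE i : (i <= d)%N -> closure (S `&` closure (Z i)) = closure (Z i).
  move=> id; apply/seteqP; split.
    by apply: closure_sub_closed; [exact: closed_closure | move=> x []].
  apply: closure_subset => x Zx; split; first exact: (irrZ i id).2 x Zx.
  exact: subset_closure.
split=> i id.
  rewrite clE //; split=> //; have [irr ZS] := irrZ i id.
  apply: irreducible_closure irr _ _ => [x Zx|x []] //.
  by split; [exact: ZS | exact: subset_closure].
have [x Zx nZx] := nZ i id; split=> [y [Sy Zy]|H].
  by split=> //; exact: closure_subset (ZZ i id) y Zy.
apply: nZx; apply: (H x _).2; split; last exact: subset_closure.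
exact: (irrZ i.+1 id).2.
Qed.

Lemma irreducible_chain_closure S e C i : irreducible_chain S e C ->
  (i <= e)%N -> irreducible_set (closure (C i)).
Proof.
move=> [irrC _] ie; have [irr _] := irrC i ie.
by apply: irreducible_closure irr _ _ => //; exact: subset_closure.
Qed.

End Chains.

Section ToricDimension.
Variables (k : closedFieldType) (M : zmodType) (n : nat).
Variables (c : {additive M -> 'rV[int]_n}) (c_bij : bijective c).
Variables (N : nat) (u : 'I_N.+1 -> M) (Aff_u : Aff u = setT).

Local Notation XA := (toric k u).
Local Notation phi := (@toric_pt k M N u).

Lemma toric_pt_in t : XA (phi t).
Proof. by apply: subset_closure; exists t. Qed.

Lemma toric_closed : closed XA.
Proof. exact: closed_closure. Qed.

Lemma act_toric g x : XA x -> XA (act u g x).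
Proof.
apply: act_closure => _ [t _ /toric_mapP ->].
by exists (torus_mul g t) => //; apply/toric_mapP; exact: act_toric_pt.
Qed.

(** Subtract affine combinations of [v] and of [0].  In this way every character
    of the torus is a quotient of two forms of the same degree. *)
Lemma zero_sum_combination v :
  exists2 a : 'I_N.+1 -> int, \sum_j a j = 0 & v = \sum_j u j *~ a j.
Proof.
have [a1 s1 v1] : Aff u v by rewrite Aff_u.
have [a0 s0 v0] : Aff u 0 by rewrite Aff_u.
exists (fun j => a1 j - a0 j); first by rewrite sumrB s1 s0 subrr.
transitivity (\sum_j u j *~ a1 j - \sum_j u j *~ a0 j).
  by rewrite -v1 -v0 subr0.
by rewrite -sumrB; apply: eq_bigr => j _; rewrite mulrzBr.
Qed.

(** Characters separate closures of torus subsets: a character constant on a set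
    keeps its value at the torus points of the closure, being a quotient of forms
    of the same degree. *)
Lemma character_closure v (t t' : torus k M) (S : set (torus k M)) :
  (forall s, S s -> s v = t' v) -> closure (toric_map_image u S) (phi t) ->
  t v = t' v.
Proof.
move=> Sv /closureP H; have [a a0 vE] := zero_sum_combination v.
have phit : toric_map u t (phi t) by apply/toric_mapP.
rewrite {1}vE; apply/(toric_map_binomial (t' v) phit a0); apply: H => y [s Ss sy].
by apply/(toric_map_binomial _ sy a0); rewrite -vE Sv.
Qed.

(** The cone over a toric variety is parametrized by monomials with nonnegative
    exponents: a shift of all exponents by [K] is absorbed by the homogenizing
    coordinate. *)
Lemma toric_monomial_map : exists l : 'I_N.+1 -> 'I_n.+1 -> nat,
  forall G : {mpoly k[N.+1]}, (forall y, heval G (monomial_map l y) = 0) ->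
     forall x, XA x -> vanish G x.
Proof.
have [e [ce eE]] := exists_basis c_bij.
pose cc j i : int := c (u j) 0 i.
pose K := (\sum_j \sum_i absz (cc j i))%N.
have cK j i : 0 <= cc j i + K%:Z.
  apply: (@Order.POrderTheory.le_trans _ _ (cc j i + (absz (cc j i))%:Z)).
    by case: (cc j i) => l //=; rewrite NegzE addNr.
  rewrite Num.Theory.lerD2l lez_nat /K (bigD1 j) //= (bigD1 i) //= -addnA.
  exact: leq_addr.
exists (fun j i => if unlift ord0 i is Some i' then absz (cc j i' + K%:Z) else 1%N).
move=> G G0; apply: toric_ind => t x xt.
apply/(vanish_unitsP _ xt) => a a0.
pose y : 'rV[k]_n.+1 := \row_i if unlift ord0 i is Some i' then t (e i')
  else a * (\prod_i t (e i) ^+ K)^-1.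
rewrite -[RHS](G0 y); congr (heval _ _); apply/rowP => j.
rewrite !mxE big_ord_recl !mxE unlift_none expr1 -mulrA; congr (_ * _).
rewrite (torus_eq_basis t (eE (u j))) -prodfV -big_split; apply: eq_bigr => i _.
rewrite !mxE !liftK (exprnP _ (absz _)) gez0_abs // expfzDr ?torus_neq0 //.
by rewrite -exprnP /= mulrCA mulVf ?mulr1 // expf_neq0 ?torus_neq0.
Qed.

(** Bounds the dimension of a subset [S] away from the rank: it is enough to find
    [r] further steps above the last member of any chain in [S]. *)
Lemma chain_extension_le (S : set (PP k N.+1)) e C r E :
  S `<=` XA -> irreducible_chain S e C -> E 0%N = C e ->
  (forall j, (j <= r)%N -> irreducible_set (E j) /\ E j `<=` XA) ->
  (forall j, (j < r)%N -> E j `<=` E j.+1) ->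
  (forall j, (j < r)%N -> exists2 x, E j.+1 x & ~ closure (E j) x) ->
  (e + r <= n)%N.
Proof.
move=> SX chC E0 irrE EE nE; have [irrC CC] := chC.
have [l lP] := toric_monomial_map.
pose D_ i := if (i <= e)%N then closure (C i) else closure (E (i - e)%N).
have DE i : (e <= i)%N -> D_ i = closure (E (i - e)%N).
  rewrite /D_ leq_eqVlt => /orP[/eqP<-|ei]; first by rewrite leqnn subnn E0.
  by rewrite leqNgt ei.
rewrite -ltnS; apply: (projective_chain_length_le (D_ := D_) lP) => [i ir|i ir|].
- rewrite /D_; case: leqP => [ie|ei]; split; try exact: closed_closure.
    exact: irreducible_chain_closure chC ie.
  have [|irr _] := irrE (i - e)%N; first by rewrite leq_subLR.
  by apply: irreducible_closure irr _ _ => //; exact: subset_closure.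
- have [ie|ei] := ltnP i e.
    rewrite /D_ (ltnW ie) ie; have [sub nsub] := CC i ie.
    split=> [|H]; first exact: closure_subset.
    apply: nsub => x; rewrite (irrC i.+1 ie).2 (irrC i (ltnW ie)).2 => -[Sx Cx].
    by split=> //; exact: H.
  rewrite !DE ?(leqW ei) // subSn //.
  have ij : (i - e < r)%N by rewrite ltn_subLR.
  split; first exact: closure_subset (EE _ ij).
  have [x Ex nEx] := nE _ ij; move=> H; apply/nEx/H; exact: subset_closure.
- rewrite DE ?leq_addr // addKn; apply: closure_sub_closed toric_closed _.
  by have [] := irrE r (leqnn r).
Qed.

Lemma chain_le (S : set (PP k N.+1)) e C :
  S `<=` XA -> irreducible_chain S e C -> (e <= n)%N.
Proof.
move=> SX chC; rewrite -[e]addn0.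
apply: (chain_extension_le (r := 0) (E := fun=> C e) SX chC) => // j _.
have [irrC _] := chC; have [irr ->] := irrC e (leqnn e); split=> //.
  by have [_ <-] := irrC e (leqnn e).
by move=> x [/SX].
Qed.

End ToricDimension.

Lemma exists_unit_pow_neq1 (k : closedFieldType) (e : int) : e != 0 ->
  exists2 a : k, a != 0 & a ^ e != 1.
Proof.
move=> e0; have [a a0 ae] : exists2 a : k, a != 0 & a ^+ absz e != 1.
  apply: contrapT => H.
  have /eqP : ('X^(absz e) - 1 : {poly k}) = 0.
    apply: poly_eq0_units => a a0; rewrite !hornerE; apply/eqP.
    by rewrite subr_eq0; apply: contrapT => /negP ae; apply: H; exists a.
  by rewrite -size_poly_eq0 size_XnsubC // absz_gt0.
exists a => //; case: e e0 ae => [] //= j _; apply: contra.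
by rewrite NegzE -invr_expz invr_eq1.
Qed.

Lemma ncoord_dual (M : zmodType) (n : nat) (c : {additive M -> 'rV[int]_n}) :
  bijective c -> exists f : nat -> M,
    forall i j, (i < n)%N -> ncoord c i (f j) = (i == j)%:Z.
Proof.
move=> [ci _ ciK]; exists (fun j => ci (\row_l (l == j :> nat)%:Z)) => i j lt_in.
by rewrite -[i]/(val (Ordinal lt_in)) ncoord_ord ciK mxE.
Qed.

Section SweepChains.
Variables (k : closedFieldType) (M : zmodType).
Variables (N : nat) (u : 'I_N.+1 -> M) (Aff_u : Aff u = setT).
Variables (lam : nat -> {additive M -> int}) (f : nat -> M) (d : nat).
Hypothesis lam_f0 : forall i j, (i < d)%N -> (j < i)%N -> lam j (f i) = 0.
Hypothesis lam_fn0 : forall i, (i < d)%N -> lam i (f i) != 0.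

(** The character [f i] is constant on the points swept out so far, hence on the
    torus points of their closure, and it varies along the next subgroup. *)
Lemma sweep_toric_pt_strict (t0 : torus k M) i : (i < d)%N ->
  let Z := sweep (act_cochar u lam) [set toric_pt u t0] in
  exists2 x, Z i.+1 x & ~ closure (Z i) x.
Proof.
move=> id Z; have [a a0 ae] := exists_unit_pow_neq1 k (lam_fn0 id).
exists (toric_pt u (torus_mul (cochar (lam i) a) t0)).
  exists a, (toric_pt u t0); split=> //; last by rewrite /act_cochar act_toric_pt.
  by elim: (i) => // j; exact: sub_act_sweep.
set t := torus_mul _ _ => Zt.
suff /eqP : t (f i) = t0 (f i).
  rewrite /= unit_partE // -subr_eq0 -{2}[t0 _]mul1r -mulrBl mulf_eq0 subr_eq0.
  by rewrite (negPf ae) (negPf (torus_neq0 _ _)).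
apply: (character_closure Aff_u (S := [set s | s (f i) = t0 (f i)])) => //.
apply: closure_subset Zt => _ /act_sweep_elt [g [_ [-> -> gf]]].
exists (torus_mul g t0); last by apply/toric_mapP; rewrite act_toric_pt.
by rewrite /= gf ?mul1r // => j; exact: lam_f0.
Qed.

Lemma sweep_toric_pt_chain (S : set (PP k N.+1)) (t0 : torus k M) :
  (forall g : torus k M,
     (forall v, (forall i, (i < d)%N -> lam i v = 0) -> g v = 1) ->
     S (toric_pt u (torus_mul g t0))) ->
  exists C, irreducible_chain S d C.
Proof.
move=> St; pose Z := sweep (act_cochar u lam) [set toric_pt u t0].
exists (fun i => S `&` closure (Z i)); apply: chain_of_closures.
- move=> i id; split.
    apply: irreducible_act_sweep; split; first by exists (toric_pt u t0).
    by move=> Z1 Z2 _ _ Z12; have [] := Z12 _ erefl; [left|right] => _ ->.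
  move=> _ /act_sweep_elt [g [_ [-> -> gf]]]; rewrite act_toric_pt; apply: St => v v0.
  by apply: gf => j ji; apply: v0; exact: leq_trans ji id.
- by move=> i _; exact: sub_act_sweep.
- by move=> i id; exact: sweep_toric_pt_strict.
Qed.

End SweepChains.

Lemma krull_dim_toric (k : closedFieldType) (M : zmodType) (n : nat)
    (c : {additive M -> 'rV[int]_n}) (N : nat) (u : 'I_N.+1 -> M) :
  bijective c -> Aff u = setT -> krull_dim (toric k u) n.
Proof.
move=> c_bij Aff_u; split; last first.
  by move=> e C; apply: (chain_le c_bij (u := u)).
have [f fE] := ncoord_dual c_bij.
pose lam i : {additive M -> int} := ncoord c i.
apply: (@sweep_toric_pt_chain _ _ _ _ Aff_u lam f n _ _ _ torus1).
- by move=> i j id ji; rewrite /lam /= fE ?(ltn_eqF ji) // (ltn_trans ji id).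
- by move=> i id; rewrite /lam /= fE // eqxx.
- by move=> g _; exact: toric_pt_in.
Qed.

(** * Row spaces and Pluecker coordinates *)

Section RowSpace.
Variables (k : fieldType) (m : nat).

Definition rowsp p (G : 'M[k]_(p, m)) : {vspace 'rV[k]_m} :=
  limg (linfun (mulmxr G : 'rV[k]_p -> 'rV[k]_m)).

Lemma rowspP p (G : 'M[k]_(p, m)) v : reflect (exists a, v = a *m G) (v \in rowsp G).
Proof.
apply: (iffP memv_imgP) => [[a _ ->]|[a ->]]; first by exists a; rewrite lfunE.
by exists a; rewrite ?memvf // lfunE.
Qed.

Lemma dim_rowsp p (G : 'M[k]_(p, m)) : row_free G -> \dim (rowsp G) = p.
Proof.
move=> fG; rewrite /rowsp limg_dim_eq; first by rewrite dimvf /dim /= mul1n.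
apply/eqP; rewrite -subv0; apply/subvP => a; rewrite memv_cap memv_ker lfunE /=.
move=> /andP[_ /eqP aG]; rewrite memv0; apply/eqP.
by apply: (row_free_inj fG); rewrite aG mul0mx.
Qed.

Lemma rowsp_sub_eq p (G : 'M[k]_(p, m)) (W : {vspace 'rV[k]_m}) :
  row_free G -> \dim W = p -> (forall v, v \in W -> v \in rowsp G) -> W = rowsp G.
Proof.
move=> fG dW sub; apply/eqP; rewrite eqEdim; apply/andP; split; first exact/subvP.
by rewrite dW dim_rowsp.
Qed.

End RowSpace.

Lemma cast_ord_bij (p q : nat) (E : p = q) :
  {on predT, bijective (cast_ord (esym E))}.
Proof. by exists (cast_ord E) => i _; rewrite (cast_ordK, cast_ordKV). Qed.

Section Minors.
Variables (k : fieldType) (m n : nat).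
Implicit Types (W : {vspace 'rV[k]_m}) (G : 'M[k]_(n.+1, m)).

Definition minors (R : comNzRingType) (G : 'M[R]_(n.+1, m)) :
    'rV[R]_#|{: pluecker_index m n}| :=
  \row_(J < #|{: pluecker_index m n}|) \det (colsub (val (enum_val J)) G).

Lemma minors_mul (A : 'M[k]_n.+1) G : minors (A *m G) = \det A *: minors G.
Proof.
apply/rowP => J; rewrite !mxE -det_mulmx; congr (\det _).
by apply/matrixP => i j; rewrite !mxE; apply: eq_bigr => l _; rewrite !mxE.
Qed.

Definition vbasis_mx W : 'M[k]_(n.+1, m) := \matrix_(i < n.+1, j < m) (vbasis W)`_i 0 j.

Lemma plueckerE W : pluecker n W = minors (vbasis_mx W).
Proof.
apply/rowP => J; rewrite !mxE; congr (\det _).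
by apply/matrixP => i j; rewrite !mxE.
Qed.

Lemma vbasis_mx_coord W v : \dim W = n.+1 -> v \in W -> exists a, v = a *m vbasis_mx W.
Proof.
move=> dW vW; exists (\row_i coord (vbasis W) (cast_ord (esym dW) i) v).
rewrite {1}(coord_vbasis vW) mulmx_sum_row.
rewrite (reindex _ (cast_ord_bij dW)) /=; apply: eq_bigr => i _.
by rewrite mxE; congr (_ *: _); apply/rowP => j; rewrite !mxE.
Qed.

Lemma vbasis_mx_sub W : \dim W = n.+1 -> forall a, a *m vbasis_mx W \in W.
Proof.
move=> dW a; rewrite mulmx_sum_row; apply: memv_suml => i _; apply: memvZ.
suff -> : row i (vbasis_mx W) = (vbasis W)`_i.
  by apply/vbasis_mem/mem_nth; rewrite size_tuple dW.
by apply/rowP => j; rewrite !mxE.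
Qed.

Lemma rowsp_vbasis_mx W : \dim W = n.+1 -> rowsp (vbasis_mx W) = W.
Proof.
move=> dW; apply/vspaceP => v; apply/rowspP/idP => [[a ->]|]; first exact: vbasis_mx_sub.
exact: vbasis_mx_coord.
Qed.

Lemma vbasis_mx_free W : \dim W = n.+1 -> row_free (vbasis_mx W).
Proof.
move=> dW; apply: inj_row_free => a; rewrite mulmx_sum_row => a0.
have /freeP := basis_free (vbasisP W).
move=> /(_ (fun i => a 0 (cast_ord dW i))) H; apply/rowP => i; rewrite mxE.
have -> : i = cast_ord dW (cast_ord (esym dW) i) by rewrite cast_ordKV.
apply: H; rewrite -[RHS]a0 (reindex _ (cast_ord_bij dW)) /=.
apply: eq_bigr => j _; rewrite cast_ordKV; congr (_ *: _).
by apply/rowP => l; rewrite !mxE.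
Qed.

(** A change of basis multiplies all maximal minors by its determinant. *)
Lemma pluecker_rowsp G : row_free G -> exists2 a, a != 0 &
  minors G = a *: pluecker n (rowsp G).
Proof.
move=> fG; have dW := dim_rowsp fG; set W := rowsp G in dW *.
have /choice[A AP] i : exists a, row i G = a *m vbasis_mx W.
  by apply: vbasis_mx_coord => //; apply/rowspP; exists (delta_mx 0 i); rewrite rowE.
have GE : G = \matrix_i A i *m vbasis_mx W.
  by apply/row_matrixP => i; rewrite row_mul rowK.
exists (\det (\matrix_i A i)); last by rewrite {1}GE minors_mul plueckerE.
rewrite -unitfE -unitmxE -row_free_unit -row_leq_rank.
by rewrite -{1}(eqP fG) {1}GE mxrankM_maxl.
Qed.

End Minors.

(** * Tangent spaces of a toric variety *)

Section ToricTangent.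
Variables (k : closedFieldType) (M : zmodType) (n : nat).
Variables (c : {additive M -> 'rV[int]_n}) (c_bij : bijective c).
Variables (N : nat) (u : 'I_N.+1 -> M) (Aff_u : Aff u = setT).

Local Notation XA := (toric k u).
Local Notation phi := (@toric_pt k M N u).

(** Homogeneous coordinates [1, c v] of a lattice point. *)
Definition hcoord (v : M) (l : 'I_n.+1) : int :=
  if unlift ord0 l is Some l' then c v 0 l' else 1.

Lemma hcoord0 v : hcoord v ord0 = 1.
Proof. by rewrite /hcoord unlift_none. Qed.

Lemma hcoordS v l : hcoord v (lift ord0 l) = c v 0 l.
Proof. by rewrite /hcoord liftK. Qed.

(** Since the points affinely generate the lattice, the integer matrix of their
    homogeneous coordinates has an integer left inverse; it keeps full rank
    modulo every prime, which is how arbitrary characteristic is covered. *)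
Lemma affine_left_inverse : exists Q : 'I_n.+1 -> 'I_N.+1 -> int,
  [/\ forall l l', \sum_j Q l j * hcoord (u j) l' = (l == l')%:Z,
      forall v, \sum_i \sum_l hcoord v l * Q l i = 1 &
      forall v, v = \sum_i u i *~ (\sum_l hcoord v l * Q l i)].
Proof.
have [e [ce eE]] := exists_basis c_bij.
have [a0 sa0 ua0] : Aff u 0 by rewrite Aff_u.
have /choice[q qP] l : exists a : 'I_N.+1 -> int,
    \sum_j a j = 0 /\ e l = \sum_j u j *~ a j.
  by have [a] := zero_sum_combination Aff_u (e l); exists a.
pose Q (l : 'I_n.+1) := if unlift ord0 l is Some l' then q l' else a0.
have Q0 : Q ord0 = a0 by rewrite /Q unlift_none.
have QS l : Q (lift ord0 l) = q l by rewrite /Q liftK.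
have sumQ l : \sum_j Q l j = (l == ord0)%:Z.
  case: (unliftP ord0 l) => [l' ->|->]; last by rewrite Q0 eqxx.
  by rewrite QS (qP l').1 eq_sym (negPf (neq_lift _ _)).
exists Q; split=> [l l'|v|v].
- case: (unliftP ord0 l') => [i ->|->]; last first.
    by under eq_bigr do rewrite hcoord0 mulr1.
  have cE (a : 'I_N.+1 -> int) :
      \sum_j a j * hcoord (u j) (lift ord0 i) = c (\sum_j u j *~ a j) 0 i.
    rewrite raddf_sum summxE; apply: eq_bigr => j _.
    by rewrite hcoordS raddfMz -scaler_int intz !mxE.
  rewrite cE; case: (unliftP ord0 l) => [l0 ->|->].
    by rewrite QS -(qP l0).2 ce mxE eqxx (inj_eq lift_inj) eq_sym natz.
  by rewrite Q0 -ua0 raddf0 mxE (negPf (neq_lift _ _)).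
- rewrite exchange_big /=; under eq_bigr => l _ do rewrite -mulr_sumr sumQ.
  rewrite big_ord_recl big1 => [|l _]; first by rewrite hcoord0 addr0.
  by rewrite eq_sym (negPf (neq_lift _ _)) mulr0.
- transitivity (\sum_l (\sum_i u i *~ Q l i) *~ hcoord v l); last first.
    under eq_bigr => l _ do rewrite mulrz_suml.
    rewrite exchange_big; apply: eq_bigr => i _; rewrite mulrz_sumr.
    by apply: eq_bigr => l _; rewrite mulrC mulrzA.
  rewrite big_ord_recl Q0 -ua0 mul0rz add0r [LHS]eE; apply: eq_bigr => l _.
  by rewrite QS -(qP l).2 hcoordS.
Qed.

Definition hcoord_mx : 'M[k]_(N.+1, n.+1) := \matrix_(j, l) (hcoord (u j) l)%:~R.

Lemma hcoord_mx_left_inverse : exists Q : 'M[k]_(n.+1, N.+1), Q *m hcoord_mx = 1%:M.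
Proof.
have [Q [QP _ _]] := affine_left_inverse; exists (\matrix_(l, j) (Q l j)%:~R).
apply/matrixP => l l'; rewrite !mxE [RHS]pmulrn -QP.
by rewrite rmorph_sum; apply: eq_bigr => j _; rewrite !mxE rmorphM.
Qed.

Definition tangent_mx (t : torus k M) : 'M[k]_(n.+1, N.+1) :=
  \matrix_(l, j) (t (u j) * hcoord_mx j l).

Lemma tangent_mxE t : tangent_mx t = hcoord_mx^T *m diag_mx (\row_j t (u j)).
Proof.
by apply/matrixP => l j; rewrite mul_mx_diag !mxE mulrC.
Qed.

Lemma tangent_mx_free t : row_free (tangent_mx t).
Proof.
have [Q QP] := hcoord_mx_left_inverse.
apply: inj_row_free => a; rewrite tangent_mxE mulmxA => a0.
have aP : a *m hcoord_mx^T = 0.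
  apply/rowP => j; rewrite mxE; apply: (mulIf (torus_neq0 t (u j))).
  by move/rowP/(_ j): a0; rewrite mul_mx_diag !mxE mul0r.
by rewrite -[a]mulmx1 -trmx1 -QP trmx_mul mulmxA aP mul0mx.
Qed.

(** Differentiate along the curve [a |-> t(u_j) a ^ L_j] at [a = 1]. *)
Lemma tangent_monomial (t : torus k M) (F : {mpoly k[N.+1]}) (L : 'I_N.+1 -> nat) :
  (forall a, a != 0 -> heval F (\row_j (t (u j) * a ^+ L j)) = 0) ->
  \sum_i heval F^`M(i) (\row_j t (u j)) * (t (u i) * (L i)%:R) = 0.
Proof.
move=> F0; pose q j : {poly k} := t (u j) *: 'X^(L j).
have : along q F = 0.
  apply: poly_eq0_units => a a0; rewrite horner_along -[RHS](F0 a a0).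
  by congr (heval F _); apply/rowP => j; rewrite !mxE hornerZ hornerXn.
move/(congr1 (fun p => p^`().[1])); rewrite deriv_along linear0 horner0 => q0.
rewrite -[RHS]q0; apply: eq_bigr => i _; congr (_ * _).
  by congr (heval _ _); apply/rowP => j; rewrite !mxE hornerZ hornerXn expr1n mulr1.
by rewrite /q derivZ derivXn hornerZ hornerMn hornerXn expr1n.
Qed.

(** The inclusion of the span of the logarithmic derivatives comes from
    differentiating along one-parameter subgroups, and the reverse inclusion
    from the binomial equations, whose gradients detect every integral relation
    between the points. *)
Lemma tangent_toric_pt t : is_tangent XA (phi t) (rowsp (tangent_mx t)).
Proof.
move=> v; split.
  move=> /rowspP[al ->] F d hF FX w.
  rewrite /phi /= => /vlineP[a ->]; apply: homog_scale_grad hF _.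
  have FL (K : nat) (L : 'I_N.+1 -> nat) (lam : {additive M -> int}) :
      (forall j, (L j)%:Z = lam (u j) + K%:Z) ->
      \sum_i heval F^`M(i) (\row_j t (u j)) * (t (u i) * (L i)%:R) = 0.
    move=> LE; apply: tangent_monomial => b b0.
    have -> : \row_j (t (u j) * b ^+ L j) =
        b ^+ K *: \row_j torus_mul t (cochar lam b) (u j).
      apply/rowP => j; rewrite !mxE /= unit_partE // exprnP LE expfzDr //.
      by rewrite -exprnP [RHS]mulrC mulrA.
    have := FX _ (toric_pt_in (t := torus_mul t (cochar lam b))).
    by apply; rewrite memvZ ?memv_line.
  have F0 : \sum_i heval F^`M(i) (\row_j t (u j)) * t (u i) = 0.
    have := FL 1%N (fun=> 1%N) \0%R; rewrite /=.
    by under eq_bigr do rewrite mulr1; apply=> j; rewrite add0r.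
  have Fl l : \sum_i heval F^`M(i) (\row_j t (u j)) * (t (u i) * hcoord_mx i l) = 0.
    case: (unliftP ord0 l) => [l' ->|->]; last first.
      by rewrite -[RHS]F0; apply: eq_bigr => i _; rewrite mxE hcoord0 mulr1.
    pose K := (\sum_j absz (ncoord c l' (u j)))%N.
    have ge0 j : 0 <= ncoord c l' (u j) + K%:Z.
      apply: (@Order.POrderTheory.le_trans _ _
               (ncoord c l' (u j) + (absz (ncoord c l' (u j)))%:Z)).
        by case: (ncoord c l' (u j)) => i //=; rewrite NegzE addNr.
      by rewrite Num.Theory.lerD2l lez_nat /K (bigD1 j) //= leq_addr.
    have := FL K (fun j => absz (ncoord c l' (u j) + K%:Z)) (ncoord c l').
    move=> /(_ (fun j => gez0_abs (ge0 j))) FK.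
    have absE i : (absz (ncoord c l' (u i) + K%:Z))%:R =
        hcoord_mx i (lift ord0 l') + K%:R :> k.
      by rewrite pmulrn gez0_abs // rmorphD /= mxE hcoordS -ncoord_ord -pmulrn.
    move: FK; under eq_bigr do rewrite absE mulrDr mulrDr.
    rewrite big_split /= => FK; rewrite -[RHS]FK -[LHS]addr0; congr (_ + _).
    under eq_bigr do rewrite mulrA.
    by rewrite -mulr_suml F0 mul0r.
  under eq_bigr => i _.
    rewrite mxE mulr_sumr; under eq_bigr => l _ do rewrite mulrCA mxE.
    over.
  by rewrite exchange_big big1 //= => l _; rewrite -mulr_sumr Fl mulr0.
move=> Hv; have [Q [QP Q1 QE]] := affine_left_inverse.
pose w := \row_j t (u j); pose y j := v 0 j / t (u j).
have w0 j : w 0 j != 0 by rewrite mxE torus_neq0.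
have rel (a : 'I_N.+1 -> int) : \sum_j a j = 0 -> \sum_j u j *~ a j = 0 ->
    \sum_j (a j)%:~R * y j = 0.
  move=> a0 ua; have wa : \prod_j w 0 j ^ a j = 1.
    by under eq_bigr do rewrite mxE; rewrite -torus_lincomb ua chi0.
  have := @grad_binomial k _ a 1 w v w0 wa.
  rewrite (Hv _ _ (binomial_homog 1 a0)).
  - move=> /(_ erefl) H0; rewrite -[RHS]H0; apply: eq_bigr => j _.
    by rewrite [w 0 j]mxE.
  - by move=> x; exact: toric_binomial.
  - exact: memv_line.
apply/rowspP; exists (\row_l \sum_i (Q l i)%:~R * y i); apply/rowP => j.
(* The left inverse expresses the j-th point by all points; the difference of the
   two expressions is an integral relation. *)
rewrite mxE; pose a i : int := (i == j)%:Z - \sum_l hcoord (u j) l * Q l i.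
have a0 : \sum_i a i = 0.
  rewrite sumrB Q1 (bigD1 j) //= eqxx big1 ?addr0 ?subrr // => i.
  by move=> /negPf->.
have ua : \sum_i u i *~ a i = 0.
  under eq_bigr => i _ do rewrite mulrzBr.
  rewrite sumrB -QE (bigD1 j) //= eqxx big1 ?addr0 ?mulr1z ?subrr // => i.
  by move=> /negPf->.
have := rel a a0 ua; under eq_bigr => i _ do rewrite rmorphB rmorph_sum mulrBl.
rewrite sumrB (bigD1 j) //= eqxx big1 => [|i /negPf->]; last by rewrite mul0r.
rewrite addr0 mul1r => /eqP; rewrite subr_eq0 => /eqP yE.
have -> : v 0 j = y j * t (u j) by rewrite /y divfK ?torus_neq0.
transitivity (\sum_i \sum_l (hcoord (u j) l * Q l i)%:~R * y i * t (u j)).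
  by rewrite yE mulr_suml; apply: eq_bigr => i _; rewrite !mulr_suml.
rewrite exchange_big; apply: eq_bigr => l _; rewrite !mxE mulr_suml.
apply: eq_bigr => i _; rewrite rmorphM /=.
by rewrite -!mulrA mulrC -!mulrA; congr (_ * (_ * _)); rewrite mulrC.
Qed.

Lemma gauss_toric_pt t : gauss XA n (phi t) (rowsp (tangent_mx t)).
Proof.
split.
- exact: (krull_dim_toric k c_bij Aff_u).
- exact: toric_pt_in.
- exact: tangent_toric_pt.
- by rewrite dim_rowsp ?tangent_mx_free.
Qed.

End ToricTangent.

(** * Affine bases and the fibres of the Gauss map on the torus *)

Section AffineBases.
Variables (k : closedFieldType) (M : zmodType) (n : nat).
Variables (c : {additive M -> 'rV[int]_n}) (c_bij : bijective c).
Variables (N : nat) (u : 'I_N.+1 -> M) (Aff_u : Aff u = setT).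
Implicit Types (s : 'I_n.+1 -> 'I_N.+1) (t : torus k M).

Local Notation P := (@hcoord_mx k M n c N u).
Local Notation G := (@tangent_mx k M n c N u).
Local Notation B := (Bset k c u).
Local Notation idx := (pluecker_index N.+1 n).

Definition affine_det s : k := \det (rowsub s P).

Lemma span_affineP s :
  span_affine (fun j => scalar_ext k c (u (s j))) <-> affine_det s != 0.
Proof.
have AP (a : 'rV[k]_n.+1) l' : (a *m rowsub s P) 0 (lift ord0 l') =
    (\sum_i a 0 i *: scalar_ext k c (u (s i))) 0 l'.
  rewrite summxE mxE; apply: eq_bigr => i _.
  by rewrite !mxE hcoordS.
have A0 (a : 'rV[k]_n.+1) : (a *m rowsub s P) 0 ord0 = \sum_i a 0 i.
  by rewrite mxE; apply: eq_bigr => i _; rewrite !mxE hcoord0 mulr1.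
rewrite -unitfE -unitmxE; split=> [span|uA].
  have sol (x : 'rV[k]_n.+1) : exists a, a *m rowsub s P = x.
    have [a1 s1 v1] := span (\row_l x 0 (lift ord0 l)).
    have [a0 s0 v0] := span 0.
    exists (\row_i (a1 i + (x 0 ord0 - 1) * a0 i)); apply/rowP => l.
    case: (unliftP ord0 l) => [l' ->|->].
      rewrite AP; under eq_bigr do rewrite mxE scalerDl -scalerA.
      by rewrite big_split /= -v1 -scaler_sumr -v0 scaler0 addr0 mxE.
    rewrite A0; under eq_bigr do rewrite mxE.
    by rewrite big_split /= s1 -mulr_sumr s0 mulr1 addrC subrK.
  have /choice[a aE] (l : 'I_n.+1) := sol (delta_mx 0 l).
  have /mulmx1_unit[] // : (\matrix_l a l) *m rowsub s P = 1%:M.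
  by apply/row_matrixP => l; rewrite row_mul rowK aE row1.
move=> v; pose x : 'rV[k]_n.+1 :=
  \row_l if unlift ord0 l is Some l' then v 0 l' else 1.
pose a := x *m invmx (rowsub s P).
have ax : a *m rowsub s P = x by rewrite mulmxKV.
exists (fun i => a 0 i).
  by rewrite -A0 ax mxE unlift_none.
by apply/rowP => l; rewrite -AP ax mxE liftK.
Qed.

Lemma affine_det_inj s : affine_det s != 0 -> injective s.
Proof.
move=> ds i j sij; apply/eqP; apply: contraNT ds => ij.
by apply/eqP; apply: (determinant_alternate ij) => l; rewrite !mxE sij.
Qed.

Lemma minors_tangent_mx t (J : 'I_#|{: idx}|) :
  minors (G t) 0 J = affine_det (val (enum_val J)) * t (\sum_i u (val (enum_val J) i)).
Proof.
rewrite mxE torus_sum; set s := val _.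
have -> : colsub s (G t) = (rowsub s P)^T *m diag_mx (\row_j t (u (s j))).
  by apply/matrixP => i j; rewrite mul_mx_diag !mxE mulrC.
rewrite det_mulmx det_tr det_diag; congr (_ * _).
by apply: eq_bigr => i _; rewrite mxE.
Qed.

Lemma increasing_enum_val (m : nat) (A : {set 'I_m}) (i j : 'I_#|A|) :
  (i < j)%N -> (enum_val i < enum_val j)%N.
Proof.
move=> ij; have x0 : 'I_m := enum_val i.
rewrite !(enum_val_nth x0).
have srt : sorted (fun x y : 'I_m => (x < y)%N) (enum A).
  rewrite {1}/enum_mem; apply: sorted_filter; first by move=> x y z; exact: ltn_trans.
  have := iota_ltn_sorted 0 m; rewrite -val_enum_ord sorted_map.
  by rewrite enumT.
apply: (sorted_ltn_nth _ x0 srt) ij; rewrite ?inE -?cardE //.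
by move=> x y z; exact: ltn_trans.
Qed.

(** An unordered affine basis has exactly one increasing enumeration, and
    reordering changes the determinant by a sign only. *)
Lemma increasing_basis s : affine_det s != 0 ->
  exists J : idx, affine_det (val J) != 0 /\ \sum_i u (val J i) = \sum_i u (s i).
Proof.
move=> ds; have s_inj := affine_det_inj ds.
pose A := [set s i | i in 'I_n.+1]%SET.
have cA : #|A| = n.+1 by rewrite card_imset // card_ord.
pose J := [ffun i : 'I_n.+1 => enum_val (cast_ord (esym cA) i) : 'I_N.+1].
have Jinc : [forall i : 'I_n.+1, forall j : 'I_n.+1, (i < j)%N ==> (J i < J j)%N].
  apply/forallP => i; apply/forallP => j; apply/implyP => ij.
  by rewrite !ffunE; apply: increasing_enum_val.
have /choice[f fE] i : exists i', J i = s i'.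
  have : J i \in A by rewrite ffunE; exact: enum_valP.
  by case/imsetP => i' _ ->; exists i'.
have f_inj : injective f.
  move=> i j fij; have : J i = J j by rewrite !fE fij.
  by rewrite !ffunE => /enum_val_inj/cast_ord_inj.
exists (Sub J Jinc); rewrite SubK; split; last first.
  rewrite [RHS](reindex_inj f_inj); apply: eq_bigr => i _; by rewrite fE.
have -> : affine_det J = (-1) ^+ perm.odd_perm (perm.perm f_inj) * affine_det s.
  rewrite /affine_det -det_perm -det_mulmx -row_permE; congr (\det _).
  by apply/matrixP => i j; rewrite !mxE fE perm.permE.
by rewrite mulf_neq0 // signr_eq0.
Qed.

Lemma mem_Bset b : b \in B <-> exists J : idx,
  affine_det (val J) != 0 /\ b = \sum_i u (val J i).
Proof.
split=> [/imfsetP /= [s]|[J [dJ ->]]].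
  rewrite inE => sp ->; have ds := (span_affineP s).1 sp.
  by have [J [dJ JE]] := increasing_basis ds; exists J.
apply/imfsetP; exists (val J) => //=.
by rewrite inE; apply/span_affineP.
Qed.

Lemma exists_basis_index : exists J : idx, affine_det (val J) != 0.
Proof.
have [Q QP] := @hcoord_mx_left_inverse k M n c c_bij N u Aff_u.
have fP : row_full P by apply/row_fullP; exists Q.
have := fullrowsub_unit fP; rewrite unitmxE unitfE => /increasing_basis[J []].
by exists J.
Qed.

(** Cramer's rule: if the point [u j] involves [u (s i)] in the affine basis
    [s], exchanging them gives another basis. *)
Lemma exchange_basis s i j : affine_det s != 0 ->
  (P *m invmx (rowsub s P)) j i != 0 ->
  affine_det (fun l => if l == i then j else s l) != 0.
Proof.
move=> ds; have uA : rowsub s P \in unitmx by rewrite unitmxE unitfE.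
set s' := fun l => _; apply: contra => /eqP ds'.
rewrite /invmx uA -scalemxAr mxE mulf_eq0; apply/orP; right.
rewrite -[X in _ == X]ds' /affine_det (expand_det_row _ i) mxE; apply/eqP/eq_bigr => l _.
rewrite !mxE /s' eqxx /cofactor; congr (_ * (_ * \det _)).
by apply/matrixP => a b; rewrite !mxE eq_sym (negPf (neq_lift _ _)).
Qed.

Lemma torus_eq_gen t t' :
  (forall b b' : B, t (val b - val b') = t' (val b - val b')) ->
  forall v, v \in gen (diffs B) -> t v = t' v.
Proof.
move=> H v /asboolP /(_ [pred v | t v == t' v]).
move=> vG; apply/eqP; apply: vG; last first.
  by move=> w [b [b' ->]]; rewrite inE H.
split=> [|a b]; first by rewrite inE !chi0.
by rewrite !inE !torusB => /eqP-> /eqP->.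
Qed.

(** Let [g = t / t'].  Expanding a point in an affine basis [s] only involves
    basis points that can be exchanged with it, on which [g] takes the same value;
    hence multiplying the rows of the matrix of points by [g] amounts to a
    multiplication by the square matrix [Y] on the right. *)
Lemma rowsp_tangent_mx_eq t t' : (forall v, v \in gen (diffs B) -> t v = t' v) ->
  rowsp (G t) = rowsp (G t').
Proof.
move=> tt'; have [J dJ] := exists_basis_index; pose s : 'I_n.+1 -> 'I_N.+1 := val J.
have uA : rowsub s P \in unitmx by rewrite unitmxE unitfE.
pose g v := t v / t' v.
have gs i j : (P *m invmx (rowsub s P)) j i != 0 -> g (u (s i)) = g (u j).
  move=> /(exchange_basis dJ); set s' := fun l => _ => ds'.
  have b'B : \sum_l u (s' l) \in B.
    by have [J' [dJ' <-]] := increasing_basis ds'; apply/mem_Bset; exists J'.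
  have bB : \sum_l u (s l) \in B by apply/mem_Bset; exists J.
  have bb' : \sum_l u (s' l) - \sum_l u (s l) = u j - u (s i).
    rewrite (bigD1 i) //= [X in _ - X](bigD1 i) //= {1}/s' eqxx.
    rewrite (eq_bigr (fun l => u (s l))) => [|l /negPf li]; last by rewrite /s' li.
    by rewrite opprD addrACA subrr addr0.
  have := tt' _ (diff_subproof [` b'B]%fset [` bB]%fset).
  rewrite /= bb' !torusB /g => /eqP; rewrite eqr_div ?torus_neq0 // => /eqP E.
  by apply/eqP; rewrite eqr_div ?torus_neq0 // mulrC -E.
pose Y := invmx (rowsub s P) *m (diag_mx (\row_i g (u (s i))) *m rowsub s P).
apply: rowsp_sub_eq; rewrite ?dim_rowsp ?tangent_mx_free //.
move=> v /rowspP[a ->]; apply/rowspP; exists (a *m Y^T); rewrite -mulmxA.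
congr (_ *m _); apply/matrixP => l j.
have PY : (P *m Y) j l = g (u j) * P j l.
  have PE : P j l = ((P *m invmx (rowsub s P)) *m rowsub s P) j l by rewrite mulmxKV.
  rewrite PE mulmxA; move: (P *m invmx (rowsub s P)) gs => al gs.
  rewrite mxE [in RHS]mxE mulr_sumr; apply: eq_bigr => i _.
  rewrite mul_diag_mx mxE [X in _ * (X * _) = _]mxE.
  have [->|/gs->] := eqVneq (al j i) 0; first by rewrite !mul0r mulr0.
  by rewrite mulrCA.
rewrite mxE [RHS]mxE; under eq_bigr do rewrite mxE [G t' _ _]mxE mulrC -mulrA.
rewrite -mulr_sumr.
have -> : \sum_i P j i * Y i l = (P *m Y) j l by rewrite [RHS]mxE.
by rewrite PY mulrA /g mulrCA mulfV ?torus_neq0 // mulr1.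
Qed.

(** Equal tangent spaces have proportional minors, and the ratio of two nonzero
    minors is a determinant quotient times the value of a character in <B - B>. *)
Lemma rowsp_tangent_mxP t t' :
  rowsp (G t) = rowsp (G t') <-> forall v, v \in gen (diffs B) -> t v = t' v.
Proof.
split; last exact: rowsp_tangent_mx_eq.
move=> GG; have fG r : row_free (G r) by exact: tangent_mx_free.
have [a a0 mE] := pluecker_rowsp (fG t); have [a' a'0 mE'] := pluecker_rowsp (fG t').
rewrite GG in mE.
apply: torus_eq_gen => b b'.
have key (x : B) : a' * t (val x) = a * t' (val x).
  have [J [dJ ->]] := (mem_Bset (val x)).1 (valP x).
  have E : minors (G t) 0 (enum_rank J) = a * pluecker n (rowsp (G t')) 0 (enum_rank J).
    by rewrite mE mxE.
  have E' : minors (G t') 0 (enum_rank J) =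
      a' * pluecker n (rowsp (G t')) 0 (enum_rank J).
    by rewrite mE' mxE.
  move: E E'; rewrite !minors_tangent_mx enum_rankK => E E'.
  by apply: (mulfI dJ); rewrite mulrCA E [RHS]mulrCA E' mulrCA.
rewrite !torusB; apply/eqP; rewrite eqr_div ?torus_neq0 //.
apply/eqP/(mulfI (mulf_neq0 a0 a'0)).
transitivity ((a' * t (val b)) * (a * t' (val b'))).
  by rewrite [a * a']mulrC mulrACA.
by rewrite (key b) -(key b') mulrACA.
Qed.

End AffineBases.

(** * Equivariance and continuity of the Gauss map *)

Section GaussContinuity.
Variables (k : closedFieldType) (m : nat) (n : nat) (X : set (PP k m)).
Implicit Types (F : {mpoly k[m]}) (x y : PP k m) (W : {vspace 'rV[k]_m}).

Definition homog_equation F := (exists d, F \is d.-homog) /\ forall y, X y -> vanish F y.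

Definition jacobian (fs : seq {mpoly k[m]}) : 'M[{mpoly k[m]}]_(m, size fs) :=
  \matrix_(j, i) (fs`_i)^`M(j).

Definition jacobian_at fs (w : 'rV[k]_m) : 'M[k]_(m, size fs) :=
  map_mx (meval (fun i => w 0 i)) (jacobian fs).

Lemma jacobian_kerP fs (w v : 'rV[k]_m) : v *m jacobian_at fs w = 0 <->
  forall F, F \in fs -> \sum_j heval F^`M(j) w * v 0 j = 0.
Proof.
split=> [vJ F|H].
  move=> /(nthP 0)[i ifs <-]; move/rowP/(_ (Ordinal ifs)): vJ; rewrite mxE [RHS]mxE.
  by move=> vJ; rewrite -[RHS]vJ; apply: eq_bigr => j _; rewrite !mxE mulrC.
apply/rowP => i; rewrite mxE [RHS]mxE -[RHS](H fs`_i) ?mem_nth //.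
by apply: eq_bigr => j _; rewrite !mxE mulrC.
Qed.

(** Finitely many equations suffice at a given point: those of maximal Jacobian
    rank. *)
Lemma tangent_finite x W w : is_tangent X x W -> line x = <[w]>%VS ->
  exists fs, (forall F, F \in fs -> homog_equation F) /\
    forall v, v *m jacobian_at fs w = 0 -> v \in W.
Proof.
move=> tW xw.
pose ok r := `[< exists fs, (forall F, F \in fs -> homog_equation F) /\
                            \rank (jacobian_at fs w) = r >].
have ex : exists r, ok r.
  exists (\rank (jacobian_at [::] w)); apply/asboolP; exists [::].
  by split=> // F; rewrite in_nil.
have ub r : ok r -> (r <= m)%N by move=> /asboolP[fs [_ <-]]; exact: rank_leq_row.
case: (ex_maxnP ex ub) => r /asboolP[fs [eqfs rE]] maxr.
exists fs; split=> // v vJ; apply: contrapT => nvW.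
have [F [d [hF FX Fv]]] : exists F d, [/\ F \is d.-homog,
    forall y, X y -> vanish F y & \sum_j heval F^`M(j) w * v 0 j <> 0].
  apply: contrapT => H; apply: nvW; apply/tW => F d hF FX w'.
  rewrite xw => /vlineP[a ->]; apply: (homog_scale_grad _ hF).
  by apply: contrapT => Fv; apply: H; exists F, d.
have : (r < r)%N; last by rewrite ltnn.
rewrite -{1}rE; apply: leq_trans (maxr (\rank (jacobian_at (F :: fs) w)) _); last first.
  apply/asboolP; exists (F :: fs); split=> // F'; rewrite inE => /predU1P[->|/eqfs//].
  by split=> //; exists d.
have kerlt : (kermx (jacobian_at (F :: fs) w) < kermx (jacobian_at fs w))%MS.
  rewrite ltmxE; apply/andP; split.
    apply/row_subP => i; apply/sub_kermxP/jacobian_kerP => F' F'fs.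
    have /sub_kermxP/jacobian_kerP := row_sub i (kermx (jacobian_at (F :: fs) w)).
    by apply; rewrite inE F'fs orbT.
  apply/negP => sub; apply: Fv.
  have /sub_kermxP/jacobian_kerP : (v <= kermx (jacobian_at (F :: fs) w))%MS.
    by apply: submx_trans sub; apply/sub_kermxP.
  by apply; rewrite inE eqxx.
move/rank_ltmx: kerlt; rewrite !mxrank_ker; apply: contraTT; rewrite -!leqNgt.
exact: leq_sub2l.
Qed.

(** Near a point [x] with tangent space [W], spanned by the rows of [V], the
    tangent spaces are spanned by the rows of [V *m \adj S] for a polynomial
    matrix [S] with [S = 1] at [x]: with [A] the Jacobian matrix at [x] and [R]
    a generalized inverse of it, [1 - A *m R] projects onto [W], so
    [S = 1 - A *m R + J *m R] maps the kernel of the Jacobian matrix [J] at any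
    point into [W].  Pluecker coordinates are therefore polynomial functions
    near [x], up to a common factor, and equations for the Gauss image extend to
    the closure. *)
Lemma gauss_closure (S : set (PP k m)) (H : {mpoly k[#|{: pluecker_index m n}|]})
    x W :
  (forall y, S y -> exists W', [/\ is_tangent X y W', \dim W' = n.+1 &
     forall a, heval H (a *: pluecker n W') = 0]) ->
  closure S x -> is_tangent X x W -> \dim W = n.+1 ->
  heval H (pluecker n W) = 0.
Proof.
move=> SH Sx tW dW; have [w w0 xw] := lineP x.
have [fs [eqfs fsW]] := tangent_finite tW xw.
pose V := vbasis_mx n W; have VW : rowsp V = W by exact: rowsp_vbasis_mx.
have fV : row_free V by exact: vbasis_mx_free.
pose A := jacobian_at fs w; pose R := pinvmx A.
pose C p q (Z : 'M[k]_(p, q)) : 'M[{mpoly k[m]}]_(p, q) := map_mx (@mpolyC m k) Z.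
pose Sp := C _ _ (1%:M - A *m R) + jacobian fs *m C _ _ R.
pose K := C _ _ V *m \adj Sp.
pose Q := \det Sp * mmap (@mpolyC m k) (fun J => minors K 0 J) H.
pose ev (v : 'rV[k]_m) : {rmorphism {mpoly k[m]} -> k} := meval (fun i => v 0 i).
have evC v p q (Z : 'M[k]_(p, q)) : map_mx (ev v) (C _ _ Z) = Z.
  by apply/matrixP => i j; rewrite !mxE; exact: mevalC.
pose Sv v := 1%:M - A *m R + jacobian_at fs v *m R.
have evS v : map_mx (ev v) Sp = Sv v.
  by rewrite map_mxD evC map_mxM evC.
have evK v : map_mx (ev v) K = V *m \adj (Sv v).
  by rewrite map_mxM evC map_mx_adj evS.
have QE v : heval Q v = \det (Sv v) * heval H (minors (V *m \adj (Sv v))).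
  rewrite /heval -[LHS]/(ev v Q) rmorphM -det_map_mx evS; congr (_ * _).
  rewrite rmorph_mmap /meval /mmap; apply: eq_bigr => mu _.
  rewrite /= [ev v _]mevalC; congr (_ * _); apply: eq_bigr => J _.
  congr (_ ^+ _); rewrite /= -evK !mxE -det_map_mx; congr (\det _).
  by apply/matrixP => i j; rewrite !mxE.
have Sw : Sv w = 1%:M by rewrite /Sv subrK.
suff /(_ w) : vanish Q x.
  rewrite xw memv_line => /(_ isT).
  by rewrite QE Sw det1 mul1r adj1 mulmx1 plueckerE.
apply: ((closureP S x).1 Sx Q) => y Sy; have [v0 v00 yv0] := lineP y.
apply/(vanish_unitsP _ yv0) => a a0; set v := a *: v0.
rewrite QE; have [->|dS] := eqVneq (\det (Sv v)) 0; first by rewrite mul0r.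
have uS : Sv v \in unitmx by rewrite unitmxE unitfE.
have uadj : \adj (Sv v) \in unitmx.
  have /mulmx1_unit[] // : ((\det (Sv v))^-1 *: Sv v) *m \adj (Sv v) = 1%:M.
  by rewrite -scalemxAl mul_mx_adj scale_scalar_mx mulVf.
have [W' [tW' dW' HW']] := SH y Sy.
have fK : row_free (V *m \adj (Sv v)).
  by rewrite /row_free mxrankMfree ?row_free_unit.
have W'E : W' = rowsp (V *m \adj (Sv v)).
  apply: rowsp_sub_eq => // z zW'.
  have zJ : z *m jacobian_at fs v = 0.
    apply/jacobian_kerP => F /eqfs[[d hF] FX].
    by apply: ((tW' z).1 zW' F d hF FX); rewrite yv0 memvZ ?memv_line.
  have : z *m Sv v \in W.
    have -> : z *m Sv v = z *m (1%:M - A *m R).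
      by rewrite /Sv mulmxDr (mulmxA z (jacobian_at fs v)) zJ mul0mx addr0.
    apply: fsW; rewrite -/A -mulmxA mulmxBl mul1mx.
    by rewrite mulmxKpV // subrr mulmx0.
  rewrite -VW => /rowspP[b bE]; apply/rowspP; exists ((\det (Sv v))^-1 *: b).
  rewrite -scalemxAl mulmxA -bE -mulmxA mul_mx_adj mul_mx_scalar scalerA.
  by rewrite mulVf ?scale1r.
have [a' a'0 ->] := pluecker_rowsp fK.
by rewrite -W'E HW' mulr0.
Qed.

End GaussContinuity.

Section Equivariance.
Variables (k : closedFieldType) (M : zmodType) (n : nat).
Variables (N : nat) (u : 'I_N.+1 -> M).
Implicit Types (g t : torus k M).

Local Notation XA := (toric k u).

Definition torus_diag_mx g : 'M[k]_N.+1 := diag_mx (\row_j g (u j)).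

Lemma mul_torus_diag_mx g (v : 'rV[k]_N.+1) : v *m torus_diag_mx g = torus_scale u g v.
Proof. by apply/rowP => j; rewrite mul_mx_diag !mxE mulrC. Qed.

Lemma torus_scaleK g (v : 'rV[k]_N.+1) :
  torus_scale u (torus_inv g) (torus_scale u g v) = v.
Proof. by apply/rowP => j; rewrite !mxE mulKf ?torus_neq0. Qed.

Lemma torus_scaleVK g (v : 'rV[k]_N.+1) :
  torus_scale u g (torus_scale u (torus_inv g) v) = v.
Proof. by apply/rowP => j; rewrite !mxE mulVKf ?torus_neq0. Qed.

Lemma grad_dilate g F (w v : 'rV[k]_N.+1) :
  \sum_i heval (dilate_mpoly (fun j => g (u j)) F)^`M(i) w * v 0 i =
  \sum_i heval F^`M(i) (torus_scale u g w) * torus_scale u g v 0 i.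
Proof.
apply: eq_bigr => i _; rewrite mderiv_dilate [heval (_ *: _) _]mevalZ.
by rewrite -/(heval _ _) heval_dilate mxE mulrCA mulrA.
Qed.

Lemma vanish_toric_dilate g F : (forall y, XA y -> vanish F y) ->
  forall y, XA y -> vanish (dilate_mpoly (fun j => g (u j)) F) y.
Proof. by move=> FX y Xy; apply/vanish_act/FX; exact: act_toric. Qed.

(** The torus permutes the equations of a toric variety by rescaling variables. *)
Lemma tangent_act g x p (V : 'M[k]_(p, N.+1)) :
  is_tangent XA x (rowsp V) -> is_tangent XA (act u g x) (rowsp (V *m torus_diag_mx g)).
Proof.
move=> tV v; have [v0 v00 xv0] := lineP x; split.
  move=> /rowspP[a ->] F d hF FX w.
  rewrite (line_act _ _ xv0) => /vlineP[b ->].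
  rewrite -torus_scaleZ mulmxA mul_torus_diag_mx.
  rewrite -grad_dilate; have /tV : a *m V \in rowsp V by apply/rowspP; exists a.
  apply; [exact: dilate_homog hF | exact: vanish_toric_dilate |].
  by rewrite xv0 memvZ ?memv_line.
move=> H; have : torus_scale u (torus_inv g) v \in rowsp V.
  apply/tV => F d hF FX w; rewrite xv0 => /vlineP[b ->].
  have := H _ d (dilate_homog (fun j => torus_inv g (u j)) hF)
    (vanish_toric_dilate (torus_inv g) FX).
  move=> /(_ (torus_scale u g (b *: v0))); rewrite grad_dilate torus_scaleK; apply.
  by rewrite (line_act _ _ xv0) torus_scaleZ memvZ ?memv_line.
move=> /rowspP[a aE]; apply/rowspP; exists a.
by rewrite mulmxA -aE mul_torus_diag_mx torus_scaleVK.
Qed.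

Lemma torus_diag_mx_unit g : torus_diag_mx g \in unitmx.
Proof.
rewrite unitmxE unitfE det_diag; apply/prodf_neq0 => j _.
by rewrite mxE torus_neq0.
Qed.

Lemma gauss_act g x (V : 'M[k]_(n.+1, N.+1)) : row_free V ->
  gauss XA n x (rowsp V) -> gauss XA n (act u g x) (rowsp (V *m torus_diag_mx g)).
Proof.
move=> fV [dX Xx tV _]; split=> //; [exact: act_toric | exact: tangent_act |].
by rewrite dim_rowsp // /row_free mxrankMfree ?row_free_unit ?torus_diag_mx_unit.
Qed.

Lemma minors_torus_diag_mx g (V : 'M[k]_(n.+1, N.+1)) J :
  minors (V *m torus_diag_mx g) 0 J = minors V 0 J * g (\sum_i u (val (enum_val J) i)).
Proof.
rewrite !mxE torus_sum; set s := val _.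
have -> : colsub s (V *m torus_diag_mx g) = colsub s V *m diag_mx (\row_j g (u (s j))).
  by apply/matrixP => i j; rewrite mul_mx_diag [LHS]mxE mul_mx_diag !mxE.
rewrite det_mulmx det_diag; congr (_ * _).
by apply: eq_bigr => i _; rewrite mxE.
Qed.

End Equivariance.

(** * Coordinates adapted to a sublattice *)

Section AdaptedBasis.
Variables (M : zmodType) (n : nat) (c : {additive M -> 'rV[int]_n}).
Hypothesis c_bij : bijective c.
Variable B : {fset M}.

Lemma gen_diffs_rows (q : nat) (p : 'I_q -> B * B) (G : 'M[int]_(q, n)) :
  (forall b b', exists i, p i = (b, b')) ->
  (forall i, row i G = c (val (p i).1 - val (p i).2)) ->
  forall v, v \in gen (diffs B) <-> exists a, c v = a *m G.
Proof.
move=> p_surj rG v.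
split=> [/asboolP/(_ [pred v | `[< exists a, c v = a *m G >]])|[a cv]].
  move=> H; apply/asboolP; apply: H => [|w [b [b' ->]]]; last first.
    rewrite inE; have [i pE] := p_surj b b'.
    by exists (delta_mx 0 i); rewrite -rowE rG pE.
  split=> [|w w']; first by rewrite inE; exists 0; rewrite raddf0 mul0mx.
  rewrite !inE => -[a aE] [a' a'E].
  by exists (a - a'); rewrite raddfB aE a'E mulmxBl.
have -> : v = \sum_i (val (p i).1 - val (p i).2) *~ a 0 i.
  apply: (bij_inj c_bij); rewrite raddf_sum cv mulmx_sum_row.
  by apply: eq_bigr => i _; rewrite raddfMz rG -scaler_int intz.
apply: rpred_sum => i _; apply: rpredMz; apply: mem_gen.
by exists (p i).1, (p i).2.
Qed.

(** Smith normal form of the matrix of the generating differences: in a suitable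
    basis of the lattice the subgroup is cut out by divisibility and vanishing
    conditions on single coordinates. *)
Lemma exists_adapted_basis :
  exists (r s : nat) (c' : {additive M -> 'rV[int]_(r + s)}) (d : 'I_r -> nat),
  [/\ (r + s)%N = n, bijective c', forall i, (0 < d i)%N &
      forall v, v \in gen (diffs B) <->
        (forall i : 'I_r, ((d i)%:Z %| c' v 0%R (lshift s i))%Z) /\
        (forall i : 'I_s, c' v 0 (rshift r i) = 0)].
Proof.
pose q := #|{: B * B}|; pose p (i : 'I_q) : B * B := enum_val i.
pose G : 'M[int]_(q, n) := \matrix_i c (val (p i).1 - val (p i).2).
have genE := @gen_diffs_rows q p G _ (fun i => rowK _ i).
have {}genE := genE (fun b b' => ex_intro _ (enum_rank (b, b')) (enum_rankK _)).
have [L uL [R0 uR [ds _ GE]]] := int_Smith_normal_form G.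
(* Divisibility by 0 expresses vanishing, in particular beyond the [q] rows. *)
pose D (j : 'I_n) : int := if (j < q)%N then ds`_j else 0.
pose x v : 'rV[int]_n := c v *m invmx R0.
have {}genE v : v \in gen (diffs B) <-> forall j, (D j %| x v 0%R j)%Z.
  have DE (a : 'rV[int]_q) (j : 'I_n) :
      (a *m \matrix_(i, j) (ds`_i *+ (i == j :> nat))) 0 j =
      if insub (val j) is Some i then a 0 i * ds`_j else 0.
    rewrite mxE; case: insubP => [i ij iE|].
      rewrite (bigD1 i) //= mxE iE eqxx mulr1n big1 ?addr0 // => l li.
      rewrite mxE -iE (_ : (l == i :> nat) = false) ?mulr0n ?mulr0 //.
      by apply/negbTE.
    rewrite -leqNgt => qj; rewrite big1 // => i _; rewrite mxE.
    by rewrite ltn_eqF ?mulr0n ?mulr0 // (leq_trans (ltn_ord i)).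
  rewrite genE; split=> [[a cv] j|Dx].
    have -> : x v = a *m L *m \matrix_(i, j) (ds`_i *+ (i == j :> nat)).
      by rewrite /x cv GE !mulmxA mulmxK.
    rewrite DE /D; case: insubP => [i -> _|/negbTE->]; first exact: dvdz_mull.
    exact: dvdz0.
  have /choice[a aE] (i : 'I_q) : exists y : int, forall j : 'I_n,
      i = j :> nat -> x v 0 j = y * ds`_j.
    have [ni|ni] := ltnP i n; last first.
      by exists 0 => j ij; move: (ltn_ord j); rewrite -ij ltnNge ni.
    have /dvdzP[y yE] := Dx (Ordinal ni); exists y => j ij.
    by have -> : j = Ordinal ni; [exact: val_inj | rewrite yE /D /= ltn_ord].
  exists ((\row_i a i) *m invmx L); rewrite GE !mulmxA mulmxKV //.
  rewrite -[LHS](mulmxKV uR); congr (_ *m _); apply/rowP => j.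
  rewrite DE -/(x v); case: insubP => [i _ iE|jq]; first by rewrite mxE; exact: aE.
  by have := Dx j; rewrite /D (negPf jq) dvd0z => /eqP.
(* The coordinates with a nonzero divisor are listed first. *)
pose A := [set j | D j != 0]%SET.
pose sg (i : 'I_(#|A| + #|~: A|)%N) : 'I_n :=
  match split i with inl a => enum_val a | inr b => enum_val b end.
have sgl i : sg (lshift _ i) = enum_val i.
  by rewrite /sg; case: split_ordP => j /eqP; rewrite eq_shift // => /eqP->.
have sgr i : sg (rshift _ i) = enum_val i.
  by rewrite /sg; case: split_ordP => j /eqP; rewrite eq_shift // => /eqP->.
have rs : (#|A| + #|~: A|)%N = n by rewrite cardsC card_ord.
have sg_inj : injective sg.
  move=> i j; case: (split_ordP i) => i' ->; case: (split_ordP j) => j' ->;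
    rewrite ?sgl ?sgr => E.
  - by rewrite (enum_val_inj E).
  - by have := enum_valP j'; rewrite -E inE (enum_valP i').
  - by have := enum_valP i'; rewrite E inE (enum_valP j').
  - by rewrite (enum_val_inj E).
have [sg' sgK sg'K] : bijective sg by apply: inj_card_bij => //; rewrite !card_ord rs.
pose c' v : 'rV[int]_(#|A| + #|~: A|) := \row_i x v 0 (sg i).
have c'_add : zmod_morphism c'.
  move=> v w; have xB : x (v - w) = x v - x w by rewrite /x raddfB mulmxBl.
  by rewrite /c' xB; apply/rowP => i; move: (x v) (x w) => xv xw; rewrite !mxE.
pose c'A : {additive M -> _} := HB.pack c' (GRing.isZmodMorphism.Build _ _ c' c'_add).
exists #|A|, #|~: A|, c'A, (fun i => absz (D (enum_val i))); split=> //.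
- have [ci cK ciK] := c_bij.
  exists (fun y : 'rV[int]_(#|A| + #|~: A|) => ci ((\row_j y 0 (sg' j)) *m R0)) => [v|y].
    apply: (canLR cK); rewrite -[RHS](mulmxKV uR); congr (_ *m _).
    by apply/rowP => j; rewrite !mxE sg'K.
  by apply/rowP => i; rewrite /= mxE /x ciK mulmxK // mxE sgK.
- by move=> i; have := enum_valP i; rewrite inE absz_gt0.
move=> v; rewrite genE; split=> [Dx|[Dl Dr] j].
  split=> i; rewrite mxE; first by rewrite sgl dvdzE /= -dvdzE.
  have := Dx (enum_val i); have := enum_valP i; rewrite !inE negbK => /eqP->.
  by rewrite dvd0z sgr => /eqP.
rewrite -(sg'K j); case: (split_ordP (sg' j)) => i ->.
  by have := Dl i; rewrite mxE sgl dvdzE /= -dvdzE.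
by have := Dr i; rewrite mxE => ->; exact: dvdz0.
Qed.

End AdaptedBasis.

(** * Sublattices, saturations and characters *)

Lemma additive_matrix (M : zmodType) (n p : nat) (c : {additive M -> 'rV[int]_n})
    (f : {additive M -> 'rV[int]_p}) : bijective c ->
  exists T, forall v, f v = c v *m T.
Proof.
move=> c_bij; have [e [_ eE]] := exists_basis c_bij.
exists (\matrix_i f (e i)) => v; rewrite {1}(eE v) raddf_sum mulmx_sum_row.
by apply: eq_bigr => i _; rewrite rowK raddfMz -scaler_int intz.
Qed.

Section AdaptedLattice.
Variables (M : zmodType) (B : {fset M}) (r s : nat).
Variables (c' : {additive M -> 'rV[int]_(r + s)}) (c'_bij : bijective c').
Variables (d : 'I_r -> nat) (d_gt0 : forall i, (0 < d i)%N).
Hypothesis genE : forall v, v \in gen (diffs B) <->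
  (forall i : 'I_r, ((d i)%:Z %| c' v 0%R (lshift s i))%Z) /\
  (forall i : 'I_s, c' v 0 (rshift r i) = 0).

Let d_neq0 i : (d i)%:Z != 0.
Proof. by rewrite eqz_nat -lt0n. Qed.

(** The real span only sees which coordinates vanish on the sublattice: a suitable
    multiple of a vector supported on the others lies in the sublattice. *)
Lemma mem_satur (R : realType) (n : nat) (c : {additive M -> 'rV[int]_n}) v :
  bijective c ->
  (v \in satur R c B) <-> forall i : 'I_s, c' v 0 (rshift r i) = 0.
Proof.
move=> c_bij; have [T TE] := additive_matrix c' c_bij; split.
  move=> vB i.
  pose h : 'Hom('rV[R]_n, 'rV[R]_1) :=
    linfun (mulmxr (col (rshift r i) (map_mx intr T)) : 'rV[R]_n -> 'rV[R]_1).
  have hE w : h (scalar_ext R c w) 0 0 = (c' w 0 (rshift r i))%:~R.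
    transitivity ((scalar_ext R c w *m map_mx intr T) 0 (rshift r i)); last first.
      by rewrite -map_mxM -TE mxE.
    by rewrite lfunE /= mxE [RHS]mxE; apply: eq_bigr => j _; rewrite !mxE.
  have /subvP sub : (<<[seq scalar_ext R c (b - b') | b <- B, b' <- B]>> <= lker h)%VS.
    apply/span_subvP => _ /allpairsP[[b b'] /= [bB b'B ->]].
    rewrite memv_ker; apply/eqP/rowP => j; rewrite ord1 hE mxE.
    have /genE[_ ->] // : b - b' \in gen (diffs B).
    by apply: mem_gen; exists [` bB]%fset, [` b'B]%fset.
  have := sub _ vB; rewrite memv_ker => /eqP/rowP/(_ 0).
  by rewrite hE mxE => /eqP; rewrite intr_eq0 => /eqP.
move=> v0; pose D := (\prod_i d i)%N.
have D0 : D%:R != 0 :> R.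
  by rewrite Num.Theory.pnatr_eq0 -lt0n prodn_gt0.
have : v *+ D \in gen (diffs B).
  apply/genE; split=> i; rewrite raddfMn mulmxnE; last by rewrite v0 mul0rn.
  by rewrite /D (bigD1 i) //= -mulr_natr natz PoszM mulrA mulrAC dvdz_mull.
have gsat w : w \in gen (diffs B) -> w \in satur R c B.
  move=> /asboolP; apply; first exact: satur_zmod_closed.
  move=> _ [b [b' ->]]; apply: memv_span; apply: allpairs_f; exact: valP.
move/gsat; rewrite -!topredE /= /satur /scalar_ext raddfMn raddfMn /= => vD.
rewrite -[map_mx _ _](scalerK D0).
by rewrite memvZ // scaler_nat.
Qed.

Lemma free_difflat : free_of_rank (difflat B) r.
Proof.
have [ci' c'K ciK] := c'_bij.
pose f (w : difflat B) : 'rV[int]_r := \row_i (c' (val w) 0%R (lshift s i) %/ (d i)%:Z)%Z.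
have fE w i : f w 0 i * (d i)%:Z = c' (difflat_incl B w) 0 (lshift s i).
  by rewrite mxE divzK //; have /genE[] := valP w.
have f_add : zmod_morphism f.
  move=> w w'; apply/rowP => i; apply: (mulIf (d_neq0 i)).
  transitivity (f w 0 i * (d i)%:Z - f w' 0 i * (d i)%:Z).
    by rewrite !fE (raddfB (difflat_incl B)) raddfB !mxE.
  by rewrite -mulrBl; move: (f w) (f w') => a a'; rewrite !mxE.
pose fA : {additive difflat B -> 'rV[int]_r} :=
  HB.pack f (GRing.isZmodMorphism.Build _ _ f f_add).
exists fA.
pose g0 (y : 'rV[int]_r) := ci' (row_mx (\row_i (y 0 i * (d i)%:Z)) 0).
have g0l y i : c' (g0 y) 0 (lshift s i) = y 0 i * (d i)%:Z.
  by rewrite ciK row_mxEl mxE.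
have g0r y i : c' (g0 y) 0 (rshift r i) = 0 by rewrite ciK row_mxEr mxE.
have g0P y : g0 y \in gen (diffs B).
  by apply/genE; split=> i; rewrite ?g0r // g0l dvdz_mull.
exists (fun y => Sub (g0 y) (g0P y) : subgroup (gen (diffs B))) => [w|y].
  apply: val_inj; rewrite SubK; apply: (bij_inj c'_bij); apply/rowP => j.
  case: (split_ordP j) => i ->; first by rewrite g0l fE.
  by rewrite g0r; have /genE[_ ->] := valP w.
by apply/rowP => i; apply: (mulIf (d_neq0 i)); rewrite fE; exact: g0l.
Qed.

Lemma free_satquot (R : realType) (n : nat) (c : {additive M -> 'rV[int]_n}) :
  bijective c -> free_of_rank (satquot R c B) s.
Proof.
move=> c_bij; have [ci' c'K ciK] := c'_bij.
pose M' := satquot R c B.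
pose f (w : M') : 'rV[int]_s := \row_i c' (repr w) 0 (rshift r i).
have piE (v v' : M) : v - v' \in satur R c B <-> \pi_M'%qT v = \pi_M'%qT v'.
  by rewrite Quotient.idealrBE; split=> [/eqP|->].
have fpi v : f (satproj R c B v) = \row_i c' v 0 (rshift r i).
  apply/rowP => i; rewrite !mxE; apply/eqP; rewrite -subr_eq0; apply/eqP.
  have /mem_satur : repr (\pi_M'%qT v) - v \in satur R c B by apply/piE; rewrite reprK.
  by move=> /(_ c_bij) /(_ i); rewrite raddfB !mxE.
have fB : zmod_morphism f.
  move=> w w'; rewrite -[w]reprK -[w']reprK.
  rewrite -[X in f (X - _)]/(satproj R c B (repr w)).
  rewrite -[X in f (_ - X)]/(satproj R c B (repr w')) -raddfB !fpi.
  by apply/rowP => i; rewrite raddfB !mxE.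
pose fA : {additive M' -> 'rV[int]_s} := HB.pack f (GRing.isZmodMorphism.Build _ _ f fB).
exists fA, (fun y => satproj R c B (ci' (row_mx 0 y))) => [w|y].
  rewrite -[RHS]reprK; apply/piE/mem_satur => // i.
  by rewrite raddfB ciK mxE [X in _ + X]mxE row_mxEr mxE subrr.
by rewrite [LHS]fpi; apply/rowP => i; rewrite mxE ciK row_mxEr.
Qed.

Section Characters.
Variable k : closedFieldType.

(** In adapted coordinates a character is extended by extracting roots of order
    [d i]. *)
Lemma torus_extend (chi : torus k (difflat B)) :
  exists t : torus k M, torus_map (difflat_incl B) t = chi.
Proof.
have [ci' c'K ciK] := c'_bij.
have f_subproof i : ci' ((d i)%:Z *: delta_mx 0 (lshift s i)) \in gen (diffs B).
  apply/genE; rewrite ciK; split=> j; rewrite !mxE eqxx /=.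
    have [->|/negPf ji] := eqVneq j i; first by rewrite eqxx mulr1.
    by rewrite (inj_eq (@lshift_inj _ _)) ji mulr0 dvdz0.
  by rewrite eq_shift mulr0.
pose f i : difflat B :=
  (Sub (ci' ((d i)%:Z *: delta_mx 0 (lshift s i))) (f_subproof i)
     : subgroup (gen (diffs B))).
have /choice[x xE] i := closed_field_root (chi (f i)) (d_gt0 i).
have x0 i : x i != 0.
  apply/eqP => xi; have := torus_neq0 chi (f i).
  by rewrite -xE xi expr0n gtn_eqF ?eqxx ?d_gt0.
pose t0 v : k := \prod_i x i ^ c' v 0 (lshift s i).
have t00 : t0 0 = 1 by rewrite /t0 big1 // => i _; rewrite raddf0 mxE expr0z.
have t0D v w : t0 (v + w) = t0 v * t0 w.
  rewrite /t0 -big_split; apply: eq_bigr => i _ /=.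
  by rewrite raddfD mxE expfzDr.
exists (Torus t00 t0D); apply: torus_ext => w.
pose q i : int := (c' (val w) 0%R (lshift s i) %/ (d i)%:Z)%Z.
have qE i : c' (val w) 0 (lshift s i) = q i * (d i)%:Z.
  by rewrite /q divzK //; have /genE[] := valP w.
have wE : w = \sum_i f i *~ q i.
  apply: val_inj; apply: (bij_inj c'_bij); apply/rowP => j.
  rewrite !raddf_sum summxE; under eq_bigr => i _.
    rewrite !raddfMz /= ciK -scaler_int intz scalerA !mxE eqxx /=.
    over.
  case: (split_ordP j) => i ->; last first.
    rewrite big1 => [|l _]; first by have /genE[_ ->] := valP w.
    by rewrite eq_shift mulr0.
  rewrite (bigD1 i) //= eqxx mulr1 qE big1 ?addr0 // => l /negPf li.
  by rewrite (inj_eq (@lshift_inj _ _)) eq_sym li mulr0.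
rewrite {2}wE torus_lincomb /=; apply: eq_bigr => i _.
by rewrite qE mulrC -exprz_exp -xE.
Qed.

Lemma torus_descend (R : realType) (n : nat) (c : {additive M -> 'rV[int]_n})
    (t : torus k M) :
  (forall v, v \in satur R c B -> t v = 1) ->
  exists chi, t = torus_map (satproj R c B) chi.
Proof.
move=> tB; pose M' := satquot R c B.
have piE (v v' : M) : \pi_M'%qT v = \pi_M'%qT v' -> t v = t v'.
  move=> vv'; have := tB (v - v'); rewrite Quotient.idealrBE vv' eqxx torusB.
  by move=> /(_ isT) E; rewrite -[LHS](divfK (torus_neq0 t v')) E mul1r.
have c0 : t (repr (0 : M')) = 1.
  by rewrite -(chi0 t); apply: piE; rewrite reprK -(raddf0 (satproj R c B)).
have cD (w w' : M') : t (repr (w + w')) = t (repr w) * t (repr w').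
  rewrite -chiD; apply: piE; rewrite reprK -[in LHS](reprK w) -[in LHS](reprK w').
  by rewrite -[RHS]/(satproj R c B (repr w + repr w')) raddfD.
exists (@Torus k M' (fun w => t (repr w)) c0 cD); apply: torus_ext => v.
by apply: piE; rewrite reprK.
Qed.

End Characters.

End AdaptedLattice.

(** * Linear embeddings of projective spaces *)

Section LinearEmbeddings.
Variables (k : closedFieldType) (q m : nat).

Definition mulmx_mpoly p1 p2 (A : 'M[k]_(p1, p2)) (F : {mpoly k[p2]}) : {mpoly k[p1]} :=
  mmap (@mpolyC p1 k) (fun j => \sum_i A i j *: 'X_i) F.

Lemma heval_mulmx p1 p2 (A : 'M[k]_(p1, p2)) F v :
  heval (mulmx_mpoly A F) v = heval F (v *m A).
Proof.
rewrite /heval /mulmx_mpoly rmorph_mmap /meval /mmap; apply: eq_bigr => mu _.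
rewrite /= -/(meval _ _) mevalC; congr (_ * _).
apply: eq_bigr => j _; rewrite /= rmorph_sum mxE; congr (_ ^+ _).
by apply: eq_bigr => i _; rewrite /= mevalZ mevalXU mulrC.
Qed.

Definition mulmx_hom (A : 'M[k]_(q, m)) : 'Hom('rV[k]_q, 'rV[k]_m) :=
  linfun (mulmxr A : 'rV[k]_q -> 'rV[k]_m).

Lemma mulmx_homE A v : mulmx_hom A v = v *m A.
Proof. by rewrite lfunE. Qed.

(** A linear embedding is a closed embedding, because it has a linear left
    inverse on its image, which is itself closed. *)
Lemma proj_image_closure (A : 'M[k]_(q, m)) (S : set (PP k q)) : row_free A ->
  proj_image (mulmx_hom A) (closure S) = closure (proj_image (mulmx_hom A) S).
Proof.
move=> fA; have /row_freeP[A' AA'] := fA.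
have nz (v : 'rV[k]_q) : v != 0 -> v *m A != 0.
  by apply: contra => /eqP vA; apply/eqP/(row_free_inj fA); rewrite vA mul0mx.
have im v (v0 : v != 0) s : line s = <[v]>%VS -> S s ->
    proj_image (mulmx_hom A) S (pt (nz v v0)).
  by move=> sv Ss; exists s => //=; rewrite sv limg_line mulmx_homE.
apply/seteqP; split=> y.
  move=> [x /closureP Sx yx]; apply/closureP => F FS; have [v v0 xv] := lineP x.
  have yv : line y = <[v *m A]>%VS by rewrite yx xv limg_line mulmx_homE.
  apply/(vanish_lineP _ yv) => a; rewrite scalemxAl -heval_mulmx.
  suff /vanish_lineP : vanish (mulmx_mpoly A F) x by apply.
  apply: Sx => s Ss; have [v' v'0 sv'] := lineP s.
  apply/(vanish_lineP _ sv') => b; rewrite heval_mulmx -scalemxAl.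
  by apply: FS (im v' v'0 s sv' Ss) _ _; rewrite /= memvZ ?memv_line.
move=> /closureP Sy; have [w w0 yw] := lineP y.
pose z := w *m A'.
have zA : z *m A = w.
  apply/rowP => i; apply/eqP; rewrite -subr_eq0; apply/eqP.
  pose F : {mpoly k[m]} := mulmx_mpoly (A' *m A - 1%:M) 'X_i.
  have FE v : heval F v = (v *m A' *m A) 0 i - v 0 i.
    by rewrite heval_mulmx mulmxBr mulmx1 /heval mevalXU mulmxA !mxE.
  rewrite /z -FE; have /Sy : forall y, proj_image (mulmx_hom A) S y -> vanish F y.
    move=> y' [s Ss y's]; have [v' v'0 sv'] := lineP s.
    have y'v : line y' = <[v' *m A]>%VS by rewrite y's sv' limg_line mulmx_homE.
    apply/(vanish_lineP _ y'v) => a; rewrite FE -!scalemxAl -(mulmxA v') AA' mulmx1.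
    by rewrite subrr.
  by move/(_ w); rewrite yw memv_line; apply.
have z0 : z != 0 by apply: contra w0 => /eqP z0; rewrite -zA z0 mul0mx.
exists (pt z0); last by rewrite yw /= limg_line mulmx_homE zA.
apply/closureP => F FS; apply/(vanish_lineP _ (erefl (line (pt z0)))) => a.
rewrite /z scalemxAl -heval_mulmx.
suff /vanish_lineP : vanish (mulmx_mpoly A' F) y by apply.
apply: Sy => y' [s Ss y's]; have [v' v'0 sv'] := lineP s.
have y'v : line y' = <[v' *m A]>%VS by rewrite y's sv' limg_line mulmx_homE.
apply/(vanish_lineP _ y'v) => b; rewrite heval_mulmx -scalemxAl -mulmxA AA' mulmx1.
by apply: FS Ss _ _; rewrite sv' memvZ ?memv_line.
Qed.

Lemma lker_mulmx_hom (A : 'M[k]_(q, m)) : row_free A -> lker (mulmx_hom A) = 0%VS.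
Proof.
move=> fA; apply/eqP/lker0P => v w; rewrite !mulmx_homE; exact: row_free_inj.
Qed.

Lemma proj_image_id (X : set (PP k m)) : proj_image \1%VF X = X.
Proof.
apply/seteqP; split=> y; first by move=> [x Xx]; rewrite lim1g => /PP_eq->.
by move=> Xy; exists y; rewrite ?lim1g.
Qed.

Lemma lker_id : lker (\1%VF : 'End('rV[k]_m)) = 0%VS.
Proof. by apply/eqP/lker0P => v w; rewrite !id_lfunE. Qed.

End LinearEmbeddings.

Section MonomialEmbeddings.
Variables (k : closedFieldType) (M : zmodType) (q m : nat) (w : 'I_q -> M).
Variables (h : 'I_m -> 'I_q) (kappa : 'I_m -> k).
Hypothesis h_surj : forall i, exists j, h j = i /\ kappa j != 0.

Definition emb_mx : 'M[k]_(q, m) := \matrix_(i, j) (kappa j *+ (h j == i)).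

Lemma mul_emb_mx v : v *m emb_mx = \row_j (kappa j * v 0 (h j)).
Proof.
apply/rowP => j; rewrite !mxE (bigD1 (h j)) //= mxE eqxx mulrC big1 ?addr0 //.
by move=> i /negPf ij; rewrite mxE eq_sym ij mulr0.
Qed.

Lemma emb_mx_free : row_free emb_mx.
Proof.
apply: inj_row_free => v; rewrite mul_emb_mx => v0; apply/rowP => i.
have [j [<- kj]] := h_surj i; move/rowP/(_ j): v0; rewrite !mxE => /eqP.
by rewrite mulf_eq0 (negPf kj) => /eqP.
Qed.

(** A family of exponents with repetitions and nonzero weights spans the same
    toric variety as the family without repetitions, up to a linear embedding;
    weights [0] account for coordinates vanishing identically. *)
Lemma proj_image_toric : (0 < q)%N ->
  proj_image (mulmx_hom emb_mx) (toric k w) =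
  closure [set y | exists t : torus k M,
             line y = <[\row_j (kappa j * t (w (h j)))]>%VS].
Proof.
move=> q_gt0; rewrite proj_image_closure ?emb_mx_free //; congr closure.
have embE (t : torus k M) : (\row_i t (w i)) *m emb_mx = \row_j (kappa j * t (w (h j))).
  by rewrite mul_emb_mx; apply/rowP => j; rewrite !mxE.
apply/seteqP; split=> y.
  move=> [x [t _ xt] yx]; exists t.
  by rewrite yx xt limg_line mulmx_homE embE.
move=> [t yt]; have nz : \row_i t (w i) != 0.
  by apply/rV0Pn; exists (Ordinal q_gt0); rewrite mxE torus_neq0.
exists (pt nz); first by exists t.
by rewrite yt /= limg_line mulmx_homE embE.
Qed.

End MonomialEmbeddings.

(** * The closure of the Gauss image *)

Lemma tangent_unique (k : fieldType) (m : nat) (X : set (PP k m)) x W W' :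
  is_tangent X x W -> is_tangent X x W' -> W = W'.
Proof.
by move=> tW tW'; apply/vspaceP => v; apply/idP/idP => /[dup] _;
  [move/tW/tW' | move/tW'/tW].
Qed.

Section GaussImage.
Variables (k : closedFieldType) (M : zmodType) (n : nat).
Variables (c : {additive M -> 'rV[int]_n}) (c_bij : bijective c).
Variables (N : nat) (u : 'I_N.+1 -> M) (Aff_u : Aff u = setT).

Local Notation XA := (toric k u).
Local Notation phi := (@toric_pt k M N u).
Local Notation G := (@tangent_mx k M n c N u).
Local Notation B := (Bset k c u).
Local Notation idx := (pluecker_index N.+1 n).
Local Notation detJ J := (affine_det k c u (val (enum_val J))).
Local Notation uJ J := (\sum_i u (val (enum_val J) i)).

Definition gamma_row (t : torus k M) : 'rV[k]_#|{: idx}| :=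
  \row_(J < #|{: idx}|) (detJ J * t (uJ J)).

Lemma minors_tangent_mx_row t : minors (G t) = gamma_row t.
Proof. by apply/rowP => J; rewrite minors_tangent_mx mxE. Qed.

Lemma exists_basis_ord : exists J : 'I_#|{: idx}|, detJ J != 0.
Proof.
have [J dJ] := exists_basis_index k c_bij Aff_u.
by exists (enum_rank J); rewrite enum_rankK.
Qed.

Lemma gamma_row_neq0 t : gamma_row t != 0.
Proof.
have [J dJ] := exists_basis_ord.
by apply/rV0Pn; exists J; rewrite mxE mulf_neq0 ?torus_neq0.
Qed.

Lemma line_pluecker_tangent_mx t : <[pluecker n (rowsp (G t))]>%VS = <[gamma_row t]>%VS.
Proof.
have [a a0 E] := pluecker_rowsp (tangent_mx_free c_bij Aff_u t).
by rewrite -minors_tangent_mx_row E vline_scale.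
Qed.

Lemma gauss_toric_pt_eq t W : gauss XA n (phi t) W -> W = rowsp (G t).
Proof.
move=> [_ _ tW _]; apply: tangent_unique tW _; exact: tangent_toric_pt.
Qed.

Definition gamma_torus : set (PP k #|{: idx}|) :=
  [set y | exists t, line y = <[gamma_row t]>%VS].

Lemma gamma_torus_gauss y : gamma_torus y -> gauss_image XA n y.
Proof.
move=> [t yt]; exists (phi t), (rowsp (G t)); split; first exact: gauss_toric_pt.
by rewrite yt line_pluecker_tangent_mx.
Qed.

(** By [gauss_closure], smooth points outside the torus do not enlarge the closure
    of the image. *)
Lemma closure_gauss_image : closure (gauss_image XA n) = closure gamma_torus.
Proof.
apply/seteqP; split; last by apply: closure_subset => y; exact: gamma_torus_gauss.
apply: closure_sub_closed; first exact: closed_closure.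
move=> y [x [W [[_ Xx tW dW] yW]]]; apply: closure_homog => F d hF FT.
apply/(vanish_homogP hF yW).
apply: (gauss_closure (S := toric_map_image u setT) _ Xx tW dW).
move=> _ [t _ /toric_mapP ->]; exists (rowsp (G t)); split.
- exact: tangent_toric_pt.
- by rewrite dim_rowsp ?tangent_mx_free.
have ptE : line (pt (gamma_row_neq0 t)) = <[pluecker n (rowsp (G t))]>%VS.
  by rewrite line_pluecker_tangent_mx.
by apply/(vanish_lineP F ptE); apply: FT; exists t.
Qed.

Lemma exists_Bset_embedding : exists h : 'I_#|{: idx}| -> 'I_#|{: B}|,
  (forall i, exists J : 'I_#|{: idx}|, h J = i /\ detJ J != 0) /\
  (forall J : 'I_#|{: idx}|, detJ J != 0 -> elems B (h J) = uJ J).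
Proof.
have inB (J : 'I_#|{: idx}|) : detJ J != 0 -> uJ J \in B.
  by move=> dJ; apply/mem_Bset; exists (enum_val J).
have [J0 dJ0] := exists_basis_ord.
have /choice[h hE] (J : 'I_#|{: idx}|) : exists i, detJ J != 0 -> elems B i = uJ J.
  have [dJ|dJ] := boolP (detJ J != 0); last by exists (enum_rank [` inB J0 dJ0]%fset).
  by exists (enum_rank [` inB J dJ]%fset); rewrite /elems enum_rankK.
exists h; split=> // i.
have [J [dJ JE]] := (mem_Bset k c u (elems B i)).1 (valP _).
exists (enum_rank J); rewrite enum_rankK; split=> //.
apply: enum_val_inj; apply: val_inj.
by rewrite -[LHS]/(elems B _) hE ?enum_rankK // -JE.
Qed.

Lemma gauss_image_toric :
  exists (m : nat)
        (j1 : 'Hom('rV[k]_#|{: idx}|, 'rV[k]_m))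
        (j2 : 'Hom('rV[k]_#|{: B}|, 'rV[k]_m)),
      proj_equiv_via j1 j2 (closure (gauss_image XA n))
                           (toric k (elems B)) /\
      forall t : torus k M, exists x W y z,
        [/\ toric_map u t x, gauss XA n x W,
            line y = <[pluecker n W]>%VS,
            forall b0 : B, orbit_map b0 (torus_map (difflat_incl B) t) z &
            (j1 @: line y)%VS = (j2 @: line z)%VS].
Proof.
have [h [h_surj hE]] := exists_Bset_embedding.
have [J0 dJ0] := exists_basis_ord.
have B0 : (0 < #|{: B}|)%N by apply: leq_ltn_trans (ltn_ord (h J0)).
have rowE (t : torus k M) :
    \row_(J < #|{: idx}|) (detJ J * t (elems B (h J))) = gamma_row t.
  apply/rowP => J; rewrite !mxE; have [->|dJ] := eqVneq (detJ J) 0.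
    by rewrite !mul0r.
  by rewrite hE.
exists #|{: idx}|, \1%VF, (mulmx_hom (emb_mx h (fun J : 'I_#|{: idx}| => detJ J))); split.
  split; [exact: lker_id | by rewrite lker_mulmx_hom ?emb_mx_free |].
  rewrite proj_image_id proj_image_toric // closure_gauss_image; congr closure.
  apply/seteqP; split=> y [t yt]; exists t; first by rewrite rowE.
  by rewrite yt rowE.
move=> t; have bnz : \row_i t (elems B i) != 0.
  by apply/rV0Pn; exists (h J0); rewrite mxE torus_neq0.
exists (phi t), (rowsp (G t)), (pt (gamma_row_neq0 t)), (pt bnz); split.
- exact/toric_mapP.
- exact: gauss_toric_pt.
- by rewrite line_pluecker_tangent_mx.
- move=> b0; rewrite /orbit_map /=.
  rewrite -(vline_scale _ (invr_neq0 (torus_neq0 t (val b0)))); congr <[_]>%VS.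
  by apply/rowP => i; rewrite !mxE /= torusB mulrC.
- rewrite lim1g /= limg_line mulmx_homE mul_emb_mx -rowE; congr <[_]>%VS.
  by apply/rowP => J; rewrite !mxE.
Qed.

End GaussImage.

(** * Components of the fibres *)

Section FiniteValues.
Variables (k : closedFieldType) (M : zmodType).

Lemma torus_level_closed v (z : k) : closed [set t : torus k M | t v = z].
Proof.
apply/torus_closedP.
exists [set monalg.mkmalgU v 1 - monalg.mkmalgU 0 z]; move=> t.
have E : teval (monalg.mkmalgU v 1 - monalg.mkmalgU 0 z) t = t v - z.
  by rewrite tevalE raddfB /= !monalg.mmapU /= chi0 mul1r mulr1.
split=> [/= tv _ ->|H]; first by rewrite E tv subrr.
by have := H _ erefl; rewrite E => /eqP; rewrite subr_eq0 => /eqP.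
Qed.

(** The level sets of a character are closed, so if finitely many of them cover an
    irreducible set, then one of them does. *)
Lemma irreducible_finite_values (F : set (torus k M)) v (p : {poly k}) :
  irreducible_set F -> p != 0 -> (forall t, F t -> root p (t v)) ->
  forall t t', F t -> F t' -> t v = t' v.
Proof.
move=> irrF p0 Fp; have [rs pE] := closed_field_poly_normal p.
have {Fp pE} Fr t : F t -> t v \in rs.
  by move=> /Fp; rewrite pE rootZ ?lead_coef_eq0 // root_prod_XsubC.
suff [z Fz] : exists z, forall t, F t -> t v = z by move=> t t' /Fz-> /Fz->.
have [[t1 Ft1] irr] := irrF.
elim: rs Fr => [|z rs IHrs] Fr; first by have := Fr t1 Ft1.
have cl : closed [set t : torus k M | t v \in rs].
  elim: (rs) => [|z' rs' IH].
    have -> : [set t : torus k M | t v \in [::]] = set0 by rewrite predeqE.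
    exact: closed0.
  have -> : [set t : torus k M | t v \in z' :: rs'] =
      [set t : torus k M | t v = z'] `|` [set t : torus k M | t v \in rs'].
    by rewrite predeqE => t; split=> /=; rewrite inE => /predU1P.
  by apply: closedU => //; exact: torus_level_closed.
case: (irr _ _ (@torus_level_closed v z) cl) => [t /Fr||] H.
- by move: H; rewrite inE => /predU1P.
- by exists z.
- exact: IHrs.
Qed.

End FiniteValues.

Section FibreComponents.
Variables (k : closedFieldType) (M : zmodType) (R : realType) (n : nat).
Variables (c : {additive M -> 'rV[int]_n}) (c_bij : bijective c).
Variables (N : nat) (u : 'I_N.+1 -> M) (Aff_u : Aff u = setT).
Variables (r s : nat).
Variables (c' : {additive M -> 'rV[int]_(r + s)}) (c'_bij : bijective c').
Variables (d : 'I_r -> nat) (d_gt0 : forall i, (0 < d i)%N).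
Local Notation B := (Bset k c u).
Hypothesis genE : forall v, v \in gen (diffs B) <->
  (forall i : 'I_r, ((d i)%:Z %| c' v 0%R (lshift s i))%Z) /\
  (forall i : 'I_s, c' v 0 (rshift r i) = 0).

Local Notation phi := (@toric_pt k M N u).
Local Notation G := (@tangent_mx k M n c N u).
Local Notation satB := (satur R c B).

Lemma gen_sub_satur v : v \in gen (diffs B) -> v \in satB.
Proof.
by move=> /genE[_ vB]; apply/(mem_satur d_gt0 genE R v c_bij).
Qed.

Definition subtorus_coset (t0 : torus k M) : set (torus k M) :=
  [set torus_mul t0 (torus_map (satproj R c B) chi) | chi in setT].

Lemma subtorus_cosetP t0 t :
  subtorus_coset t0 t <-> forall v, v \in satB -> t v = t0 v.
Proof.
split=> [[chi _ <-] v vB|H].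
  rewrite /= -[RHS]mulr1; congr (_ * _); rewrite -[RHS](chi0 chi); congr (chi _).
  by apply/eqP; rewrite -(raddf0 (satproj R c B)) -Quotient.idealrBE subr0.
have [|chi E] := @torus_descend M B k R n c (torus_mul t (torus_inv t0)).
  by move=> v /H /= ->; rewrite mulfV ?torus_neq0.
exists chi => //; rewrite -E; apply: torus_ext => v /=.
by rewrite mulrCA mulfV ?torus_neq0 ?mulr1.
Qed.

Let mu (i : nat) (a : k) (t : torus k M) : torus k M :=
  torus_mul (cochar (ncoord c' (r + i)) a) t.

Lemma ncoord_rshift (i : 'I_s) v : ncoord c' (r + i) v = c' v 0 (rshift r i).
Proof. exact: (ncoord_ord c' (rshift r i)). Qed.

(** A coset of the subtorus is obtained from one of its points by sweeping with the
    last [s] one-parameter subgroups in turn, hence is irreducible. *)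
Lemma coset_sweep t0 t : subtorus_coset t0 t -> sweep mu [set t0] s t.
Proof.
move=> /subtorus_cosetP tt0; have [e [ce eE]] := exists_basis c'_bij.
have [g gE] : exists g : torus k M, forall v, g v = t v / t0 v.
  by exists (torus_mul t (torus_inv t0)).
have g1 i : g (e (lshift s i)) = 1.
  rewrite gE tt0 ?mulfV ?torus_neq0 //; apply/(mem_satur d_gt0 genE R _ c_bij) => j.
  by rewrite ce mxE eqxx eq_rlshift.
pose y (i : nat) : k := if insub i is Some j then g (e (rshift r j)) else 1.
have y0 i : y i != 0.
  by rewrite /y; case: insub => [j|]; rewrite ?torus_neq0 ?oner_eq0.
pose gj j v := \prod_(i < j) y i ^ ncoord c' (r + i) v.
have gjs v : gj s v = g v.
  rewrite (torus_eq_basis g (eE v)) big_split_ord /=.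
  rewrite [X in _ = X * _]big1 ?mul1r => [|i _]; last by rewrite g1 exp1rz.
  by apply: eq_bigr => i _; rewrite /y valK ncoord_rshift.
suff H j : (j <= s)%N -> exists2 t', sweep mu [set t0] j t' &
    forall v, t' v = gj j v * t0 v.
  have [t' t's t'E] := H s (leqnn s).
  suff -> : t = t' by [].
  by apply: torus_ext => v; rewrite t'E gjs gE divfK ?torus_neq0.
elim: j => [_|j IHj js]; first by exists t0 => // v; rewrite /gj big_ord0 mul1r.
have [t' t'j t'E] := IHj (ltnW js).
exists (mu j (y j) t'); first by exists (y j), t'.
move=> v; rewrite /mu [LHS]/= unit_partE // t'E /gj big_ord_recr /=.
by rewrite mulrA [in RHS](mulrC (\prod_(i < j) _)).
Qed.

Lemma sweep_coset t0 t : sweep mu [set t0] s t -> subtorus_coset t0 t.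
Proof.
move=> ts; apply/subtorus_cosetP => v /(mem_satur d_gt0 genE R v c_bij) v0.
suff H j : (j <= s)%N -> forall t', sweep mu [set t0] j t' -> t' v = t0 v.
  exact: H ts.
elim: j => [_ t' ->//|j IHj js t' [a [t'' [a0 t''j ->]]]].
rewrite /= (IHj (ltnW js) _ t''j).
have -> : ncoord c' (r + j) v = 0 by rewrite (ncoord_rshift (Ordinal js)) v0.
by rewrite expr0z mul1r.
Qed.

Lemma irreducible_coset t0 : irreducible_set (subtorus_coset t0).
Proof.
have -> : subtorus_coset t0 = sweep mu [set t0] s.
  by apply/seteqP; split=> t; [exact: coset_sweep | exact: sweep_coset].
apply: irreducible_sweep => [|i a C _|i z C].
- split; first by exists t0.
  by move=> Z1 Z2 _ _ Z12; have [] := Z12 _ erefl; [left|right] => _ ->.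
- exact: torus_translate_closed.
- exact: torus_orbit_finite.
Qed.

Lemma torus_fiberP W t : torus_fiber n u W t <-> W = rowsp (G t).
Proof.
split=> [[x /toric_mapP -> gW]|->]; first exact: gauss_toric_pt_eq.
by exists (phi t); [exact/toric_mapP | exact: gauss_toric_pt].
Qed.

(** On a fibre the [d i]-th power of the i-th adapted coordinate is constant for
    the first [r] coordinates.  On an irreducible subset these coordinates are
    then constant themselves, so it lies in a single coset, which is irreducible
    and contained in the fibre. *)
Lemma component_coset W F : irreducible_component (torus_fiber n u W) F ->
  exists t0, F = subtorus_coset t0.
Proof.
move=> [irrF FW maxF]; have [[t0 Ft0] _] := irrF; exists t0.
have [e [ce eE]] := exists_basis c'_bij.
have Fgen t v : F t -> v \in gen (diffs B) -> t v = t0 v.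
  move=> /FW/torus_fiberP Wt vB; move: (FW _ Ft0) => /torus_fiberP Wt0.
  by have /rowsp_tangent_mxP : rowsp (G t) = rowsp (G t0); [rewrite -Wt | apply].
have deB i : e (lshift s i) *+ d i \in gen (diffs B).
  apply/genE; split=> j; rewrite raddfMn mulmxnE ce mxE eqxx /=.
    rewrite (inj_eq (@lshift_inj _ _)); have [->|_] := eqVneq j i.
      by rewrite mulr1n natz dvdzz.
    by rewrite mul0rn dvdz0.
  by rewrite eq_rlshift mul0rn.
have Fconst i t : F t -> t (e (lshift s i)) = t0 (e (lshift s i)).
  move=> Ft; pose p : {poly k} := 'X^(d i) - (t0 (e (lshift s i)) ^+ d i)%:P.
  apply: (irreducible_finite_values (p := p)) irrF _ _ _ _ Ft Ft0.
    by rewrite -size_poly_eq0 size_XnsubC.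
  by move=> t' Ft'; rewrite rootE !hornerE -!torusMn Fgen // subrr.
have FC : F `<=` subtorus_coset t0.
  move=> t Ft; apply/subtorus_cosetP => v /(mem_satur d_gt0 genE R v c_bij) v0.
  rewrite !(torus_eq_basis _ (eE v)) !big_split_ord /=; congr (_ * _).
    by apply: eq_bigr => i _; rewrite Fconst.
  by apply: eq_bigr => i _; rewrite v0 !expr0z.
apply/esym/maxF => //; first exact: irreducible_coset.
move=> t /subtorus_cosetP tt0; apply/torus_fiberP.
rewrite ((torus_fiberP W t0).1 (FW _ Ft0)); apply/rowsp_tangent_mxP => // v vB.
by rewrite tt0 ?gen_sub_satur.
Qed.

Lemma proj_equiv_coset t0 (piA := [fset satproj R c B (u i) | i in 'I_N.+1]%fset) :
  proj_equiv (closure (toric_map_image u (subtorus_coset t0))) (toric k (elems piA)).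
Proof.
have inA (j : 'I_N.+1) : satproj R c B (u j) \in piA by apply/imfsetP; exists j.
pose h j := enum_rank [` inA j]%fset.
have hE j : elems piA (h j) = satproj R c B (u j) by rewrite /elems enum_rankK.
have h_surj i : exists j, h j = i /\ t0 (u j) != 0.
  have /imfsetP[j _ jE] := valP (enum_val i : piA).
  exists j; rewrite torus_neq0; split=> //.
  by apply: enum_val_inj; apply: val_inj; rewrite enum_rankK jE.
exists N.+1, \1%VF, (mulmx_hom (emb_mx h (fun j => t0 (u j)))); split.
- exact: lker_id.
- by rewrite lker_mulmx_hom ?emb_mx_free.
rewrite proj_image_id proj_image_toric //; last exact: leq_ltn_trans (ltn_ord (h ord0)).
congr closure; apply/seteqP; split=> y.
  move=> [_ [chi _ <-] yt]; exists chi; rewrite yt; congr <[_]>%VS.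
  by apply/rowP => j; rewrite !mxE hE.
move=> [chi yt]; exists (torus_mul t0 (torus_map (satproj R c B) chi)).
  by exists chi.
by rewrite /toric_map yt; congr <[_]>%VS; apply/rowP => j; rewrite !mxE hE.
Qed.

End FibreComponents.

(** * The Gauss defect *)

Section GaussDefect.
Variables (k : closedFieldType) (M : zmodType) (n : nat).
Variables (c : {additive M -> 'rV[int]_n}) (c_bij : bijective c).
Variables (N : nat) (u : 'I_N.+1 -> M) (Aff_u : Aff u = setT).

Local Notation XA := (toric k u).
Local Notation phi := (@toric_pt k M N u).
Local Notation G := (@tangent_mx k M n c N u).
Local Notation B := (Bset k c u).
Local Notation idx := (pluecker_index N.+1 n).
Local Notation pidx := 'I_#|{: idx}|.
Local Notation detJ J := (affine_det k c u (val (enum_val J))).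
Local Notation uJ J := (\sum_i u (val (enum_val J) i)).
Local Notation grow := (@gamma_row k M n c N u).

(** Elements of the difference lattice of [B] are the zero-sum combinations of
    the sums over affine bases; as exponents of Pluecker coordinates these only
    involve coordinates that are nonzero on the image of the torus. *)
Lemma gen_combination v : v \in gen (diffs B) ->
  exists a : pidx -> int,
    [/\ \sum_J a J = 0, forall J, a J != 0 -> detJ J != 0 &
       v = \sum_(J : pidx) uJ J *~ a J].
Proof.
move=> /asboolP /(_ [pred v | `[< exists a : pidx -> int,
    [/\ \sum_J a J = 0, forall J, a J != 0 -> detJ J != 0 &
       v = \sum_(J : pidx) uJ J *~ a J] >]]).
rewrite inE /= => H; apply: H => [|w [b [b' ->]]].
  split=> [|w w']; rewrite !inE.
    exists (fun=> 0); split=> [|J|]; first by rewrite big1.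
      by rewrite eqxx.
    by rewrite big1 // => J _; rewrite mulr0z.
  move=> [a [a0 ad ->]] [a' [a'0 a'd ->]]; exists (fun J => a J - a' J); split.
  - by rewrite sumrB a0 a'0 subrr.
  - move=> J; have [aJ|/ad//] := eqVneq (a J) 0; rewrite aJ sub0r oppr_eq0.
    exact: a'd.
  - by rewrite -sumrB; apply: eq_bigr => J _; rewrite mulrzBr.
rewrite inE.
have [J [dJ JE]] := (mem_Bset k c u (val b)).1 (valP b).
have [J' [dJ' J'E]] := (mem_Bset k c u (val b')).1 (valP b').
exists (fun K => (K == enum_rank J)%:Z - (K == enum_rank J')%:Z).
have sum1 (J0 : idx) : \sum_(K : pidx) (K == enum_rank J0)%:Z = 1.
  by rewrite (bigD1 (enum_rank J0)) //= eqxx big1 ?addr0 // => K /negPf->.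
split.
- by rewrite sumrB !sum1 subrr.
- move=> K; case: (eqVneq K (enum_rank J)) => [->|_]; first by rewrite enum_rankK.
  by case: (eqVneq K (enum_rank J')) => [->|_]; rewrite ?enum_rankK // subrr eqxx.
have sumu (J0 : idx) :
    \sum_(K : pidx) uJ K *~ (K == enum_rank J0)%:Z = \sum_i u (val J0 i).
  rewrite (bigD1 (enum_rank J0)) //= eqxx mulr1z enum_rankK [X in _ + X]big1 ?addr0 //.
  by move=> K /negPf->.
under eq_bigr => K _ do rewrite mulrzBr.
by rewrite sumrB !sumu JE J'E.
Qed.

Lemma torus_combination (t : torus k M) (a : pidx -> int) :
  (forall J, a J != 0 -> detJ J != 0) ->
  \prod_(J : pidx) (grow t 0 J) ^ a J =
  (\prod_(J : pidx) detJ J ^ a J) * t (\sum_(J : pidx) uJ J *~ a J).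
Proof.
move=> ad; rewrite torus_lincomb -big_split; apply: eq_bigr => J _ /=.
have [->|/ad dJ] := eqVneq (a J) 0; first by rewrite !expr0z mulr1.
by rewrite mxE expfzMl.
Qed.

Lemma prod_affine_det_neq0 (a : pidx -> int) :
  (forall J, a J != 0 -> detJ J != 0) -> \prod_(J : pidx) detJ J ^ a J != 0.
Proof.
move=> ad; apply/prodf_neq0 => J _; have [->|/ad dJ] := eqVneq (a J) 0.
  by rewrite expr0z oner_neq0.
by rewrite expfz_neq0.
Qed.

(** Points of the closure of the Gauss image with nonzero coordinates at all
    affine bases come from the torus: the binomial equations of the closure say
    that the coordinates define a character of the difference lattice, which
    extends to the whole lattice. *)
Lemma gamma_torus_open y v :
  (forall chi : torus k (difflat B), exists t, torus_map (difflat_incl B) t = chi) ->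
  closure (@gamma_torus k M n c N u) y -> line y = <[v]>%VS ->
  (forall J : pidx, detJ J != 0 -> v 0 J != 0) -> exists t, line y = <[grow t]>%VS.
Proof.
move=> ext /closureP Ty yv vJ.
have v0 (J : pidx) : detJ J = 0 -> v 0 J = 0.
  move=> dJ; have : vanish 'X_J y.
    apply: Ty => y' [t y't]; apply/(vanish_lineP _ y't) => a.
    by rewrite /heval mevalXU !mxE dJ mul0r mulr0.
  by move/(_ v); rewrite yv memv_line /heval mevalXU; apply.
have rel (a : pidx -> int) : \sum_J a J = 0 ->
    (forall J, a J != 0 -> detJ J != 0) -> \sum_(J : pidx) uJ J *~ a J = 0 ->
    \prod_(J : pidx) (v 0 J / detJ J) ^ a J = 1.
  move=> a0 ad ua; pose b := \prod_(J : pidx) detJ J ^ a J.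
  have : vanish (binomial a b) y.
    apply: Ty => y' [t y't]; apply/(vanish_homogP (binomial_homog b a0) y't).
    apply/heval_binomial => [J /ad dJ|]; first by rewrite mxE mulf_neq0 ?torus_neq0.
    by rewrite torus_combination // ua chi0 mulr1.
  move/(vanish_homogP (binomial_homog b a0) yv)/heval_binomial.
  move=> /(_ (fun J aJ => vJ J (ad J aJ))) vb.
  under eq_bigr do rewrite expfzMl exprz_inv.
  rewrite big_split /= vb; under [X in _ * X]eq_bigr do rewrite -invr_expz.
  by rewrite prodfV mulfV // prod_affine_det_neq0.
have /choice[a aP] (w : difflat B) : exists a : pidx -> int,
    [/\ \sum_J a J = 0, forall J, a J != 0 -> detJ J != 0 &
       val w = \sum_(J : pidx) uJ J *~ a J].
  exact: gen_combination (valP w).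
pose f w := \prod_(J : pidx) (v 0 J / detJ J) ^ a w J.
(* Any expression of an element of the lattice computes the character. *)
have fE (w : difflat B) (b : pidx -> int) : \sum_J b J = 0 ->
    (forall J, b J != 0 -> detJ J != 0) -> val w = \sum_(J : pidx) uJ J *~ b J ->
    f w = \prod_(J : pidx) (v 0 J / detJ J) ^ b J.
  move=> b0 bd wE; have [a0 ad awE] := aP w.
  have := rel (fun J => a w J - b J).
  rewrite sumrB a0 b0 subrr => /(_ erefl).
  have abd J : a w J - b J != 0 -> detJ J != 0.
    by have [aJ|/ad//] := eqVneq (a w J) 0; rewrite aJ sub0r oppr_eq0; exact: bd.
  move/(_ abd); under eq_bigr => J _ do rewrite mulrzBr.
  rewrite sumrB -awE -wE subrr => /(_ erefl) fb.
  transitivity ((\prod_(J : pidx) (v 0 J / detJ J) ^ (a w J - b J)) *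
    \prod_(J : pidx) (v 0 J / detJ J) ^ b J); last by rewrite fb mul1r.
  rewrite -big_split; apply: eq_bigr => J _ /=.
  have [bJ|/bd dJ] := eqVneq (b J) 0; first by rewrite bJ subr0 expr0z mulr1.
  by rewrite -expfzDr ?subrK // mulf_neq0 ?invr_neq0 // vJ.
have f0 : f 0 = 1.
  rewrite (fE 0 (fun=> 0)); first by rewrite big1 // => J _; rewrite expr0z.
  - by rewrite big1.
  - by move=> J; rewrite eqxx.
  - by rewrite big1 // => J _; rewrite mulr0z.
have fD w w' : f (w + w') = f w * f w'.
  have [a0 ad wE] := aP w; have [a'0 a'd w'E] := aP w'.
  rewrite (fE _ (fun J => a w J + a w' J)).
  - rewrite -big_split; apply: eq_bigr => J _ /=.
    have [dJ|dJ] := eqVneq (detJ J) 0; last first.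
      by rewrite expfzDr // mulf_neq0 ?invr_neq0 // vJ.
    have z0 w0 : a w0 J = 0.
      apply/eqP; apply: contraT => nz; have [_ /(_ J nz)] := aP w0.
      by rewrite dJ eqxx.
    by rewrite !z0 addr0 expr0z mulr1.
  - by rewrite big_split /= a0 a'0 addr0.
  - move=> J; have [aJ|/ad//] := eqVneq (a w J) 0; rewrite aJ add0r; exact: a'd.
  - transitivity (val w + val w'); first by [].
    by rewrite wE w'E -big_split; apply: eq_bigr => J _; rewrite mulrzDr.
have [t tE] := ext (Torus f0 fD).
have [J0 dJ0] := @exists_basis_ord k M n c c_bij N u Aff_u.
exists t; rewrite yv; set z := v 0 J0 / (detJ J0 * t (uJ J0)).
have z0 : z != 0.
  by rewrite mulf_neq0 ?invr_neq0 ?mulf_neq0 ?torus_neq0 ?vJ.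
rewrite -(vline_scale (grow t) z0); congr <[_]>%VS; apply/rowP => J; rewrite !mxE.
have [dJ|dJ] := eqVneq (detJ J) 0; first by rewrite v0 // dJ mul0r mulr0.
have inB (K : pidx) : detJ K != 0 -> uJ K \in B.
  by move=> dK; apply/mem_Bset; exists (enum_val K).
have tf : t (uJ J - uJ J0) = f (diff [` inB J dJ]%fset [` inB J0 dJ0]%fset).
  by rewrite -[RHS]/(Torus f0 fD _) -tE.
pose rho (K : pidx) := v 0 K / detJ K.
have rho0 (K : pidx) : detJ K != 0 -> rho K != 0.
  by move=> dK; rewrite mulf_neq0 ?invr_neq0 ?vJ.
have delta_sum (K0 : pidx) : \sum_(K : pidx) (K == K0)%:Z = 1.
  by rewrite (bigD1 K0) //= eqxx big1 ?addr0 // => K /negPf->.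
have delta_prod (K0 : pidx) : \prod_(K : pidx) rho K ^ (K == K0)%:Z = rho K0.
  by rewrite (bigD1 K0) //= eqxx expr1z big1 ?mulr1 // => K /negPf->.
have delta_u (K0 : pidx) : \sum_(K : pidx) uJ K *~ (K == K0)%:Z = uJ K0.
  by rewrite (bigD1 K0) //= eqxx mulr1z [X in _ + X]big1 ?addr0 // => K /negPf->.
have fJ : f (diff [` inB J dJ]%fset [` inB J0 dJ0]%fset) = rho J / rho J0.
  rewrite (fE _ (fun K => (K == J)%:Z - (K == J0)%:Z)).
  - rewrite -(delta_prod J) -(delta_prod J0) -prodf_div; apply: eq_bigr => K _.
    case: (eqVneq K J) => [->|_]; first by rewrite expfzDr ?rho0 // invr_expz.
    case: (eqVneq K J0) => [->|_]; first by rewrite expfzDr ?rho0 // invr_expz.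
    by rewrite subrr !expr0z divr1.
  - by rewrite sumrB !delta_sum subrr.
  - move=> K; case: (eqVneq K J) => [->//|_].
    by case: (eqVneq K J0) => [->//|_]; rewrite subrr eqxx.
  - transitivity (\sum_(K : pidx) uJ K *~ (K == J)%:Z -
                  \sum_(K : pidx) uJ K *~ (K == J0)%:Z).
      by rewrite !delta_u.
    by rewrite -sumrB; apply: eq_bigr => K _; rewrite mulrzBr.
move: tf; rewrite fJ torusB => /eqP; rewrite eqr_div ?torus_neq0 ?rho0 // => /eqP.
move=> E; have {E} E : t (uJ J) * v 0 J0 * detJ J = v 0 J * t (uJ J0) * detJ J0.
  apply/eqP; rewrite -eqr_div //; apply/eqP.
  by rewrite -mulrA [RHS]mulrAC.
apply: (mulIf (mulf_neq0 dJ0 (torus_neq0 t (uJ J0)))).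
rewrite [RHS]mulrAC /z divfK ?mulf_neq0 ?torus_neq0 //.
transitivity (v 0 J * t (uJ J0) * detJ J0); first by rewrite mulrA mulrAC.
by rewrite -E -mulrA mulrCA; congr (_ * _); exact: mulrC.
Qed.

End GaussDefect.

Section FibreDimension.
Variables (k : closedFieldType) (M : zmodType) (n : nat).
Variables (c : {additive M -> 'rV[int]_n}) (c_bij : bijective c).
Variables (N : nat) (u : 'I_N.+1 -> M) (Aff_u : Aff u = setT).
Variables (r s : nat) (rs : (r + s)%N = n).
Variables (c' : {additive M -> 'rV[int]_(r + s)}) (c'_bij : bijective c').
Variables (d : 'I_r -> nat) (d_gt0 : forall i, (0 < d i)%N).
Local Notation B := (Bset k c u).
Hypothesis genE : forall v, v \in gen (diffs B) <->
  (forall i : 'I_r, ((d i)%:Z %| c' v 0%R (lshift s i))%Z) /\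
  (forall i : 'I_s, c' v 0 (rshift r i) = 0).

Local Notation XA := (toric k u).
Local Notation phi := (@toric_pt k M N u).
Local Notation G := (@tangent_mx k M n c N u).
Local Notation idx := (pluecker_index N.+1 n).
Local Notation pidx := 'I_#|{: idx}|.
Local Notation uJ J := (\sum_i u (val (enum_val J) i)).
Local Notation grow := (@gamma_row k M n c N u).

Definition gauss_fibre (y : PP k #|{: idx}|) : set (PP k N.+1) :=
  [set x | exists2 W, gauss XA n x W & line y = <[pluecker n W]>%VS].

Variables (y0 : PP k #|{: idx}|) (t1 : torus k M).
Hypothesis y0E : line y0 = <[grow t1]>%VS.

(** By equivariance, translating a point of the fibre by [g] multiplies each
    Pluecker coordinate by the corresponding character of [g]. *)
Lemma gauss_fibre_act g x : gauss_fibre y0 x -> exists W,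
  gauss XA n (act u g x) W /\ exists2 b, b != 0 &
    pluecker n W = b *: grow (torus_mul g t1).
Proof.
move=> [W gW y0W]; have [_ _ _ dW] := gW.
have fV := vbasis_mx_free dW; have VW := rowsp_vbasis_mx dW.
exists (rowsp (vbasis_mx n W *m torus_diag_mx u g)); split.
  by apply: gauss_act => //; rewrite VW.
have fVg : row_free (vbasis_mx n W *m torus_diag_mx u g).
  by rewrite /row_free mxrankMfree ?row_free_unit ?torus_diag_mx_unit.
have [b b0 bE] := pluecker_rowsp fVg.
have [b' b'0 b'E] := eq_vline (line_neq0 y0W) (etrans (esym y0W) y0E).
exists (b^-1 * b'); first by rewrite mulf_neq0 ?invr_neq0.
rewrite -scalerA -[LHS](scalerK b0) -bE; congr (_ *: _); apply/rowP => J.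
rewrite minors_torus_diag_mx -plueckerE b'E !mxE -!mulrA; congr (_ * (_ * _)).
exact: mulrC.
Qed.

(** The character [d j] times the j-th basis vector lies in <B - B>, so it is a
    quotient [H] of monomials in the Pluecker coordinates.  It is constant on the
    Gauss images of the points swept out so far, by [gauss_closure] also on those
    of the smooth points of their closure, but not along the next one-parameter
    subgroup. *)
Lemma fibre_sweep_strict (C : set (PP k N.+1)) (j : nat) :
  C !=set0 -> C `<=` gauss_fibre y0 -> (j < r)%N ->
  let E := sweep (act_cochar u (fun i => ncoord c' i : {additive M -> int})) C in
  exists2 x, E j.+1 x & ~ closure (E j) x.
Proof.
move=> [p Cp] Cy jr E; have [f fE] := ncoord_dual c'_bij.
pose jj := Ordinal jr; pose v := f j *+ d jj.
have cf i : c' (f j) 0 i = (i == j :> nat)%:Z by rewrite -ncoord_ord fE.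
have vB : v \in gen (diffs B).
  apply/genE; split=> i; rewrite raddfMn mulmxnE cf /=.
    have [ij|_] := eqVneq (i : nat) j; last by rewrite mul0rn dvdz0.
    have -> : i = jj by exact: val_inj.
    by rewrite natz dvdzz.
  by rewrite (_ : (r + i == j)%N = false) ?mul0rn // gtn_eqF // ltn_addr.
have [a [a0 ad vE]] := gen_combination vB.
have [al al0 ald] : exists2 al : k, al != 0 & al ^ (d jj)%:Z != 1.
  by apply: exists_unit_pow_neq1; rewrite eqz_nat -lt0n.
pose H := binomial a (\prod_J (grow t1 0 J) ^ a J).
have HE g b : b != 0 -> heval H (b *: grow (torus_mul g t1)) = 0 <-> g v = 1.
  move=> b0; rewrite /H heval_binomial => [|J /ad dJ]; last first.
    by rewrite !mxE !mulf_neq0 ?torus_neq0.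
  have -> : \prod_J (b *: grow (torus_mul g t1)) 0 J ^ a J =
      g v * \prod_J (grow t1 0 J) ^ a J.
    transitivity (\prod_J b ^ a J * \prod_J (grow (torus_mul g t1) 0 J) ^ a J).
      by rewrite -big_split; apply: eq_bigr => J _; rewrite mxE expfzMl.
    rewrite !torus_combination // -vE /= mulrCA [RHS]mulrCA; congr (_ * _).
    have -> : \prod_J b ^ a J = b ^ (\sum_J a J).
      rewrite (big_morph (fun z : int => b ^ z) (id1 := 1) (op1 := *%R)) //.
      by move=> y z; rewrite expfzDr.
    by rewrite a0 expr0z mul1r.
  have P0 : \prod_J grow t1 0 J ^ a J != 0.
    by rewrite torus_combination // mulf_neq0 ?torus_neq0 ?prod_affine_det_neq0.
  split=> [E1|->]; last by rewrite mul1r.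
  by apply: (mulIf P0); rewrite E1 mul1r.
pose g0 : torus k M := cochar (ncoord c' j) al.
exists (act u g0 p).
  exists al, p; split=> //; elim: (j) => // i IHi; exact: sub_act_sweep.
move=> clE; have [W [gW [b b0 bE]]] := gauss_fibre_act g0 (Cy p Cp).
have [_ _ tW dW] := gW.
have gv1 : g0 v = 1.
  apply/(HE g0 b b0); rewrite -bE.
  apply: (gauss_closure (S := E j) _ clE tW dW).
  move=> _ /act_sweep_elt[g [z [Cz -> gf]]].
  have [W' [[_ _ tW' dW'] [b' b'0 b'E]]] := gauss_fibre_act g (Cy z Cz).
  exists W'; split=> // e; rewrite b'E (heval_scale _ _ (binomial_homog _ a0)).
  rewrite (_ : heval _ _ = 0) ?mulr0 //; apply/HE => //.
  apply: gf => i ij; rewrite /v raddfMn /= fE ?(ltn_eqF ij) ?mul0rn //.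
  by rewrite (ltn_trans ij) // ltn_addr.
move: ald; rewrite -gv1 cocharE // /v raddfMn /= fE ?ltn_addr // eqxx.
by rewrite natz eqxx.
Qed.

(** The lower bound comes from the subtorus coset through [t1].  The upper bound
    prolongs a chain in the fibre by [r] sweeps to a chain in the toric variety,
    whose length is at most [n = r + s]. *)
Lemma krull_dim_gauss_fibre : krull_dim (gauss_fibre y0) s.
Proof.
have fibX : gauss_fibre y0 `<=` XA by move=> x [W [_ Xx _ _] _].
split; last first.
  move=> e C chC; rewrite -(leq_add2r r) [X in (_ <= X)%N]addnC rs.
  have [irrC _] := chC; have [irrCe CeE] := irrC e (leqnn e).
  have Ce : C e `<=` gauss_fibre y0 by rewrite CeE => x [].
  pose lam i : {additive M -> int} := ncoord c' i.
  apply: (chain_extension_le c_bij (u := u) (S := gauss_fibre y0)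
           (E := sweep (act_cochar u lam) (C e))) chC _ _ _ _ => //.
  - move=> j _; split; first exact: irreducible_act_sweep.
    by move=> _ /act_sweep_elt[g [z [/Ce/fibX Xz -> _]]]; exact: act_toric.
  - by move=> j _; exact: sub_act_sweep.
  - by move=> j jr; apply: fibre_sweep_strict => //; have [] := irrCe.
have [f fE] := ncoord_dual c'_bij.
pose lam i : {additive M -> int} := ncoord c' (r + i).
apply: (@sweep_toric_pt_chain _ _ _ _ Aff_u lam (fun i => f (r + i)%N) s _ _ _ t1).
- move=> i j si ji; rewrite /lam /= fE ?ltn_add2l ?(ltn_trans ji) //.
  by rewrite eqn_add2l (ltn_eqF ji).
- by move=> i si; rewrite /lam /= fE ?ltn_add2l // eqxx.
move=> g g1; exists (rowsp (G (torus_mul g t1))); first exact: gauss_toric_pt.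
have -> : rowsp (G (torus_mul g t1)) = rowsp (G t1).
  apply/rowsp_tangent_mxP => // v /genE[_ v0]; rewrite /= g1 ?mul1r // => i si.
  by rewrite /lam /= (ncoord_rshift _ (Ordinal si)) v0.
by rewrite line_pluecker_tangent_mx.
Qed.

End FibreDimension.

(** The open set is the locus where all Pluecker coordinates at affine bases are
    nonzero: its points in the closure of the image come from the torus. *)
Lemma gauss_defect_toric (k : closedFieldType) (M : zmodType) (n : nat)
    (c : {additive M -> 'rV[int]_n}) (N : nat) (u : 'I_N.+1 -> M) (r s : nat)
    (c' : {additive M -> 'rV[int]_(r + s)}) (d : 'I_r -> nat) :
  bijective c -> Aff u = setT -> (r + s)%N = n -> bijective c' ->
  (forall i, (0 < d i)%N) ->
  (forall v, v \in gen (diffs (Bset k c u)) <->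
    (forall i : 'I_r, ((d i)%:Z %| c' v 0%R (lshift s i))%Z) /\
    (forall i : 'I_s, c' v 0 (rshift r i) = 0)) ->
  gauss_defect (toric k u) n s.
Proof.
move=> c_bij Aff_u rs c'_bij d_gt0 genE.
pose good (J : 'I_#|{: pluecker_index N.+1 n}|) :=
  affine_det k c u (val (enum_val J)) != 0.
pose F : {mpoly k[#|{: pluecker_index N.+1 n}|]} :=
  'X_[[multinom nat_of_bool (good J) | J < _]].
have hF : exists e, F \is e.-homog by eexists; rewrite dhomogX.
have FE v : heval F v != 0 <-> forall J, good J -> v 0 J != 0.
  rewrite /heval mevalX; split=> [/prodf_neq0 H J gJ|H].
    by have := H J isT; rewrite mnmE gJ expr1.
  apply/prodf_neq0 => J _; rewrite mnmE; case gJ: (good J); last by rewrite oner_neq0.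
  by rewrite expr1 H.
exists [set y | ~ vanish F y]; split.
- rewrite PP_openE; exists [set F]; split=> [_ ->//|].
  by rewrite predeqE => y; split=> [nF|[_ ->//]]; exists F.
- exists (pt (gamma_row_neq0 c_bij Aff_u torus1)); split.
    move=> Fy; have := (FE (@gamma_row k M n c N u torus1)).2.
    rewrite Fy ?memv_line // eqxx => /(_ _)/negP; apply=> // J gJ.
    by rewrite mxE mulf_neq0 ?torus_neq0.
  by apply: subset_closure; apply: (gamma_torus_gauss c_bij Aff_u); exists torus1.
move=> y nFy; rewrite (closure_gauss_image k c_bij Aff_u) => Ty.
have [e hFe] := hF; have [v v0 yv] := lineP y.
have vJ J : good J -> v 0 J != 0.
  apply/FE: J; apply/eqP => Fv; apply: nFy.
  by apply/(vanish_homogP hFe yv).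
have [|t yt] := gamma_torus_open c_bij Aff_u _ Ty yv vJ.
  by move=> chi; apply: (torus_extend c'_bij d_gt0 genE).
exact: (krull_dim_gauss_fibre c_bij Aff_u rs c'_bij d_gt0 genE yt).
Qed.

Theorem theorem1p1 (k : closedFieldType) (R : realType)
    (n : nat) (M : zmodType)
    (c : {additive M -> 'rV[int]_n}) (c_bij : bijective c)
    (N : nat) (u : 'I_N.+1 -> M) (u_inj : injective u)
    (Aff_u : Aff u = setT) :
  let B : {fset M} := Bset k c u in
  let M' : zmodType := satquot R c B in
  let pi : {additive M -> M'} := satproj R c B in
  let piA : {fset M'} := [fset pi (u i) | i in 'I_N.+1]%fset in
  let XA : set (PP k N.+1) := toric k u in
  [/\
    exists (m : nat)
        (j1 : 'Hom('rV[k]_#|{: pluecker_index N.+1 n}|, 'rV[k]_m))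
        (j2 : 'Hom('rV[k]_#|{: B}|, 'rV[k]_m)),
      proj_equiv_via j1 j2 (closure (gauss_image XA n))
                           (toric k (elems B)) /\
      forall t : torus k M, exists x W y z,
        [/\ toric_map u t x, gauss XA n x W,
            line y = <[pluecker n W]>%VS,
            forall b0 : B, orbit_map b0 (torus_map (difflat_incl B) t) z &
            (j1 @: line y)%VS = (j2 @: line z)%VS],
    forall s : torus k (difflat B),
      exists t : torus k M, torus_map (difflat_incl B) t = s,
    forall (W : {vspace 'rV[k]_N.+1}) (F : set (torus k M)),
      irreducible_component (torus_fiber n u W) F ->
      (exists t0 : torus k M,
         F = [set torus_mul t0 (torus_map pi s) | s in setT]) /\
      proj_equiv (closure (toric_map_image u F)) (toric k (elems piA)) &
    exists r r' : nat,
      [/\ free_of_rank (difflat B) r, free_of_rank M' r',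
          r'%:Z = n%:Z - r%:Z & gauss_defect XA n r']].
Proof.
move=> B M' pi piA XA.
have [r [s [c' [d [rs c'_bij d_gt0 genE]]]]] := exists_adapted_basis c_bij B.
split.
- exact: gauss_image_toric.
- by move=> chi; apply: (torus_extend c'_bij d_gt0 genE).
- move=> W F compF.
  have [t0 FE] := component_coset R c_bij Aff_u c'_bij d_gt0 genE compF.
  split; first by exists t0.
  by rewrite FE; exact: proj_equiv_coset.
- exists r, s; split.
  + exact: (free_difflat c'_bij d_gt0 genE).
  + exact: (free_satquot c'_bij d_gt0 genE).
  + by rewrite -rs PoszD addrC addKr.
  + exact: (gauss_defect_toric c_bij Aff_u rs c'_bij d_gt0 genE).
Qed.
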